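(* Let $(X,d)$ be a metric space (the metric $d$ being allowed to take the value $+\infty$), let $K:X\to[0,+\infty]$, and let $x^-,x^+\in X$. Assume: (i) $(X,d)$ is complete and is a length space; (ii) $K$ is lower semicontinuous and the set $\Sigma:=\{x\in X: K(x)=0\}$ is finite; (iii) there exists a subset $F\subset X$ such that $F\cap\{K\le \ell\}$ is compact for every $\ell<+\infty$, and $$d_K(x^-,x^+)=\inf\{\mathfrak{L}_K(\gamma)\;:\;\gamma\in AC_{ploc}([0,1],X),\ \gamma:x^-\mapsto x^+,\ \mathrm{Im}(\gamma)\subset F\}.$$ If $d_K(x^+,x^-)<\infty$, then there exist an interval $I$ and a curve $\gamma\in \mathrm{Lip}_{ploc}(I,X)$ such that $\gamma:x^+\mapsto x^-$ and $\mathfrak{L}_K(\gamma)=d_K(x^+,x^-)$.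
   Context: A metric on $X$ is a map $d:X\times X\to[0,+\infty]$ which is symmetric, satisfies the triangle inequality, and vanishes exactly on the diagonal. A curve is a continuous map $\gamma:I\to X$ from a nonempty interval $I\subset\mathbb{R}$. $AC_{loc}$ and $\mathrm{Lip}_{loc}$ denote locally absolutely continuous and locally Lipschitz maps. $AC_{ploc}(I,X)$ (resp. $\mathrm{Lip}_{ploc}(I,X)$) is the set of continuous $\gamma:I\to X$ for which there exist $t_0=\inf I<t_1<\dots<t_n=\sup I$ such that $\gamma\in AC_{loc}((t_i,t_{i+1}),X)$ (resp. $\gamma\in \mathrm{Lip}_{loc}((t_i,t_{i+1}),X)$) for all $i$. For $\gamma\in AC_{ploc}(I,X)$ the metric derivative $|\dot\gamma|(t)=\lim_{s\to t} d(\gamma(t),\gamma(s))/|t-s|$ exists for a.e. $t$. $(X,d)$ is a length space if $d(x,y)=\inf\{L_d(\gamma):\gamma:x\mapsto y\}$ for all $x,y$, where $L_d(\gamma)=\sup\sum_i d(\gamma(t_i),\gamma(t_{i+1}))$ (supremum over finite sequences $t_0\le\dots\le t_N$ in $I$) is the length. The notation $\gamma:x\mapsto y$ for a curve $\gamma$ defined on an interval $I$ means $\gamma(\inf I)=x$ and $\gamma(\sup I)=y$, interpreted as limits when the endpoints do not belong to $I$. The $K$-length of $\gamma\in AC_{ploc}(I,X)$ is $\mathfrak{L}_K(\gamma)=\int_I K(\gamma(t))\,|\dot\gamma|(t)\,dt$, with the convention $+\infty\times 0=+\infty$ in the integrand. The $K$-distance is $d_K(x,y)=\inf\{\mathfrak{L}_K(\gamma):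 I\text{ an interval},\ \gamma\in AC_{ploc}(I,X),\ \gamma:x\mapsto y\}\in[0,+\infty]$ (one-point intervals are allowed, so $d_K(x,x)=0$). *)

(* Defs.v *)
From HB Require Import structures.
From mathcomp Require Import all_boot all_order all_algebra.
From mathcomp Require Import all_classical all_reals all_analysis.

Set Implicit Arguments.
Unset Strict Implicit.
Unset Printing Implicit Defensive.

Import Order.TTheory GRing.Theory Num.Theory.
Import numFieldNormedType.Exports.

Local Open Scope classical_set_scope.
Local Open Scope ring_scope.
Local Open Scope ereal_scope.

(* A metric with values in [0, +oo].  The last field says that the balls (hence
   the topology and the uniformity) of X are those of d: it is the analogue for
   +oo-valued distances of the library's ballEmdist.  Conversely, the sets
   [set y | d x y < e%:E] of any such d define a pseudoMetricType. *)
Record emetric (R : realType) (X : pseudoMetricType R)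
    (d : X -> X -> \bar R) : Prop := EMetric {
  emetric_ge0 : forall x y, 0 <= d x y ;
  emetric_eq0 : forall x y, d x y = 0 <-> x = y ;
  emetric_sym : forall x y, d x y = d y x ;
  emetric_triangle : forall y x z, d x z <= d x y + d y z ;
  emetric_ballE : forall (x : X) (e : R), ball x e = [set y | d x y < e%:E]
}.

(* A map I -> X is represented by a total gamma : R -> X whose values outside
   the interval I are never used. *)
Definition curve (R : realType) (X : pseudoMetricType R)
    (I : interval R) (gamma : R -> X) : Prop :=
  [set` I] !=set0 /\ {within [set` I], continuous gamma}.

(* gamma (inf I) = x.  A nonempty I has left bound `[a (BLeft a), `]a (BRight a)
   or -oo. *)
Definition starts_at (R : realType) (X : pseudoMetricType R)
    (I : interval R) (gamma : R -> X) (x : X) : Prop :=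
  let: Interval l _ := I in
  match l with
  | BSide true a => gamma a = x
  | BSide false a => gamma t @[t --> a^'+] --> x
  | BInfty _ => gamma t @[t --> -oo%R] --> x
  end.

(* gamma (sup I) = x.  A nonempty I has right bound b] (BRight b), b[ (BLeft b)
   or +oo. *)
Definition ends_at (R : realType) (X : pseudoMetricType R)
    (I : interval R) (gamma : R -> X) (x : X) : Prop :=
  let: Interval _ r := I in
  match r with
  | BSide false b => gamma b = x
  | BSide true b => gamma t @[t --> b^'-] --> x
  | BInfty _ => gamma t @[t --> +oo%R] --> x
  end.

Definition joins (R : realType) (X : pseudoMetricType R)
    (I : interval R) (gamma : R -> X) (x y : X) : Prop :=
  starts_at I gamma x /\ ends_at I gamma y.

Definition curve_length (R : realType) (X : pseudoMetricType R)
    (d : X -> X -> \bar R) (I : interval R) (gamma : R -> X) : \bar R :=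
  ereal_sup [set L | exists (N : nat) (t : nat -> R),
    [/\ forall i, (i <= N)%N -> t i \in I,
        forall i, (i < N)%N -> (t i <= t i.+1)%R &
        L = \sum_(i < N) d (gamma (t i)) (gamma (t i.+1))]].

Definition length_space (R : realType) (X : pseudoMetricType R)
    (d : X -> X -> \bar R) : Prop :=
  forall x y, d x y = ereal_inf [set L | exists (I : interval R) (gamma : R -> X),
    [/\ curve I gamma, joins I gamma x y & L = curve_length d I gamma]].

Definition abs_continuous_on (R : realType) (X : pseudoMetricType R)
    (d : X -> X -> \bar R) (a b : R) (gamma : R -> X) : Prop :=
  forall e : R, (0 < e)%R -> exists2 delta : R, (0 < delta)%R &
  forall (n : nat) (s t : nat -> R),
    (forall i, (i < n)%N -> [/\ a <= s i, s i <= t i & t i <= b]%R) ->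
    (forall i, (i.+1 < n)%N -> (t i <= s i.+1)%R) ->
    (\sum_(i < n) (t i - s i) < delta)%R ->
    \sum_(i < n) d (gamma (s i)) (gamma (t i)) < e%:E.

Definition ac_loc (R : realType) (X : pseudoMetricType R)
    (d : X -> X -> \bar R) (J : set R) (gamma : R -> X) : Prop :=
  forall a b : R, (a <= b)%R -> [set` `[a, b]] `<=` J ->
    abs_continuous_on d a b gamma.

Definition lip_loc (R : realType) (X : pseudoMetricType R)
    (d : X -> X -> \bar R) (J : set R) (gamma : R -> X) : Prop :=
  forall a b : R, (a <= b)%R -> [set` `[a, b]] `<=` J ->
    exists L : R, forall s t : R, s \in `[a, b] -> t \in `[a, b] ->
      d (gamma s) (gamma t) <= (L * `|s - t|)%:E.

(* P holds on each ]t_i, t_(i+1)[ for some subdivision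
   t_0 = inf I < t_1 < ... < t_n = sup I, computed in [-oo, +oo]. *)
Definition piecewise (R : realType) (P : set R -> Prop) (I : interval R) : Prop :=
  exists (n : nat) (t : nat -> \bar R),
    [/\ t 0%N = ereal_inf (EFin @` [set` I]),
        t n = ereal_sup (EFin @` [set` I]),
        forall i, (i < n)%N -> t i < t i.+1 &
        forall i, (i < n)%N -> P [set s : R | t i < s%:E < t i.+1]].

Definition ac_ploc (R : realType) (X : pseudoMetricType R)
    (d : X -> X -> \bar R) (I : interval R) (gamma : R -> X) : Prop :=
  curve I gamma /\ piecewise (fun J => ac_loc d J gamma) I.

Definition lip_ploc (R : realType) (X : pseudoMetricType R)
    (d : X -> X -> \bar R) (I : interval R) (gamma : R -> X) : Prop :=
  curve I gamma /\ piecewise (fun J => lip_loc d J gamma) I.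

(* For curves in ac_ploc the limit exists for a.e. t in I; where it does not,
   lim is a junk value. *)
Definition metric_derivative (R : realType) (X : pseudoMetricType R)
    (d : X -> X -> \bar R) (I : interval R) (gamma : R -> X) (t : R) : \bar R :=
  lim ((d (gamma t) (gamma s) * (`|t - s|^-1)%:E)
         @[s --> within [set` I] (t^')]).

(* Product on [0, +oo] with +oo * 0 = 0 * +oo = +oo, whereas the library's
   product has +oo * 0 = 0. *)
Definition mule_infty (R : realType) (x y : \bar R) : \bar R :=
  if (x == +oo) || (y == +oo) then +oo else x * y.

Definition Klength (R : realType) (X : pseudoMetricType R)
    (d : X -> X -> \bar R) (K : X -> \bar R)
    (I : interval R) (gamma : R -> X) : \bar R :=
  \int[lebesgue_measure]_(t in [set` I])
    mule_infty (K (gamma t)) (metric_derivative d I gamma t).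

Definition Kdist (R : realType) (X : pseudoMetricType R)
    (d : X -> X -> \bar R) (K : X -> \bar R) (x y : X) : \bar R :=
  ereal_inf [set L | exists (I : interval R) (gamma : R -> X),
    [/\ ac_ploc d I gamma, joins I gamma x y & L = Klength d K I gamma]].

(* Main.v *)
Require Import Defs.
From mathcomp Require Import all_boot all_order all_algebra.
From mathcomp Require Import all_classical all_reals all_analysis.
From mathcomp Require Import measurable_realfun.
From mathcomp Require Import ring lra zify.

(** Let D be the weighted distance from xm to xp.  The curve is a limit of curves
    in F whose weighted length tends to D.  The difficulty is that K controls
    neither the d-length of these curves, since moving near the zeros of K is
    cheap, nor their position, since only F `&` {K <= l} is compact.

    Each curve is run at constant speed for its clock, the length for the weight
    min (K, 1), which is at most the cost.  The clock controls distances
    uniformly (modulus): to move by e a curve must cross a shell around its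
    starting point; as K has finitely many zeros, a shell of definite width
    avoids all of them, K is bounded below there along F, and crossing it takes a
    definite amount of clock.  As to positions, leaving {K <= l} is expensive
    when l is large (excursion), so points of the curves are uniformly close to
    compact sets.  The curves are therefore equicontinuous and pointwise
    relatively compact, and have a continuous limit (limit_curve).

    Instead of the weighted length, two families of inequalities pass to the
    limit, on the intervals where K > c: speed_bound (min (c, 1) times the
    distance is at most the clock) and cost_bound (the cost is at least
    max (c, 1) times the clock).  Lower semicontinuity of K is what makes them
    stable.  They say nothing at the zeros of K, which the limit might visit on
    a large set of times; but the part of a curve between two visits to the same
    point can be removed at no cost (cut_loop), and there are finitely many
    zeros, so one may assume that each is visited at most once.  Between these
    visits speed_bound is a local Lipschitz bound (lip_ploc_of_speed_bound), and
    the two bounds together give weighted length at most D (Klength_le_cost).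
    Reversing time yields the curve from xp to xm.

    The underlying theory of absolutely continuous curves rests on the right
    lower derivative of the distance along the curve, which is measurable
    (right_speed).  The distance between two points of the curve is at most its
    integral (dist_le_int_speed), and a.e. it is the metric derivative
    (ae_has_speed).  Both come from comparing an integral with an increment given
    an infinitesimal one-sided comparison (growth, dist_le_int_speed), by
    continuous induction and Lebesgue differentiation. *)

Import Order.TTheory GRing.Theory Num.Theory.
Import numFieldNormedType.Exports.

Set Implicit Arguments.
Unset Strict Implicit.
Unset Printing Implicit Defensive.

Local Open Scope classical_set_scope.
Local Open Scope ring_scope.
Local Open Scope ereal_scope.

(** * Continuous induction and functions growing at a given rate *)

Section RealInduction.
Context {R : realType}.
Local Open Scope ring_scope.

(** The supremum of the points of [a, b] where P holds is one of them, since P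
    is closed from the left, and cannot be below b, since P propagates to the
    right.  All global estimates below are obtained from one-sided local ones by
    this principle. *)
Lemma real_induction (P : R -> Prop) (a b : R) : a <= b -> P a ->
  (forall t, a <= t < b -> P t -> exists2 s, t < s <= b & P s) ->
  (forall t, a < t <= b ->
    (forall e, 0 < e -> exists2 s, a <= s & t - e < s < t /\ P s) -> P t) ->
  P b.
Proof.
move=> ab Pa step closed.
pose S := [set t | a <= t <= b /\ P t].
have Sa : S a by split => //; rewrite lexx.
have supS : has_sup S by split; [exists a | exists b => t [/andP[]]].
have am : a <= sup S by apply: ub_le_sup Sa; case: supS.
have mb : sup S <= b by apply: ge_sup => [|t [/andP[]]]; first by exists a.
have Pm : P (sup S).
  have [<-//|am'] := eqVneq a (sup S).
  have [//|nPm] := pselect (P (sup S)).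
  apply: closed => [|e e0]; first by rewrite mb lt_neqAle am' am.
  have [t St et] := sup_adherent e0 supS.
  have [/andP[ta _] Pt] := St.
  exists t => //; split=> //; rewrite et lt_neqAle (ub_le_sup _ St) ?andbT; last by case: supS.
  by apply: contra_notN nPm => /eqP <-.
have [<-//|bm] := eqVneq (sup S) b.
have [|s /andP[ms sb] Ps] := step _ _ Pm; first by rewrite am lt_neqAle bm mb.
suff: s <= sup S by rewrite leNgt ms.
by apply: ub_le_sup; [case: supS | split=> //; rewrite (le_trans am (ltW ms)) sb].
Qed.

End RealInduction.

Section LebesguePoints.
Context {R : realType}.
Local Open Scope ring_scope.
Local Notation mu := (@lebesgue_measure R).

(** Lebesgue points in a form suited to one-sided intervals: A may be any
    measurable part of the ball, such as its right half. *)
Lemma lebesgue_pt_small (f : R -> R) (x : R) : lebesgue_pt f x ->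
  measurable_fun setT f ->
  forall e, 0 < e -> exists2 h0, 0 < h0 & forall h A, 0 < h < h0 ->
    measurable A -> A `<=` ball x h ->
    (\int[mu]_(y in A) `|f y - f x|%:E <= (e * h)%:E)%E.
Proof.
move=> fx mf e e0.
have e20 : 0 < e / 2 by rewrite divr_gt0.
move/fine_cvgP : fx => [[h1 /= h10 fin1] /cvgrPdist_lt /(_ _ e20)[h2 /= h20 small]].
exists (Num.min h1 h2) => [|h A /andP[h0 hh] mA Ah]; first by rewrite lt_min h10.
have hb1 : ball 0 h1 h by rewrite /ball/= sub0r normrN gtr0_norm //; move: hh; rewrite lt_min => /andP[].
have hb2 : ball 0 h2 h by rewrite /ball/= sub0r normrN gtr0_norm //; move: hh; rewrite lt_min => /andP[].
have := small _ hb2 h0; rewrite sub0r normrN; have := fin1 _ hb1 h0.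
rewrite /davg /iavg.
set I := integral _ _ _ => fin sm.
have I0 : (0 <= I)%E by apply: integral_ge0 => y _; rewrite lee_fin.
have : (\int[mu]_(y in A) `|f y - f x|%:E <= I)%E.
  rewrite /I; apply: ge0_subset_integral => //; first exact: measurable_ball.
  apply/measurable_EFinP; apply: measurable_funTS;
      by apply: measurableT_comp => //; apply: measurable_funB.
move=> /le_trans; apply.
clearbody I.
move: fin sm; rewrite lebesgue_measure_ball ?(ltW h0)// inver mulrn_eq0/= gt_eqF//.
case: I I0 => [r||] //= r0 fin; last first.
  by move: fin; rewrite gt0_muley ?lte_fin ?invr_gt0 ?mulrn_wgt0.
rewrite ger0_norm; last by rewrite mulr_ge0 ?invr_ge0 ?mulrn_wge0 ?(ltW h0)// -lee_fin.
rewrite mulrC ltr_pdivrMr ?mulrn_wgt0// lee_fin => /ltW /le_trans; apply.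
by rewrite (_ : e / 2 * (h *+ 2) = e * h)//; field.
Qed.

(** Openness is what is needed of the exceptional set: a point of V has a
    right neighbourhood inside V, so that continuous induction can cross V by
    steps whose total length is small. *)
Lemma ae_small_open (P : R -> Prop) : {ae mu, forall x, P x} ->
  forall e, 0 < e -> exists V, [/\ open V, (mu V < e%:E)%E &
    forall x, ~ V x -> P x].
Proof.
move=> [N [mN N0 PN]] e e0.
have N_fin : (mu N < +oo)%E by rewrite N0.
have [V [oO NO muO]] := lebesgue_regularity_outer mN N_fin e0.
exists V; split => //.
  have mO : measurable V by exact: open_measurable.
  rewrite -(setUIDK V N); apply: le_lt_trans.
    by apply: measureU2; [exact: measurableI | exact: measurableD].
  rewrite [X in (X + _)%E](_ : _ = 0%E) ?add0e//.
  apply/eqP; rewrite eq_le measure_ge0 andbT -N0.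
  by apply: le_measure; rewrite ?inE//; exact: measurableI.
by move=> x nOx; apply: contrapT => nPx; apply/nOx/NO/PN.
Qed.

Lemma open_right (V : set R) (t b : R) : open V -> V t -> t < b ->
  exists s, t < s <= b /\ [set` `[t, s]] `<=` V.
Proof.
move=> oO Ot tb; have /nbhs_ballP[e /= e0 tO] : nbhs t V by exact: open_nbhs_nbhs.
exists (Num.min b (t + e / 2)); split.
  by rewrite lt_min tb ge_min lexx /= andbT; lra.
move=> r /=; rewrite in_itv/= le_min => /and3P[tr rb rt].
by apply: tO; rewrite /ball/= distrC ger0_norm; lra.
Qed.

End LebesguePoints.

Section Growth.
Context {R : realType}.
Local Open Scope ring_scope.
Local Notation mu := (@lebesgue_measure R).

Lemma integral_itv_split (f : R -> \bar R) (a b c : R) : a <= b <= c ->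
  measurable_fun setT f -> (forall x, (0 <= f x)%E) ->
  (\int[mu]_(x in `[a, c]) f x =
    \int[mu]_(x in `[a, b]) f x + \int[mu]_(x in `[b, c]) f x)%E.
Proof.
move=> /andP[ab bc] mf f0.
have -> : [set` `[a, c]] = [set` `[a, b]] `|` [set` `]b, c]] :> set R.
  rewrite -itv_bndbnd_setU ?bnd_simp//.
rewrite ge0_integral_setU//=; last 2 first.
- exact: measurable_funTS.
- apply/disj_setPRL => z /=; rewrite !in_itv/= => /andP[bz _]; apply/negP.
  by rewrite negb_and -!ltNge bz orbT.
by congr (_ + _)%E; rewrite integral_itv_obnd_cbnd//; exact: measurable_funTS.
Qed.

Lemma measure_itvI_split (V : set R) (a t s : R) : open V -> a <= t <= s ->
  [set` `[t, s]] `<=` V ->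
  (mu (V `&` [set` `[a, s]]) = mu (V `&` [set` `[a, t]]) + (s - t)%:E)%E.
Proof.
move=> oO /andP[at_ ts] tsO.
have mO : measurable V by exact: open_measurable.
have -> : V `&` [set` `[a, s]] = V `&` [set` `[a, t]] `|` [set` `]t, s]].
  apply/seteqP; split => x /=; rewrite !in_itv/=.
    by move=> [Ox /andP[ax xs]]; have [xt|tx] := leP x t; [left|right; rewrite xs];
      rewrite ?ax.
  move=> [[Ox /andP[ax xt]]|/andP[tx xs]].
    by rewrite ax (le_trans xt ts).
  by split; [apply: tsO; rewrite /= in_itv/= ltW|rewrite xs (le_trans at_ (ltW tx))].
rewrite measureU//=; last 2 first.
- exact: measurableI.
- rewrite -subset0 => x [[_] /=]; rewrite !in_itv/= => /andP[_ xt] /andP[].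
  by rewrite ltNge xt.
congr (_ + _)%E; rewrite lebesgue_measure_itv/= lte_fin.
by case: (ltgtP t s) ts => // -> _; rewrite subrr.
Qed.

Lemma integral_itv_cst (c p q : R) : p <= q ->
  (\int[mu]_(y in `[p, q]) c%:E = (c * (q - p))%:E)%E.
Proof.
move=> pq; rewrite integral_cst//= lebesgue_measure_itv/= lte_fin -EFinB.
by case: (ltgtP p q) pq => // -> _; rewrite subrr mulr0 mule0.
Qed.

Lemma integral_near_const_le (f : R -> R) (x p q E : R) :
  measurable_fun setT f -> (forall y, 0 <= f y) -> p <= q ->
  (\int[mu]_(y in `[p, q]) `|f y - f x|%:E <= E%:E)%E ->
  (\int[mu]_(y in `[p, q]) (f y)%:E <= (f x * (q - p) + E)%:E)%E.
Proof.
move=> mf f0 pq fE.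
have mfE : measurable_fun setT (EFin \o f) by exact/measurable_EFinP.
have mfB : measurable_fun setT (fun y => `|f y - f x|%:E).
  by apply/measurable_EFinP; apply: measurableT_comp => //; exact: measurable_funB.
apply: (@le_trans _ _ (\int[mu]_(y in `[p, q]) ((f x)%:E + `|f y - f x|%:E))%E).
  apply: ge0_le_integral => //=.
  - by move=> y _; rewrite lee_fin.
  - exact: measurable_funTS.
  - by apply: measurable_funTS; apply: emeasurable_funD.
  - move=> y _; rewrite -EFinD lee_fin -lerBlDl; exact: ler_norm.
rewrite ge0_integralD//=; last 2 first.
- by move=> y _; rewrite lee_fin.
- exact: measurable_funTS.
by rewrite integral_itv_cst// EFinD leeD2l.
Qed.

Lemma integral_near_const_ge (f : R -> R) (x p q E : R) :
  measurable_fun setT f -> (forall y, 0 <= f y) -> p <= q ->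
  (\int[mu]_(y in `[p, q]) `|f y - f x|%:E <= E%:E)%E ->
  ((f x * (q - p))%:E <= \int[mu]_(y in `[p, q]) (f y)%:E + E%:E)%E.
Proof.
move=> mf f0 pq fE.
have mfE : measurable_fun setT (EFin \o f) by exact/measurable_EFinP.
have mfB : measurable_fun setT (fun y => `|f y - f x|%:E).
  by apply/measurable_EFinP; apply: measurableT_comp => //; exact: measurable_funB.
rewrite -integral_itv_cst//.
apply: (@le_trans _ _ (\int[mu]_(y in `[p, q]) ((f y)%:E + `|f y - f x|%:E))%E).
  apply: ge0_le_integral => //=.
  - by move=> y _; rewrite lee_fin.
  - by apply: measurable_funTS; apply: emeasurable_funD.
  - by move=> y _; rewrite -EFinD lee_fin -lerBlDl distrC; exact: ler_norm.
rewrite ge0_integralD//=; last 3 first.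
- by move=> y _; rewrite lee_fin.
- exact: measurable_funTS.
- exact: measurable_funTS.
by rewrite leeD2l.
Qed.

(** The integral over [a, t] is compared with V t - V a by continuous induction.
    At a Lebesgue point of f the average of f on a short interval to the right
    is close to f t, hence dominated by the increment of V.  The other points lie
    in a small open set, where f <= N makes the error at most N times the measure
    already crossed: this is the term N * m t of the induction predicate. *)
Lemma growth_bounded (f : R -> R) (V : R -> R) (N a b : R) : a <= b ->
  measurable_fun setT f -> (forall x, 0 <= f x <= N) ->
  locally_integrable setT f ->
  {in `[a, b] &, {homo V : x y / x <= y}} ->
  (forall t, a <= t < b -> forall c, c < f t ->
     exists2 h0, 0 < h0 & forall s, t < s < t + h0 -> s <= b ->
       c * (s - t) <= V s - V t) ->
  (\int[mu]_(x in `[a, b]) (f x)%:E <= (V b - V a)%:E)%E.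
Proof.
move=> ab mf f0N lf ndV growV.
have f0 x : 0 <= f x by case/andP: (f0N x).
have N0 : 0 <= N by case/andP: (f0N 0) => /le_trans; apply.
have mfE : measurable_fun setT (EFin \o f) by exact/measurable_EFinP.
have fE0 x : (0 <= (EFin \o f) x)%E by rewrite lee_fin.
have bndN s t : s <= t -> (\int[mu]_(x in `[s, t]) (f x)%:E <= (N * (t - s))%:E)%E.
  move=> st; apply: (@le_trans _ _ (\int[mu]_(x in `[s, t]) (cst N%:E x))%E).
    apply: ge0_le_integral => //=.
    - by move=> x _; rewrite lee_fin.
    - exact: measurable_funTS.
    - by move=> x _; rewrite lee_fin; case/andP: (f0N x).
  by rewrite integral_itv_cst.
apply/lee_addgt0Pr => e e0.
have e'0 : 0 < e / (b - a + N + 1) by rewrite divr_gt0//; lra.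
set e' := e / _ in e'0.
have [OO [oO muO nO]] := ae_small_open (lebesgue_differentiation lf) e'0.
have mOO : measurable OO by exact: open_measurable.
pose m t := mu (OO `&` [set` `[a, t]]).
have m_le t : (m t <= mu OO)%E by apply: le_measure; rewrite ?inE//; exact: measurableI.
pose P t : Prop := (\int[mu]_(x in `[a, t]) (f x)%:E <=
   (V t - V a + e' * (t - a))%:E + N%:E * m t)%E.
suff : P b.
  move=> /le_trans; apply; apply: (@le_trans _ _ ((V b - V a + e' * (b - a))%:E + N%:E * e'%:E)%E).
    by rewrite leeD2l// lee_wpmul2l ?lee_fin//; apply: (le_trans (m_le _)); exact: ltW.
  rewrite -EFinM -!EFinD lee_fin -addrA lerD2l mulrC -mulrDl /e' mulrA ler_pdivrMr; last lra.
  by rewrite mulrC ler_pM2l//; lra.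
apply: (@real_induction _ P a b) => //.
- rewrite /P set_itv1 integral_set1 !subrr mulr0 addr0 add0e.
  by rewrite mule_ge0// ?lee_fin.
- move=> t /andP[at_ tb] Pt.
  have aab : a \in `[a, b] by rewrite in_itv/= lexx.
  have tab : t \in `[a, b] by rewrite in_itv/= at_ ltW.
  have [Ot|nOt] := pselect (OO t).
    have [s [/andP[ts sb] tsO]] := open_right oO Ot tb.
    exists s; first by rewrite ts.
    have sab : s \in `[a, b] by rewrite in_itv/= sb (le_trans at_ (ltW ts)).
    rewrite /P (@integral_itv_split _ a t s)// ?at_ ?(ltW ts)//.
    rewrite /m (@measure_itvI_split OO a t s)// ?at_ ?(ltW ts)// ge0_muleDr//; last first.
      by rewrite lee_fin subr_ge0 ltW.
    rewrite [leRHS]addeA leeD//; last by rewrite -EFinM; apply: bndN; exact: ltW.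
    apply: (le_trans Pt); rewrite leeD2r// lee_fin lerD//.
      by rewrite lerD2r; exact: (ndV _ _ tab sab (ltW ts)).
    by rewrite ler_wpM2l// ?(ltW e'0)//; lra.
  have [h1 h10 sm1] := lebesgue_pt_small (nO _ nOt) mf (e := e' / 4) ltac:(lra).
  have [h2 h20 sm2] := growV t ltac:(by rewrite at_) (f t - e' / 2) ltac:(lra).
  pose h := Num.min (b - t) (Num.min (h1 / 4) (h2 / 2)).
  have h0 : 0 < h by rewrite !lt_min; apply/and3P; split; lra.
  have hb : h <= b - t by rewrite ge_min lexx.
  have hh1 : h <= h1 / 4 by rewrite !ge_min lexx orbT.
  have hh2 : h <= h2 / 2 by rewrite !ge_min lexx !orbT.
  have sab : t + h \in `[a, b] by rewrite in_itv/=; lra.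
  exists (t + h); first by apply/andP; split; lra.
  rewrite /P (@integral_itv_split _ a t (t + h))//; last by apply/andP; split; lra.
  apply: (@le_trans _ _ (((V t - V a + e' * (t - a))%:E + N%:E * m t) +
      (V (t + h) - V t + e' * h)%:E)%E).
    have tth : t <= t + h by lra.
    apply: leeD => //; apply: (le_trans (integral_near_const_le mf f0 tth
        (sm1 (h + h) _ _ _ _))) => //; first by apply/andP; split; lra.
      move=> x /=; rewrite in_itv/= => /andP[tx xth].
      by rewrite /ball/= distrC ger0_norm; lra.
    have := sm2 (t + h) ltac:(by apply/andP; split; lra) ltac:(lra).
    by rewrite lee_fin; lra.
  rewrite [leLHS]addeAC leeD//; first by rewrite -EFinD lee_fin; lra.
  rewrite lee_wpmul2l ?lee_fin//; apply: le_measure; rewrite ?inE.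
  + exact: measurableI.
  + exact: measurableI.
  + move=> x /= [Ox]; rewrite !in_itv/= => /andP[ax xt]; split => //.
    by rewrite ax/=; lra.
- move=> t /andP[at_ tb] closeP.
  apply/lee_addgt0Pr => d d0.
  have d'0 : 0 < d / (N + 1) by rewrite divr_gt0//; lra.
  have [s as_ [/andP[ds st] Ps]] := closeP _ d'0.
  rewrite (@integral_itv_split _ a s t)//; last by rewrite as_ ltW.
  apply: leeD; last first.
    apply: (le_trans (bndN _ _ (ltW st))); rewrite lee_fin.
    apply: (@le_trans _ _ ((N + 1) * (d / (N + 1)))).
      by rewrite ler_pM//; lra.
    by rewrite mulrC divfK//; lra.
  apply: (le_trans Ps); rewrite leeD//.
    rewrite lee_fin lerD//; last by rewrite ler_wpM2l ?(ltW e'0)//; lra.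
    by rewrite lerD2r; apply: ndV; rewrite ?in_itv/=; lra.
  rewrite lee_wpmul2l ?lee_fin//; apply: le_measure; rewrite ?inE.
  + exact: measurableI.
  + exact: measurableI.
  + move=> x /= [Ox]; rewrite !in_itv/= => /andP[ax xt]; split => //.
    by rewrite ax/=; lra.
Qed.

(** A nondecreasing V whose right lower Dini derivative dominates f grows at
    least as much as the integral of f; the bounded case is applied to the
    truncations of f. *)
Lemma growth (f : R -> \bar R) (V : R -> R) (a b : R) : a <= b ->
  measurable_fun setT f -> (forall x, (0 <= f x)%E) ->
  {in `[a, b] &, {homo V : x y / x <= y}} ->
  (forall t, a <= t < b -> forall c, (c%:E < f t)%E ->
     exists2 h0, 0 < h0 & forall s, t < s < t + h0 -> s <= b ->
       c * (s - t) <= V s - V t) ->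
  (\int[mu]_(x in `[a, b]) f x <= (V b - V a)%:E)%E.
Proof.
move=> ab mf f0 ndV growV.
pose g (n : nat) x := Order.min (f x) n%:R%:E.
have g0 n x : (0 <= g n x)%E by rewrite /g le_min f0 lee_fin ler0n.
have gn n x : (g n x <= n%:R%:E)%E by rewrite /g ge_min lexx orbT.
have gfin n x : g n x \is a fin_num by rewrite ge0_fin_numE// (le_lt_trans (gn n x))// ltry.
have mg n : measurable_fun setT (g n) by exact: measurable_mine.
have limg x : limn (g^~ x) = f x.
  apply/cvg_lim => //; case E: (f x) (f0 x) => [r||] // r0.
    apply: cvg_near_cst; near=> n.
    rewrite /g E min_l// lee_fin.
    near: n; exact: nbhs_infty_ger.
  apply/cvgeyPge => A; near=> n; rewrite /g E min_r ?leey// lee_fin.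
  by near: n; exact: nbhs_infty_ger.
have -> : (\int[mu]_(x in `[a, b]) f x = limn (fun n => \int[mu]_(x in `[a, b]) g n x))%E.
  rewrite -monotone_convergence//.
  - by apply: eq_integral => x _; rewrite limg.
  - by move=> n; exact: (measurable_funTS (mg n)).
  - move=> x _ n m nm; rewrite /g le_min ge_min lexx/= ge_min lee_fin ler_nat nm orbT//.
apply: lime_le.
  apply: ereal_nondecreasing_is_cvgn => n m nm; apply: ge0_le_integral => //.
  - exact: (measurable_funTS (mg n)).
  - exact: (measurable_funTS (mg m)).
  - move=> x _; rewrite /g le_min ge_min lexx/= ge_min lee_fin ler_nat nm orbT//.
near=> n.
have gE x : g n x = (fine (g n x))%:E by rewrite fineK.
have -> : (\int[mu]_(x in `[a, b]) g n x = \int[mu]_(x in `[a, b]) (fine (g n x))%:E)%E.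
  by apply: eq_integral => x _; exact: gE.
have mfg : measurable_fun setT (fun x => fine (g n x)).
  by apply/measurable_EFinP; apply: eq_measurable_fun (mg n) => x _; rewrite /= -gE.
have fg0n x : 0 <= fine (g n x) <= n%:R.
  by rewrite fine_ge0//= -lee_fin -gE gn.
apply: (@growth_bounded _ _ n%:R) => //.
  split => //; first exact: openT.
  move=> K _ cK; have [M [_ KM]] := compact_bounded cK.
  have mK : measurable K by exact: compact_measurable.
  apply: (@le_lt_trans _ _ (\int[mu]_(x in K) (cst n%:R%:E x))%E).
    apply: ge0_le_integral => //=.
    - by apply/measurable_EFinP/measurableT_comp => //; exact: measurable_funTS.
    - by move=> x _; rewrite lee_fin ger0_norm; case/andP: (fg0n x).
  rewrite integral_cst//= lte_mul_pinfty//.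
  exact: compact_finite_measure.
move=> t tab c cg; apply: growV => //.
by apply: (lt_le_trans (_ : c%:E < g n t)%E); [rewrite gE lte_fin|rewrite /g ge_min lexx].
Unshelve. all: by end_near. Qed.

End Growth.

(** * Right speed of a curve *)

Section EMetric.
Context {R : realType} {X : pseudoMetricType R} (d : X -> X -> \bar R).
Hypothesis dm : emetric d.
Local Open Scope ring_scope.

Let d_ge0 x y : (0 <= d x y)%E := emetric_ge0 dm x y.

Lemma emetric_xx x : d x x = 0%E.
Proof. by apply/(emetric_eq0 dm). Qed.

Lemma emetric_ballP x y e : ball x e y <-> (d x y < e%:E)%E.
Proof. by rewrite (emetric_ballE dm). Qed.

Lemma emetric_small0 x y : (forall e, 0 < e -> (d x y < e%:E)%E) -> x = y.
Proof.
move=> xy; apply/(emetric_eq0 dm)/eqP; rewrite eq_le d_ge0 andbT.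
by apply/lee_addgt0Pr => e e0; rewrite add0e ltW// xy.
Qed.

Lemma emetric_lt_open x y (c : R) : (c%:E < d x y)%E ->
  exists2 e, 0 < e & forall x' y', (d x x' < e%:E)%E -> (d y y' < e%:E)%E ->
    (c%:E < d x' y')%E.
Proof.
move=> cd; have [e e0 ce] : exists2 e, 0 < e & ((c + 2 * e)%:E < d x y)%E.
  case: (d x y) cd => [r||]//; last by exists 1; rewrite ?ltry.
  by rewrite lte_fin => cr; exists ((r - c) / 3); rewrite ?lte_fin; lra.
exists e => // x' y' xx' yy'; rewrite ltNge; apply/negP => d'c.
have : (d x y <= (c + 2 * e)%:E)%E; last by rewrite leNgt ce.
apply: (le_trans (emetric_triangle dm x' _ _)).
rewrite (_ : c + 2 * e = e + (c + e)); last lra.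
rewrite EFinD leeD ?(ltW xx')//.
apply: (le_trans (emetric_triangle dm y' _ _)).
by rewrite EFinD leeD// (emetric_sym dm) ltW.
Qed.

Lemma curve_close (g : R -> X) t : {for t, continuous g} ->
  forall e, 0 < e -> exists2 h, 0 < h & forall s, `|s - t| < h ->
    (d (g t) (g s) < e%:E)%E.
Proof.
move=> gt e e0; have /nbhs_ballP[h /= h0 th] := gt _ (nbhsx_ballx (g t) e e0).
exists h => // s st; apply/emetric_ballP/th.
by rewrite /ball/= distrC.
Qed.

Lemma measurable_dist_shift (g : R -> X) h : continuous g ->
  measurable_fun setT (fun t => d (g t) (g (t + h))).
Proof.
move=> cg; apply: lower_semicontinuous_measurable => t c cd.
have [e e0 de] := emetric_lt_open cd.
have [h1 h10 th1] := curve_close (cg t) e0.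
have [h2 h20 th2] := curve_close (cg (t + h)) e0.
exists (ball t (Num.min h1 h2)).
  by apply: nbhsx_ballx; rewrite lt_min h10.
move=> s; rewrite /ball/= distrC lt_min => /andP[s1 s2].
apply: de; first exact: th1.
by apply: th2; rewrite (_ : s + h - (t + h) = s - t)//; ring.
Qed.

Definition rat_step (k : nat) : R := ratr (odflt 0 (unpickle k)).

(** Steps outside the allowed range contribute +oo, the neutral element of the
    infimum, so that the infimum can be taken over all of nat. *)
Definition step_quotient (g : R -> X) (n k : nat) (t : R) : \bar R :=
  if 0 < rat_step k < n.+1%:R^-1
  then (d (g t) (g (t + rat_step k)%R) * (rat_step k)^-1%:E)%E else +oo%E.

(** The right lower derivative liminf_(h -> 0+) d (g t) (g (t + h)) / h, along
    rational h to be measurable as a countable combination; for continuous g the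
    restriction to rational steps is harmless. *)
Definition right_speed (g : R -> X) (t : R) : \bar R :=
  ereal_sup (range (fun n => ereal_inf (range (fun k => step_quotient g n k t)))).

Lemma step_quotient_ge0 g n k t : (0 <= step_quotient g n k t)%E.
Proof.
rewrite /step_quotient; case: ifP => [/andP[h0 _]|_]; last exact: leey.
by rewrite mule_ge0// lee_fin invr_ge0 ltW.
Qed.

Lemma right_speed_ge0 g t : (0 <= right_speed g t)%E.
Proof.
apply: (@le_trans _ _ (ereal_inf (range (fun k => step_quotient g 0 k t)))).
  by apply: le_ereal_inf_tmp => _ [k _ <-]; exact: step_quotient_ge0.
by apply: ereal_sup_ubound; exists 0%N.
Qed.

Lemma measurable_right_speed g : continuous g ->
  measurable_fun setT (right_speed g).
Proof.
move=> cg.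
have mq n k : measurable_fun setT (step_quotient g n k).
  have [hk|/negbTE hk] := boolP (0 < rat_step k < n.+1%:R^-1); last first.
    apply: (eq_measurable_fun (cst +oo%E)); last exact: measurable_cst.
    by move=> t _; rewrite /step_quotient hk.
  apply: (eq_measurable_fun (fun t => d (g t) (g (t + rat_step k)%R) * (rat_step k)^-1%:E)%E).
    by move=> t _; rewrite /step_quotient hk.
  by apply: emeasurable_funM => //; exact: measurable_dist_shift.
have mi n : measurable_fun setT (fun t => einfs (fun k => step_quotient g n k t) 0%N).
  by apply: (measurable_fun_einfs (f := fun k t => step_quotient g n k t)) => k; exact: mq.
have := measurable_fun_esups (f := fun n t => einfs (fun k => step_quotient g n k t) 0%N)
   mi 0%N.
by apply: eq_measurable_fun => t _; rewrite /esups/einfs /sdrop /right_speed/=;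
  congr (ereal_sup _); apply/seteqP; split => _ [n _ <-]; exists n => //=;
  congr (ereal_inf _); apply/seteqP; split => _ [k _ <-]; exists k.
Qed.

(** A real step is approximated by rational ones: if s violated the bound, so
    would t + q for all rational q close to s - t, by continuity of g at s. *)
Lemma right_speed_gt g t c : continuous g -> (c%:E < right_speed g t)%E ->
  exists2 h0, 0 < h0 & forall s, t < s < t + h0 ->
    ((c * (s - t))%:E <= d (g t) (g s))%E.
Proof.
move=> cg /ereal_sup_gt[_ [n _ <-] cn].
exists n.+1%:R^-1 => [|s /andP[ts sn]]; first by rewrite invr_gt0.
rewrite leNgt; apply/negP => dc.
have dfin : d (g t) (g s) \is a fin_num by rewrite ge0_fin_numE// (lt_trans dc)// ltry.
move: dc; rewrite -(fineK dfin); set r := fine _; rewrite lte_fin => rc.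
(* half of the defect goes to moving s, half to changing the length of the step *)
have e0 : 0 < (c * (s - t) - r) / 2 by lra.
set e := _ / 2 in e0.
have [h1 h10 gs] := curve_close (cg s) e0.
pose h2 := Num.min h1 (e / (`|c| + 1)).
have c1 : 0 < `|c| + 1 by have := normr_ge0 c; lra.
have h20 : 0 < h2 by rewrite lt_min h10 divr_gt0.
have lo_hi : Num.max 0 (s - t - h2) < Num.min n.+1%:R^-1 (s - t + h2).
  have sN : s - t < n.+1%:R^-1 by rewrite ltrBlDl.
  rewrite gt_max !lt_min invr_gt0 ltr0n /=; apply/and3P; split.
  - by clear sn sN; lra.
  - by apply: lt_trans sN; clear sn; lra.
  - by clear sn sN; lra.
have [q] := rat_in_itvoo lo_hi.
rewrite in_itv/= gt_max lt_min => /andP[/andP[q0 qlo] /andP[qn qhi]].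
have qh : `|ratr q - (s - t)| < h2 by rewrite ltr_norml; lra.
have : (c%:E < step_quotient g n (pickle q) t)%E.
  by apply: (lt_le_trans cn); apply: ereal_inf_lbound; exists (pickle q).
rewrite /step_quotient /rat_step pickleK/= q0 qn/=.
have dq : (d (g t) (g (t + ratr q)%R) <= (c * ratr q)%:E)%E.
  apply: (le_trans (emetric_triangle dm (g s) _ _)).
  rewrite -(fineK dfin) -/r.
  have : (d (g s) (g (t + ratr q)%R) <= e%:E)%E.
    apply/ltW/gs; rewrite (_ : t + _ - s = ratr q - (s - t)); last ring.
    by rewrite (lt_le_trans qh)// ge_min lexx.
  move=> /(leeD2l r%:E)/le_trans; apply; rewrite -EFinD lee_fin.
  have : `|c * (ratr q - (s - t))| <= e.
    rewrite normrM (@le_trans _ _ ((`|c| + 1) * (e / (`|c| + 1))))//.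
      apply: ler_pM => //; first by lra.
      by rewrite (le_trans (ltW qh))// ge_min lexx orbT.
    by rewrite mulrC divfK// gt_eqF.
  rewrite ler_norml mulrBr => /andP[ceq _].
  have -> : r = c * (s - t) - 2 * e by rewrite /e; lra.
  lra.
move=> /lt_le_trans /(_ (lee_wpmul2r _ dq)).
rewrite lee_fin invr_ge0 (ltW q0) => /(_ isT).
by rewrite -EFinM mulfK ?ltxx// gt_eqF.
Qed.

Lemma right_speed_lt g t c : (right_speed g t < c%:E)%E ->
  forall h, 0 < h -> exists2 s, t < s < t + h & (d (g t) (g s) <= (c * (s - t))%:E)%E.
Proof.
move=> tc h h0; have [n _ nh] := near_infty_natSinv_lt (PosNum h0).
have nh' : n.+1%:R^-1 < h by have := nh n (leqnn n).
have : (ereal_inf (range (fun k => step_quotient g n k t)) < c%:E)%E.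
  by apply: le_lt_trans tc; apply: ereal_sup_ubound; exists n.
move=> /ereal_inf_lt[_ [k _ <-]].
rewrite /step_quotient; case: ifP => // /andP[k0 kn] kc.
have kh := lt_trans kn nh'.
exists (t + rat_step k); first by apply/andP; split; lra.
have := ltW kc; rewrite lee_pdivrMr// => /le_trans; apply.
by rewrite -EFinM lee_fin (_ : t + _ - t = rat_step k)//; ring.
Qed.

End EMetric.

Lemma adde_regroup (R : numDomainType) (A B C D E : \bar R) :
  A + B + C + (D + E) = A + D + (B + E) + C.
Proof. by rewrite (AC (3*2) ((1*4)*(2*5)*3)). Qed.

(** * Absolutely continuous curves and the integral of their right speed *)

Section Chains.
Context {R : realType} {X : pseudoMetricType R} (d : X -> X -> \bar R).
Hypothesis dm : emetric d.
Variable g : R -> X.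
Local Open Scope ring_scope.
Local Notation mu := (@lebesgue_measure R).

Let d_ge0 x y : (0 <= d x y)%E := emetric_ge0 dm x y.

(** chain a t l S: there are finitely many successive intervals in [a, t], of
    total length l, on which the increments of g add up to S.  These are the
    families occurring in the definition of absolute continuity, built one
    interval at a time from the left as continuous induction does. *)
Inductive chain (a : R) : R -> R -> \bar R -> Prop :=
| chain0 : chain a a 0 0%E
| chainS t l S s u : chain a t l S -> t <= s -> s <= u ->
    chain a u (l + (u - s)) (S + d (g s) (g u))%E.

Lemma chain_ge t a l S : chain a t l S -> [/\ a <= t, 0 <= l <= t - a & (0 <= S)%E].
Proof.
elim=> [|{}t {}l {}S s u _ [at_ /andP[l0 lt_] S0] ts su]; first by split; rewrite ?subrr ?lexx.
split; [lra | by apply/andP; split; lra | by rewrite adde_ge0].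
Qed.

Lemma chain_seq a t l S : chain a t l S -> exists (n : nat) (s u : nat -> R),
  [/\ forall i, (i < n)%N -> [/\ a <= s i, s i <= u i & u i <= t],
      forall i, (i.+1 < n)%N -> u i <= s i.+1,
      \sum_(i < n) (u i - s i) = l &
      (\sum_(i < n) d (g (s i)) (g (u i)))%E = S].
Proof.
elim=> [|{}t {}l {}S p q ch [n [s [u [su us sl sS]]]] tp pq].
  by exists 0%N, (fun=> 0), (fun=> 0); split => //; rewrite big_ord0.
have [at_ _ _] := chain_ge ch.
exists n.+1, (fun i => if (i < n)%N then s i else p),
  (fun i => if (i < n)%N then u i else q); split.
- move=> i; rewrite ltnS leq_eqVlt => /predU1P[->|i_n].
    by rewrite ltnn; split; lra.
  by rewrite i_n; have [? ? ?] := su _ i_n; split; lra.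
- move=> i; rewrite ltnS => i_n; rewrite i_n.
  case: ltnP => [i1n|ni1]; first exact: us.
  by have [_ _] := su _ i_n; lra.
- rewrite big_ord_recr/= ltnn; congr (_ + _); rewrite -sl.
  by apply: eq_bigr => i _; rewrite ltn_ord.
- rewrite big_ord_recr/= ltnn; congr (_ + _)%E; rewrite -sS.
  by apply: eq_bigr => i _; rewrite ltn_ord.
Qed.

(** The hypothesis is the inner clause of absolute continuity, for one fixed
    pair e, delta. *)
Lemma chain_ac a b e delta : 
  (forall (n : nat) (s t : nat -> R),
    (forall i, (i < n)%N -> [/\ a <= s i, s i <= t i & t i <= b]) ->
    (forall i, (i.+1 < n)%N -> (t i <= s i.+1)) ->
    (\sum_(i < n) (t i - s i) < delta) ->
    (\sum_(i < n) d (g (s i)) (g (t i)) < e%:E)%E) ->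
  forall t l S, chain a t l S -> t <= b -> l < delta -> (S <= e%:E)%E.
Proof.
move=> ac t l S /chain_seq[n [s [u [su us <- <-]]]] tb ld.
by apply/ltW/ac => // i /su[? ? ?]; split => //; lra.
Qed.

(** The best sum over chains whose total length is at most len t.  With
    len t = t - a this is the variation of g; with len t the measure of the
    part of [a, t] in an open set V it is the variation that can be spent in V,
    which absolute continuity makes small when V is small. *)
Definition chain_sup (len : R -> \bar R) (a t : R) : \bar R :=
  ereal_sup [set S | exists t' l, [/\ chain a t' l S, t' <= t & (l%:E <= len t)%E]].

Lemma chain_sup_mono len a s t : s <= t -> (len s <= len t)%E ->
  (chain_sup len a s <= chain_sup len a t)%E.
Proof.
move=> st lst; apply: le_ereal_sup => S [t' [l [ch t's ls]]].
by exists t', l; split => //; [exact: le_trans st|exact: le_trans lst].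
Qed.

Lemma chain_sup_ge0 len a t : a <= t -> (0 <= len t)%E -> (0 <= chain_sup len a t)%E.
Proof. by move=> at_ l0; apply: ereal_sup_ubound; exists a, 0; split => //; exact: chain0. Qed.

Lemma chain_sup_step len a s t : a <= s <= t -> (0 <= len s)%E ->
  (len s + (t - s)%:E <= len t)%E ->
  (chain_sup len a s + d (g s) (g t) <= chain_sup len a t)%E.
Proof.
move=> /andP[as_ st] l0 lst.
have lstep t' l S : chain a t' l S -> t' <= s -> (l%:E <= len s)%E ->
    (S + d (g s) (g t) <= chain_sup len a t)%E.
  move=> ch t's ls; apply: ereal_sup_ubound; exists t, (l + (t - s)).
  split => //; first exact: chainS ch t's st.
  by rewrite EFinD (le_trans _ lst)// leeD2r.
have [dfin|dinf] := boolP (d (g s) (g t) \is a fin_num).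
  by rewrite -leeBrDr//; apply: ge_ereal_sup => S [t' [l [ch t's ls]]];
    rewrite leeBrDr//; exact: lstep ch t's ls.
have dE : d (g s) (g t) = +oo%E by apply/eqP; rewrite -leye_eq leNgt -ge0_fin_numE.
have := lstep _ _ _ (chain0 a) as_ l0.
by rewrite add0e dE leye_eq => /eqP ->; rewrite leey.
Qed.

End Chains.

Section MetricSpeed.
Context {R : realType} {X : pseudoMetricType R} (d : X -> X -> \bar R).
Hypothesis dm : emetric d.
Variable g : R -> X.
Hypothesis cg : continuous g.
Local Open Scope ring_scope.
Local Notation mu := (@lebesgue_measure R).
Local Notation rho := (right_speed d g).

Let d_ge0 x y : (0 <= d x y)%E := emetric_ge0 dm x y.
Let rho_ge0 t : (0 <= rho t)%E := right_speed_ge0 dm g t.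
Let mrho : measurable_fun setT rho := measurable_right_speed dm cg.

Lemma ac_sub a b s t : a <= s -> t <= b ->
  abs_continuous_on d a b g -> abs_continuous_on d s t g.
Proof.
move=> as_ tb ac e e0; have [delta delta0 H] := ac e e0.
exists delta => // n p q pq qp; apply: H => // i /pq[sp pq' qt].
by split => //; lra.
Qed.

(** The variation of g on [s, t] is at most 1 by absolute continuity with e = 1,
    and grows at least at the right speed. *)
Lemma right_speed_short a b : a <= b -> abs_continuous_on d a b g ->
  exists2 delta, 0 < delta & forall s t, a <= s -> s <= t -> t <= b ->
    t - s < delta -> (\int[mu]_(x in `[s, t]) rho x <= 1)%E.
Proof.
move=> ab ac; have [delta delta0 H] := ac 1 ltr01.
exists delta => // s t as_ st tb stdelta.
pose len u : \bar R := (u - s)%:E.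
pose W u := chain_sup d g len s u.
have W1 u : u <= t -> (W u <= 1)%E.
  move=> ut; apply: ge_ereal_sup => S [t' [l [ch t'u lu]]].
  apply: (@chain_ac _ _ d dm g s t 1 delta _ _ _ _ ch).
  - move=> n p q pq; apply: H => i /pq[sp pq' qt].
    by split => //; lra.
  - lra.
  - by rewrite (le_lt_trans _ stdelta)//; move: lu; rewrite lee_fin; lra.
have W0 u : s <= u -> (0 <= W u)%E.
  by move=> su; apply: chain_sup_ge0 => //; rewrite lee_fin; lra.
have Wfin u : s <= u <= t -> W u = (fine (W u))%:E.
  move=> /andP[su ut]; rewrite fineK// ge0_fin_numE ?W0//.
  by rewrite (le_lt_trans (W1 _ ut))// ltry.
apply: (@le_trans _ _ (fine (W t) - fine (W s))%:E).
  apply: (@growth _ rho (fun u => fine (W u)) s t) => //.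
    move=> u v; rewrite !in_itv/= => /andP[su ut] /andP[sv vt] uv.
    rewrite -lee_fin -!Wfin ?su ?sv//; apply: chain_sup_mono => //.
    by rewrite lee_fin; lra.
  move=> u /andP[su ut] c cu.
  have [h0 h00 Hu] := right_speed_gt dm cg cu.
  exists h0 => // v uv vt; have := Hu _ uv.
  move/andP: uv => [uv _] cd; rewrite -lee_fin; apply: (le_trans cd).
  rewrite EFinB -!Wfin ?su ?(ltW ut)//; last by rewrite vt andbT; lra.
  rewrite leeBrDr; last by rewrite Wfin// su ltW.
  rewrite addeC; apply: chain_sup_step => //.
  - by rewrite su ltW.
  - by rewrite lee_fin; lra.
  - by rewrite -EFinD lee_fin; lra.
rewrite lee_fin; have : fine (W t) <= 1 by rewrite -lee_fin -Wfin ?W1// st lexx.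
have : 0 <= fine (W s) by rewrite fine_ge0// W0.
lra.
Qed.

Lemma right_speed_integrable a b : a <= b -> abs_continuous_on d a b g ->
  (\int[mu]_(x in `[a, b]) rho x < +oo)%E.
Proof.
move=> ab ac; have [delta delta0 H] := right_speed_short ab ac.
pose P t : Prop := (\int[mu]_(x in `[a, t]) rho x < +oo)%E.
apply: (@real_induction _ P a b) => //.
- by rewrite /P set_itv1 integral_set1 ltry.
- move=> t /andP[at_ tb] Pt.
  exists (Num.min b (t + delta / 2)).
    by rewrite lt_min ge_min tb lexx /= andbT; lra.
  set s := Num.min _ _.
  have sb : s <= b by rewrite ge_min lexx.
  have sd : s <= t + delta / 2 by rewrite ge_min lexx orbT.
  have ts : t <= s by rewrite le_min (ltW tb); lra.
  rewrite /P (@integral_itv_split _ _ a t s)// ?at_//.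
  apply: lte_add_pinfty => //.
  by rewrite (le_lt_trans (H _ _ _ _ _ _))// ?ltry//; lra.
- move=> t /andP[at_ tb] /(_ _ delta0)[s as_ [/andP[ds st] Ps]].
  rewrite /P (@integral_itv_split _ _ a s t)// ?as_ ?(ltW st)//.
  apply: lte_add_pinfty => //.
  by rewrite (le_lt_trans (H _ _ _ _ _ _))// ?ltry//; lra.
Qed.

(** A locally integrable real-valued representative of rho on [a, b], as
    required by the differentiation theorem. *)
Definition fin_speed (a b : R) : R -> R := (fine \o rho) \_ [set` `[a, b]].

Lemma fin_speed_ge0 a b x : 0 <= fin_speed a b x.
Proof. by rewrite /fin_speed patchE; case: ifP => // _; rewrite fine_ge0. Qed.

Lemma fin_speedE a b x : x \in `[a, b] -> fin_speed a b x = fine (rho x).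
Proof. by move=> xab; rewrite /fin_speed patchE mem_set. Qed.

Lemma measurable_fin_speed a b : measurable_fun setT (fin_speed a b).
Proof.
apply/(measurable_restrictT _ _).1 => //; apply: measurable_funTS.
by apply: (measurableT_comp (f := fine)) => //; exact: measurable_fine.
Qed.

Section OnInterval.
Variables a b : R.
Hypothesis ab : a <= b.
Hypothesis ac : abs_continuous_on d a b g.

Let irho : mu.-integrable `[a, b] rho.
Proof.
apply/integrableP; split; first exact: measurable_funTS.
under eq_integral do rewrite gee0_abs//.
exact: right_speed_integrable.
Qed.

Let lf : locally_integrable setT (fin_speed a b).
Proof.
apply: integrable_locally => //; apply: le_integrable irho => //.
  by apply: measurable_funTS; apply/measurable_EFinP/(measurableT_comp (f := fine)) => //;
     exact: measurable_fine.
move=> x xab; rewrite gee0_abs ?lee_fin ?fine_ge0// gee0_abs//=.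
by case: (rho x) (rho_ge0 x) => [r||]//= _; rewrite leey.
Qed.

Lemma ae_fin_speed : {ae mu, forall x,
  lebesgue_pt (fin_speed a b) x /\ (x \in `[a, b] -> (rho x < +oo)%E)}.
Proof.
have := integrable_ae _ irho; move=> /(_ (measurable_itv _)) H1.
have H2 := lebesgue_differentiation lf.
apply: filterS2 H1 H2 => x /= fx lx; split => // /fx.
by rewrite ge0_fin_numE.
Qed.

Lemma integral_fin_speed s t : a <= s -> t <= b ->
  (\int[mu]_(x in `[s, t]) rho x = \int[mu]_(x in `[s, t]) (fin_speed a b x)%:E)%E.
Proof.
move=> as_ tb; apply: ge0_ae_eq_integral => //.
- exact: measurable_funTS.
- by apply: measurable_funTS; apply/measurable_EFinP; exact: measurable_fin_speed.
- by move=> x _; rewrite lee_fin fin_speed_ge0.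
suff : {ae mu, forall x, [set` `[s, t]] x -> rho x = (fin_speed a b x)%:E} by [].
apply: (@filterS _ _ (ae_filter_ringOfSetsType mu) _ _ _ ae_fin_speed) => x [_ xfin] /=.
rewrite in_itv/= => /andP[sx xt].
have xab : x \in `[a, b] by rewrite in_itv/=; lra.
by rewrite fin_speedE// fineK// ge0_fin_numE// xfin.
Qed.

End OnInterval.

(** Continuous induction on t.  At a Lebesgue point of rho some s > t arbitrarily
    close satisfies d (g t) (g s) <= (rho t + e) (s - t), and rho t (s - t) is
    close to the integral of rho over [t, s].  The remaining points lie in an
    open set V of measure less than delta, and the increments of g across V add
    up to at most e' by absolute continuity; chain_sup is what has been spent so
    far of this budget. *)
Lemma dist_le_int_speed a b : a <= b -> abs_continuous_on d a b g ->
  (d (g a) (g b) <= \int[mu]_(x in `[a, b]) rho x)%E.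
Proof.
move=> ab ac; set f := fin_speed a b.
have f_ge0 : forall x, 0 <= f x by exact: fin_speed_ge0.
have mf : measurable_fun setT f := measurable_fin_speed a b.
have mfE : measurable_fun setT (EFin \o f) by exact/measurable_EFinP.
have good := ae_fin_speed ab ac.
rewrite (integral_fin_speed ab ac)//; apply/lee_addgt0Pr => e e0.
have e'0 : 0 < e / (b - a + 1).
  rewrite divr_gt0//.
  lra.
set e' := e / _ in e'0.
have [delta delta0 acd] := ac e' e'0.
have [V [oV muV nV]] := ae_small_open good delta0.
have mV : measurable V by exact: open_measurable.
pose len t := mu (V `&` [set` `[a, t]]).
have len0 t : (0 <= len t)%E by exact: measure_ge0.
have len_mono s t : s <= t -> (len s <= len t)%E.
  move=> st; apply: le_measure; rewrite ?inE; try exact: measurableI.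
  by move=> x /= [Vx]; rewrite !in_itv/= => /andP[ax xs]; split => //; rewrite ax/=; lra.
pose W t := chain_sup d g len a t.
have W0 t : a <= t -> (0 <= W t)%E by move=> at_; exact: chain_sup_ge0.
have We t : t <= b -> (W t <= e'%:E)%E.
  move=> tb; apply: ge_ereal_sup => S [t' [l [ch t't lt_]]].
  apply: (@chain_ac _ _ d dm g a b e' delta acd _ _ _ ch); first lra.
  rewrite -lte_fin (le_lt_trans lt_)// (le_lt_trans _ muV)//.
  by apply: le_measure; rewrite ?inE//; exact: measurableI.
pose F t := (\int[mu]_(x in `[a, t]) (f x)%:E)%E.
have f0E x : (0 <= (EFin \o f) x)%E by rewrite lee_fin.
have F_split s t : a <= s <= t -> F t = (F s + \int[mu]_(x in `[s, t]) (f x)%:E)%E.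
  by move=> ast; rewrite /F (@integral_itv_split _ (EFin \o f) a s t).
have F_mono s t : a <= s <= t -> (F s <= F t)%E.
  move=> ast; rewrite (F_split _ _ ast) leeDl//; apply: integral_ge0 => x _; exact: f0E.
pose P t : Prop := (d (g a) (g t) <= F t + (e' * (t - a))%:E + W t)%E.
suff : P b.
  move=> /le_trans; apply; rewrite -addeA leeD2l//.
  apply: (@le_trans _ _ ((e' * (b - a))%:E + e'%:E)%E); first by rewrite leeD2l// We.
  by rewrite -EFinD lee_fin /e' -{2}(mulr1 (e / _)) -mulrDr divfK// gt_eqF//; lra.
apply: (@real_induction _ P a b) => //.
- rewrite /P emetric_xx// adde_ge0 ?W0// adde_ge0 ?subrr ?mulr0//.
  by apply: integral_ge0 => x _; exact: f0E.
- move=> t /andP[at_ tb] Pt.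
  have [Vt|nVt] := pselect (V t).
    have [s [/andP[ts sb] tsV]] := open_right oV Vt tb.
    exists s; first by rewrite ts.
    rewrite /P; apply: (le_trans (emetric_triangle dm (g t) _ _)).
    apply: (@le_trans _ _ (F t + (e' * (t - a))%:E + (W t + d (g t) (g s)))%E).
      by rewrite addeA leeD2r.
    apply: leeD; first apply: leeD.
    + by apply: F_mono; rewrite at_ ltW.
    + by rewrite lee_fin ler_pM2l//; lra.
    + apply: chain_sup_step => //; first by rewrite at_ ltW.
      by rewrite /len (@measure_itvI_split _ V a t s)// at_ ltW.
  have [lt_ tfin] := nV _ nVt.
  have tab : t \in `[a, b] by rewrite in_itv/= at_ ltW.
  have rt : (rho t < (f t + e' / 2)%:E)%E.
    have := tfin tab; rewrite -ge0_fin_numE// => /fineK <-.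
    by rewrite /f fin_speedE// lte_fin; lra.
  have [h1 h10 sm1] := lebesgue_pt_small lt_ mf (e := e' / 4) ltac:(lra).
  pose h := Num.min (b - t) (h1 / 4).
  have h0 : 0 < h by rewrite lt_min; apply/andP; split; lra.
  have hb : h <= b - t by rewrite ge_min lexx.
  have hh1 : h <= h1 / 4 by rewrite !ge_min lexx orbT.
  have [s /andP[ts sh] dts] := right_speed_lt rt h0.
  exists s; first by rewrite ts; lra.
  have st0 : 0 < s - t by lra.
  rewrite /P; apply: (le_trans (emetric_triangle dm (g t) _ _)).
  apply: (@le_trans _ _ ((F t + (e' * (t - a))%:E + W t) +
     (\int[mu]_(x in `[t, s]) (f x)%:E + (e' * (s - t))%:E))%E).
    apply: leeD => //; apply: (le_trans dts).
    have ge_f : ((f t * (s - t))%:E <=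
        \int[mu]_(x in `[t, s]) (f x)%:E + (e' / 4 * (2 * (s - t)))%:E)%E.
      apply: integral_near_const_ge => //; first exact: ltW.
      apply: sm1 => //; first by apply/andP; split; lra.
      move=> x /=; rewrite in_itv/= => /andP[tx xs].
      by rewrite /ball/= distrC ger0_norm; lra.
    move: ge_f=> /(leeD2r (e' / 2 * (s - t))%:E); rewrite -EFinD -addeA -EFinD.
    rewrite -mulrDl => /le_trans; apply; rewrite leeD2l// lee_fin.
    by rewrite le_eqVlt; apply/orP; left; apply/eqP; field.
  rewrite (F_split t s) ?at_ ?(ltW ts)//.
  rewrite [leLHS](_ : _ = F t + \int[mu]_(x in `[t, s]) (f x)%:E +
     ((e' * (t - a))%:E + (e' * (s - t))%:E) + W t)%E; last first.
    exact: adde_regroup.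
  apply: leeD; first apply: leeD => //.
  + by rewrite -EFinD lee_fin; lra.
  + by apply: chain_sup_mono; [exact: ltW|apply: len_mono; exact: ltW].
- move=> t /andP[at_ tb] closeP; apply/lee_addgt0Pr => c c0.
  have [h h0 gh] := curve_close dm (@cg t) c0.
  have [s as_ [/andP[hs st] Ps]] := closeP _ h0.
  apply: (le_trans (emetric_triangle dm (g s) _ _)).
  apply: leeD; last first.
    by rewrite (emetric_sym dm) ltW// gh// distrC ger0_norm; lra.
  apply: (le_trans Ps); apply: leeD; first apply: leeD.
  + by apply: F_mono; rewrite as_ ltW.
  + by rewrite lee_fin ler_pM2l//; lra.
  + by apply: chain_sup_mono; [exact: ltW|apply: len_mono; exact: ltW].
Qed.

(** Lebesgue differentiation of the bound by the integral: the right speed,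
    defined by a right lower limit, controls the two-sided upper limit a.e. *)
Lemma ae_upper_speed a b : a <= b -> abs_continuous_on d a b g ->
  {ae mu, forall x, a < x < b -> (rho x < +oo)%E /\ 
    forall e, 0 < e -> exists2 h0, 0 < h0 & forall s, `|s - x| < h0 ->
      (d (g x) (g s) <= ((fine (rho x) + e) * `|s - x|)%:E)%E}.
Proof.
move=> ab ac; have good := ae_fin_speed ab ac.
have f_ge0 := @fin_speed_ge0 a b; have mf := measurable_fin_speed a b.
apply: (@filterS _ _ (ae_filter_ringOfSetsType mu) _ _ _ good).
move=> x [lx xfin] /andP[ax xb].
have xab : x \in `[a, b] by rewrite in_itv/=; lra.
split=> [|e e0]; first exact: xfin.
have [h1 h10 sm] := lebesgue_pt_small lx mf (e := e / 2) ltac:(lra).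
pose h0 := Num.min (h1 / 2) (Num.min (x - a) (b - x)).
exists h0 => [|s]; first by rewrite !lt_min; apply/and3P; split; lra.
rewrite !lt_min => /and3P[sh1 sa sb].
have bnd p q : a <= p -> p <= q -> q <= b -> x \in `[p, q] -> q - p < h1 / 2 ->
    (d (g p) (g q) <= ((fine (rho x) + e) * (q - p))%:E)%E.
  move=> ap pq qb; rewrite in_itv/= => /andP[px xq] pqh.
  apply: (le_trans (dist_le_int_speed pq (ac_sub ap qb ac))).
  rewrite (integral_fin_speed ab ac ap qb).
  have [pq'|] := ltP p q; last first.
    move=> qp; have -> : q = p by apply/eqP; rewrite eq_le qp pq.
    by rewrite set_itv1 integral_set1 subrr mulr0.
  apply: (le_trans (integral_near_const_le (x := x) (E := e / 2 * (2 * (q - p))) mf f_ge0 pq _)).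
    apply: sm => //; first by apply/andP; split; lra.
    move=> y /=; rewrite in_itv/= => /andP[py yq].
    by rewrite /ball/= ltr_norml; lra.
  rewrite fin_speedE// lee_fin [leLHS](_ : _ = (fine (rho x) + e) * (q - p))//.
  by field.
have [xs|sx] := leP x s.
  move: sh1 sb; rewrite ger0_norm ?subr_ge0// => sh1 sb.
  by apply: bnd => //; rewrite ?in_itv/= ?lexx//; lra.
move: sh1 sa; rewrite distrC gtr0_norm ?subr_gt0// => sh1 sa.
rewrite (emetric_sym dm); apply: bnd => //; rewrite ?in_itv/= ?lexx ?andbT//; lra.
Qed.

End MetricSpeed.

(** * Reflection of time and the metric derivative *)

Section Reflection.
Context {R : realType}.
Local Open Scope ring_scope.
Local Notation mu := (@lebesgue_measure R).

Lemma ae_opp (P : R -> Prop) : {ae mu, forall x, P x} ->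
  {ae mu, forall x, P (- x)}.
Proof.
move=> [N [mN N0 PN]].
exists (-%R @^-1` N); split.
- by rewrite -[X in measurable X]setTI; exact: oppr_measurable.
- by have := lebesgue_measureN mN; rewrite /pushforward => ->.
- by move=> x /= nP; exact: PN.
Qed.

(** The integral of a nonnegative function is the supremum over the simple
    functions below it, hence is monotone even for functions whose measurability
    is unknown, such as metric derivatives, which take junk values where the
    limit does not exist. *)
Lemma integral_mono_sub (A B : set R) (m f : R -> \bar R) :
  A `<=` B -> (forall x, A x -> (0 <= m x <= f x)%E) -> (forall x, B x -> (0 <= f x)%E) ->
  (\int[mu]_(x in A) m x <= \int[mu]_(x in B) f x)%E.
Proof.
move=> AB mf f0.
rewrite ge0_integralE; last by move=> x /mf/andP[].
rewrite [leRHS]ge0_integralE//.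
apply: le_ereal_sup => _ [h hm <-]; exists h => // x; apply: (le_trans (hm x)).
rewrite !patchE; case: ifPn => [xA|_].
  by rewrite mem_set; [case/andP: (mf x (set_mem xA))|apply/AB/set_mem].
by case: ifPn => // xB; exact: f0 (set_mem xB).
Qed.

Import HBNNSimple.

Lemma ge0_integral_opp_le (D : set R) (f : R -> \bar R) :
  measurable D -> (forall x, D x -> (0 <= f x)%E) ->
  (\int[mu]_(x in D) f x <= \int[mu]_(x in -%R @^-1` D) f (- x)%R)%E.
Proof.
move=> mD f0; rewrite ge0_integralE//.
apply: ge_ereal_sup => _ [h hf <-].
have mN : measurable_fun setT (-%R : R -> R) by exact: oppr_measurable.
have mh : measurable_fun setT (fun x : R => (h x)%:E).
  have mh0 : measurable_fun setT (h : measurableTypeR R -> R) by [].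
  exact/measurable_EFinP.
have h0 x : (0 <= (h x)%:E)%E by rewrite lee_fin.
have -> : sintegral mu h = (\int[mu]_(x in [set: R]) (h x)%:E)%E.
  by rewrite integral_nnsfun// patch_setT.
have -> : (\int[mu]_(x in [set: R]) (h x)%:E =
    \int[pushforward mu (-%R : _ -> measurableTypeR R)]_(x in [set: R]) (h x)%:E)%E.
  by apply: eq_measure_integral => A mA _; exact/esym/lebesgue_measureN.
rewrite (@ge0_integral_pushforward _ _ (measurableTypeR R) (measurableTypeR R) R
  (-%R) mN mu [set: R] (fun x => (h x)%:E) measurableT mh (fun x _ => h0 x)).
rewrite preimage_setT [leRHS]integral_mkcond.
have fD0 x : (0 <= ((fun x => f (- x)%R) \_ (-%R @^-1` D)) x)%E.
  by rewrite patchE; case: ifP => // xD; apply: f0; exact: (set_mem xD).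
apply: integral_mono_sub => // x _; rewrite h0/=.
apply: (le_trans (hf (- x))); rewrite !patchE.
have -> : (x \in -%R @^-1` D) = (- x \in D) by apply/idP/idP; rewrite !inE.
by [].
Qed.

Lemma ge0_integral_opp (D : set R) (f : R -> \bar R) :
  measurable D -> (forall x, D x -> (0 <= f x)%E) ->
  (\int[mu]_(x in -%R @^-1` D) f (- x)%R = \int[mu]_(x in D) f x)%E.
Proof.
move=> mD f0; apply/eqP; rewrite eq_le ge0_integral_opp_le// andbT.
have mD' : measurable (-%R @^-1` D).
  by rewrite -[X in measurable X]setTI; exact: oppr_measurable.
have := @ge0_integral_opp_le (-%R @^-1` D) (fun x => f (- x)%R) mD'.
have -> : -%R @^-1` (-%R @^-1` D) = D by apply/seteqP; split => x /=; rewrite opprK.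
under [X in (_ -> (_ <= X)%E)]eq_integral do rewrite opprK.
by apply => x /= Dx; exact: f0.
Qed.

Lemma integral_opp (D : set R) (f : R -> \bar R) : measurable D ->
  (\int[mu]_(x in -%R @^-1` D) f (- x)%R = \int[mu]_(x in D) f x)%E.
Proof.
move=> mD; rewrite integralE [RHS]integralE.
have P := @ge0_integral_opp D (f^\+)%E mD (fun x _ => funepos_ge0 f x).
have N := @ge0_integral_opp D (f^\-)%E mD (fun x _ => funeneg_ge0 f x).
congr (_ - _)%E.
  etransitivity; last exact: P.
  by apply: eq_integral => x _; rewrite !funeposE.
etransitivity; last exact: N.
by apply: eq_integral => x _; rewrite !funenegE.
Qed.

(** The lower integral of f is not affected by what happens on the null set,
    once that set is removed from the domain of the measurable function m. *)
Lemma ge0_ae_le_lower_integral (D : set R) (m f : R -> \bar R) :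
  measurable D -> measurable_fun D m ->
  (forall x, D x -> (0 <= m x)%E) -> (forall x, D x -> (0 <= f x)%E) ->
  {ae mu, forall x, D x -> (m x <= f x)%E} ->
  (\int[mu]_(x in D) m x <= \int[mu]_(x in D) f x)%E.
Proof.
move=> mD mm m0 f0 [N [mN N0 mfN]].
rewrite (ge0_negligible_integral mN)//.
apply: integral_mono_sub => [x []//|x [Dx nNx]|//].
rewrite m0//=; apply: contrapT => nmf; apply: nNx; apply: mfN => /=.
by move/(_ Dx).
Qed.

End Reflection.

Section MetricDerivative.
Context {R : realType} {X : pseudoMetricType R} (d : X -> X -> \bar R).
Hypothesis dm : emetric d.
Local Open Scope ring_scope.
Local Notation mu := (@lebesgue_measure R).

Let d_ge0 x y : (0 <= d x y)%E := emetric_ge0 dm x y.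

Lemma within_dnbhs_proper (I : interval R) (t u : R) :
  t \in I -> u \in I -> u != t -> ProperFilter (within [set` I] (t^')).
Proof.
move=> tI uI ut; apply: Build_ProperFilter_ex => A.
rewrite /within/= => /nbhs_ballP[e /= e0 He].
have itv_I p q v : p \in I -> q \in I -> p <= v <= q -> v \in I.
  by case: I {tI uI He} => l r; rewrite !itv_boundlr => /andP[lp _] /andP[_ qr] /andP[pv vq];
    rewrite (le_trans lp) ?bnd_simp//= (le_trans _ qr) ?bnd_simp.
pose h := Num.min (e / 2) `|u - t|.
have ut0 : 0 < `|u - t| by rewrite normr_gt0 subr_eq0.
have h0 : 0 < h by rewrite lt_min ut0 andbT; lra.
have he : h < e by rewrite gt_min; apply/orP; left; lra.
have hu : h <= `|u - t| by rewrite ge_min lexx orbT.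
have [tu|ut'] := ltP t u.
  exists (t + h); apply: He.
  - by rewrite /ball/= opprD addNKr normrN gtr0_norm.
  - by rewrite gt_eqF// ltrDl.
  - by apply: (itv_I t u) => //; move: hu; rewrite gtr0_norm ?subr_gt0//; lra.
exists (t - h); apply: He.
- by rewrite /ball/= opprB addrC subrK gtr0_norm.
- by rewrite lt_eqF// gtrBl.
- by apply: (itv_I u t) => //; move: hu; rewrite distrC ger0_norm ?subr_ge0//; lra.
Qed.

Lemma metric_derivative_ge0 (I : interval R) g t u : t \in I -> u \in I -> u != t ->
  (0 <= metric_derivative d I g t)%E.
Proof.
move=> tI uI ut; rewrite /metric_derivative.
have PF := within_dnbhs_proper tI uI ut.
set f := fun s => _; set F := within _ _.
have [cvf|dvf] := pselect (cvg (f @ F)); last by rewrite dvgP.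
apply: lime_ge => //; apply: filterE => s; rewrite /f.
by rewrite mule_ge0// lee_fin invr_ge0.
Qed.

(** The two-sided metric derivative at t exists and is r, written without
    division and with no reference to an interval. *)
Definition has_speed (g : R -> X) (t r : R) : Prop :=
  forall e, 0 < e -> exists2 h, 0 < h & forall s, `|s - t| < h ->
    (((r - e) * `|s - t|)%:E <= d (g t) (g s) <= ((r + e) * `|s - t|)%:E)%E.

Lemma has_speed_metric_derivative (I : interval R) g t r a b :
  a < t < b -> [set` `]a, b[ ] `<=` [set` I] -> has_speed g t r ->
  metric_derivative d I g t = r%:E.
Proof.
move=> /andP[at_ tb] abI sp; rewrite /metric_derivative.
have tI : t \in I by apply: abI; rewrite /= in_itv/= at_.
have uI : (t + b) / 2 \in I by apply: abI; rewrite /= in_itv/=; lra.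
have PF : ProperFilter (within [set` I] (t^')).
  by apply: (within_dnbhs_proper tI uI); rewrite gt_eqF//; lra.
apply/cvg_lim => //; apply/fine_cvgP.
have key e : 0 < e -> \forall s \near within [set` I] t^',
    (d (g t) (g s) * (`|t - s|^-1)%:E)%E \is a fin_num /\
    `|r - fine (d (g t) (g s) * (`|t - s|^-1)%:E)%E| <= e.
  move=> e0; have [h h0 Hh] := sp _ e0.
  rewrite /within/=; apply/nbhs_ballP; exists h => //= s ts st _.
  have := Hh s; rewrite distrC => /(_ ts) /andP[lo hi].
  have ts0 : 0 < `|t - s| by rewrite normr_gt0 subr_eq0 eq_sym.
  have dfin : d (g t) (g s) \is a fin_num.
    by rewrite ge0_fin_numE// (le_lt_trans hi)// ltry.
  move: lo hi; rewrite -(fineK dfin) !lee_fin => lo hi; split => //=.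
  rewrite ler_distlC -ler_pdivrMr ?invr_gt0// -[X in _ && X]ler_pdivlMr ?invr_gt0//.
  by rewrite !invrK hi lo.
split.
  by apply: filterS (key 1 ltr01) => s [].
by apply/cvgrPdist_le => e e0; apply: filterS (key e e0) => s [].
Qed.

Lemma ac_opp (g : R -> X) a b : abs_continuous_on d a b g ->
  abs_continuous_on d (- b) (- a) (g \o -%R).
Proof.
move=> ac e e0; have [delta delta0 H] := ac e e0.
exists delta => // n s t st ts sm.
pose s' i := - t (n.-1 - i)%N; pose t' i := - s (n.-1 - i)%N.
have ni i : (i < n)%N -> (n.-1 - i < n)%N by lia.
have sumE (T : nmodType) (F : nat -> T) : \sum_(i < n) F (n.-1 - i)%N = \sum_(i < n) F i.
  rewrite [RHS](reindex_inj rev_ord_inj)/=; apply: eq_bigr => i _.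
  by congr F; have := ltn_ord i; lia.
have := H n s' t'; rewrite /s' /t'.
rewrite (sumE _ (fun i => - s i - - t i)) (sumE _ (fun i => d (g (- t i)) (g (- s i)))).
under [X in (X < e%:E)%E]eq_bigr do rewrite (emetric_sym dm).
apply.
- by move=> i /ni /st[]; split; lra.
- move=> i i1n; rewrite lerN2; have -> : (n.-1 - i = (n.-1 - i.+1).+1)%N by lia.
  by apply: ts; lia.
- by under eq_bigr do rewrite opprK addrC.
Qed.

(** Apply the a.e. upper bound to g and to its time reversal.  Each right speed
    is a lower bound of the quotients on its own side and, a.e., an upper bound
    on both sides; so the left and right speeds agree and are the derivative. *)
Lemma ae_has_speed (g : R -> X) a b : continuous g -> a <= b ->
  abs_continuous_on d a b g ->
  {ae mu, forall x, a < x < b -> (right_speed d g x < +oo)%E /\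
    has_speed g x (fine (right_speed d g x))}.
Proof.
move=> cg ab ac.
have cg' : continuous (g \o -%R).
  by move=> x; apply: continuous_comp; [exact: opp_continuous|exact: cg].
have ab' : - b <= - a by rewrite lerN2.
have H1 := ae_upper_speed dm cg ab ac.
have H2 := ae_opp (ae_upper_speed dm cg' ab' (ac_opp ac)).
apply: (@filterS2 _ _ (ae_filter_ringOfSetsType mu) _ _ _ _ H1 H2) => x up upN axb.
have [rfin {}up] := up axb.
have axb' : - b < - x < - a by move: axb; lra.
have [lfin {}upN] := upN axb'; split=> //.
set r := fine _ in up *; set l := fine _ in upN.
have rE : right_speed d g x = r%:E.
  by rewrite /r fineK// ge0_fin_numE// right_speed_ge0.
have lE : right_speed d (g \o -%R) (- x) = l%:E.
  by rewrite /l fineK// ge0_fin_numE// right_speed_ge0.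
have lowr e : 0 < e -> exists2 h, 0 < h & forall s, x < s < x + h ->
    (((r - e) * (s - x))%:E <= d (g x) (g s))%E.
  by move=> e0; apply: right_speed_gt => //; rewrite rE lte_fin; lra.
have lowl e : 0 < e -> exists2 h, 0 < h & forall s, x - h < s < x ->
    (((l - e) * (x - s))%:E <= d (g x) (g s))%E.
  move=> e0; have := @right_speed_gt _ _ d dm (g \o -%R) (- x) (l - e) cg'.
  rewrite lE lte_fin => /(_ _)[|h h0 Hh]; first lra.
  exists h => // s /andP[hs sx]; have := Hh (- s); rewrite /= !opprK.
  rewrite (_ : - s + x = x - s); last by ring.
  by apply; lra.
have upl e : 0 < e -> exists2 h, 0 < h & forall s, `|s - x| < h ->
    (d (g x) (g s) <= ((l + e) * `|s - x|)%:E)%E.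
  move=> /upN[h h0 Hh]; exists h => // s; have := Hh (- s).
  by rewrite /= !opprK (_ : - s + x = - (s - x)) ?normrN//; ring.
have common (h k : R) : 0 < h -> 0 < k -> exists m, [/\ 0 < m, m < h & m < k].
  move=> h0 k0; exists (Num.min h k / 2).
  have m0 : 0 < Num.min h k by rewrite lt_min h0.
  have mh : Num.min h k <= h by rewrite ge_min lexx.
  have mk : Num.min h k <= k by rewrite ge_min lexx orbT.
  by move: m0 mh mk; move: (Num.min h k) => m m0 mh mk; split; lra.
have rl : r = l.
  apply/eqP; rewrite eq_le; apply/andP; split; apply/ler_addgt0Pr => e e0.
    have [h h0 Hh] := lowr (e / 2) ltac:(lra).
    have [k k0 Hk] := upl (e / 2) ltac:(lra).
    have [m [m0 mh mk]] := common _ _ h0 k0.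
    have := Hh (x + m); have := Hk (x + m).
    rewrite addrAC subrr add0r gtr0_norm// => /(_ mk) up' /(_ _)low'.
    have : (((r - e / 2) * m)%:E <= ((l + e / 2) * m)%:E)%E.
      by apply: le_trans up'; apply: low'; rewrite ltrDl m0 ltrD2l.
    by rewrite lee_fin ler_pM2r//; clear -e0; lra.
  have [h h0 Hh] := lowl (e / 2) ltac:(lra).
  have [k k0 Hk] := up (e / 2) ltac:(lra).
  have [m [m0 mh mk]] := common _ _ h0 k0.
  have := Hh (x - m); have := Hk (x - m).
  rewrite (_ : x - m - x = - m); last by ring.
  rewrite (_ : x - (x - m) = m); last by ring.
  rewrite normrN gtr0_norm// => /(_ mk) up' /(_ _)low'.
  have : (((l - e / 2) * m)%:E <= ((r + e / 2) * m)%:E)%E.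
    by apply: le_trans up'; apply: low'; rewrite ltrD2l ltrN2 mh gtrBl.
  by rewrite lee_fin ler_pM2r//; clear -e0; lra.
move=> e e0.
have [h h0 Hh] := lowr e e0; have [k k0 Hk] := lowl e e0; have [j j0 Hj] := up e e0.
exists (Num.min j (Num.min h k)) => [|s]; first by rewrite !lt_min j0 h0.
rewrite !lt_min => /and3P[sj sh sk]; rewrite Hj// andbT.
have [xs|sx|->] := ltgtP x s.
- by move: sh; rewrite gtr0_norm ?subr_gt0// => sh; apply: Hh; lra.
- move: sk; rewrite distrC gtr0_norm ?subr_gt0// => sk; rewrite rl; apply: Hk; lra.
- by rewrite subrr normr0 mulr0.
Qed.

End MetricDerivative.

(** * Piecewise absolutely continuous curves *)

Lemma steps_mono (disp : Order.disp_t) (T : porderType disp) (n : nat) (t : nat -> T) :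
  (forall i, (i < n)%N -> (t i < t i.+1)%O) ->
  forall i j, (i <= j)%N -> (j <= n)%N -> (t i <= t j)%O.
Proof.
move=> tS i; elim=> [|j IHj]; first by rewrite leqn0 => /eqP ->.
rewrite leq_eqVlt => /predU1P[-> //|ij] jn; apply: (le_trans (IHj ij (ltnW jn))).
exact/ltW/tS.
Qed.

Section PiecewiseAC.
Context {R : realType} {X : pseudoMetricType R} (d : X -> X -> \bar R).
Hypothesis dm : emetric d.
Local Open Scope ring_scope.
Local Notation mu := (@lebesgue_measure R).

Let d_ge0 x y : (0 <= d x y)%E := emetric_ge0 dm x y.

Lemma ereal_inf_itvcc (a b : R) : a <= b ->
  ereal_inf (EFin @` [set` `[a, b]]) = a%:E.
Proof.
move=> ab; apply/eqP; rewrite eq_le; apply/andP; split.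
  by apply: ereal_inf_lbound; exists a => //=; rewrite in_itv/= lexx.
by apply: le_ereal_inf_tmp => _ [x xI <-]; move: xI; rewrite /= in_itv/= lee_fin => /andP[].
Qed.

Lemma ereal_sup_itvcc (a b : R) : a <= b ->
  ereal_sup (EFin @` [set` `[a, b]]) = b%:E.
Proof.
move=> ab; apply/eqP; rewrite eq_le; apply/andP; split.
  by apply: ge_ereal_sup => _ [x xI <-]; move: xI; rewrite /= in_itv/= lee_fin => /andP[].
by apply: ereal_sup_ubound; exists b => //=; rewrite in_itv/= lexx andbT.
Qed.

Lemma step_find (n : nat) (t : nat -> \bar R) (x : \bar R) :
  (t 0%N <= x)%E -> (x < t n)%E -> exists2 i, (i < n)%N & (t i <= x < t i.+1)%E.
Proof.
elim: n => [|n IHn] t0x xt; first by have := le_lt_trans t0x xt; rewrite ltxx.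
have [/(IHn t0x)[i i_n ix]|tx] := ltP x (t n).
  by exists i => //; exact: leqW.
by exists n => //; rewrite tx.
Qed.

Section Curve.
Variable g : R -> X.
Hypothesis cg : continuous g.
Hypothesis pw : piecewise (fun J => ac_loc d J g) `[0, 1]%R.
Local Notation rho := (right_speed d g).

Let rho_ge0 t : (0 <= rho t)%E := right_speed_ge0 dm g t.
Let mrho : measurable_fun setT rho := measurable_right_speed dm cg.

(** A division point of the subdivision belongs to the piece on its right; only
    intervals starting strictly after t are claimed to be good, since the pieces
    are open. *)
Lemma piecewise_ac_right t : 0 <= t < 1 -> exists2 b, t < b <= 1 &
  forall s s', t < s -> s <= s' -> s' < b -> abs_continuous_on d s s' g.
Proof.
move=> /andP[t0 t1]; have [n [r [r0 rn rS acP]]] := pw.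
move: r0 rn; rewrite ereal_inf_itvcc// ereal_sup_itvcc// => r0 rn.
have [i i_n /andP[rt tr]] : exists2 i, (i < n)%N & (r i <= t%:E < r i.+1)%E.
  by apply: step_find; rewrite ?r0 ?rn ?lee_fin ?lte_fin.
have [b tb bri] : exists2 b, t < b <= 1 & (b%:E <= r i.+1)%E.
  case: (r i.+1) tr => [x||] //; last first.
    by exists 1; rewrite ?leey// t1 lexx.
  rewrite lte_fin => tx; exists (Num.min x 1).
    by rewrite lt_min tx t1 ge_min lexx orbT.
  by rewrite lee_fin ge_min lexx.
exists b => // s s' ts ss' s'b; apply: (acP i i_n) => // u /=.
rewrite in_itv/= => /andP[su us']; apply/andP; split.
  by apply: (le_lt_trans rt); rewrite lte_fin; lra.
by apply: lt_le_trans bri; rewrite lte_fin; lra.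
Qed.

(** The bound on the pieces extends across division points by continuity of g,
    which absorbs the missing initial step [t, q]. *)
Lemma piecewise_dist_le_int a b : 0 <= a -> a <= b -> b <= 1 ->
  (d (g a) (g b) <= \int[mu]_(x in `[a, b]) rho x)%E.
Proof.
move=> a0 ab b1; pose F s t := (\int[mu]_(x in `[s, t]) rho x)%E.
have F0 s t : (0 <= F s t)%E by exact: integral_ge0.
have F_split s t u : s <= t <= u -> F s u = (F s t + F t u)%E.
  by move=> stu; rewrite /F (@integral_itv_split _ rho s t u).
pose P t : Prop := (d (g a) (g t) <= F a t)%E.
apply: (@real_induction _ P a b) => //.
- by rewrite /P emetric_xx.
- move=> t /andP[at_ tb] Pt.
  have [b' /andP[tb' b'1] acP] := @piecewise_ac_right t ltac:(by apply/andP; split; lra).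
  pose s := Num.min b ((t + b') / 2).
  have ts : t < s by rewrite lt_min tb; lra.
  have sb' : s < b' by rewrite gt_min; apply/orP; right; lra.
  have sb : s <= b by rewrite ge_min lexx.
  exists s; first by rewrite ts.
  rewrite /P (@F_split a t s) ?at_ ?(ltW ts)//.
  apply: (le_trans (emetric_triangle dm (g t) _ _)); apply: leeD => //.
  apply/lee_addgt0Pr => e e0.
  have [h h0 gh] := curve_close dm (@cg t) e0.
  pose q := t + Num.min (h / 2) (s - t).
  have m0 : 0 < Num.min (h / 2) (s - t) by rewrite lt_min; apply/andP; split; lra.
  have m1 : Num.min (h / 2) (s - t) <= h / 2 by rewrite ge_min lexx.
  have m2 : Num.min (h / 2) (s - t) <= s - t by rewrite ge_min lexx orbT.
  have tq : t < q by rewrite ltrDl.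
  have qs : q <= s by rewrite /q -lerBrDl.
  rewrite addeC; apply: (le_trans (emetric_triangle dm (g q) _ _)); apply: leeD.
    by apply/ltW/gh; rewrite /q addrAC subrr add0r gtr0_norm//; lra.
  apply: (le_trans (dist_le_int_speed dm cg qs (acP _ _ tq qs sb'))).
  by rewrite -/(F q s) (@F_split t q s) ?leeDr// (ltW tq).
- move=> t /andP[at_ tb] closeP; apply/lee_addgt0Pr => e e0.
  have [h h0 gh] := curve_close dm (@cg t) e0.
  have [s as_ [/andP[hs st] Ps]] := closeP _ h0.
  apply: (le_trans (emetric_triangle dm (g s) _ _)); apply: leeD.
    by apply: (le_trans Ps); rewrite (@F_split a s t) ?leeDl// as_ (ltW st).
  by rewrite (emetric_sym dm); apply/ltW/gh; rewrite ltr0_norm; lra.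
Qed.

Lemma ae_neq (c : R) : {ae mu, forall x, x != c}.
Proof.
exists [set c]; split => //; first by rewrite lebesgue_measure_set1.
by move=> x /= /negP; rewrite negbK => /eqP.
Qed.

(** A point other than the division points lies in an interval with rational
    end points contained in a piece, and there are countably many of these. *)
Lemma piecewise_ae_speed : {ae mu, forall x, 0 < x < 1 ->
  (rho x < +oo)%E /\ has_speed d g x (fine (rho x))}.
Proof.
have [n [r [r0 rn rS acP]]] := pw.
move: r0 rn; rewrite ereal_inf_itvcc// ereal_sup_itvcc// => r0 rn.
pose good x := (rho x < +oo)%E /\ has_speed d g x (fine (rho x)).
pose pq (k : nat) : R * R := let: (p, q) := odflt (0, 0) (unpickle k : option (rat * rat)) in
  (ratr p, ratr q).
have H1 : {ae mu, forall x, forall k, (pq k).1 <= (pq k).2 ->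
    abs_continuous_on d (pq k).1 (pq k).2 g -> (pq k).1 < x < (pq k).2 -> good x}.
  apply/ae_foralln => k.
  have [pqk|npqk] := pselect ((pq k).1 <= (pq k).2 /\
      abs_continuous_on d (pq k).1 (pq k).2 g).
    case: pqk => pqk ack.
    by apply: (@filterS _ _ (ae_filter_ringOfSetsType mu) _ _ _ (ae_has_speed dm cg pqk ack))
      => x Hx _ _ /Hx.
  by apply: aeW => x le_k ac_k; case: npqk.
have H2 : {ae mu, forall x, forall k, x != fine (r k)}.
  by apply/ae_foralln => k; exact: ae_neq.
apply: (@filterS2 _ _ (ae_filter_ringOfSetsType mu) _ _ _ _ H1 H2) => x Hpq Hr /andP[x0 x1].
have [i i_n /andP[rx xr]] : exists2 i, (i < n)%N & (r i <= x%:E < r i.+1)%E.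
  by apply: step_find; rewrite ?r0 ?rn ?lee_fin ?lte_fin// ltW.
have {}rx : (r i < x%:E)%E.
  rewrite lt_neqAle rx andbT; apply/eqP => rix.
  by have := Hr i; rewrite rix/= eqxx.
have [p px rp] : exists2 p : rat, ratr p < x & (r i < (ratr p)%:E)%E.
  case: (r i) rx => [y||] //.
    by rewrite lte_fin => /rat_in_itvoo[p]; rewrite in_itv/= => /andP[yp px]; exists p.
  by have [p] := @rat_in_itvoo _ (x - 1) x ltac:(lra); rewrite in_itv/= => /andP[_ ?] _;
    exists p => //; rewrite ltNyr.
have [q xq qr] : exists2 q : rat, x < ratr q & ((ratr q)%:E < r i.+1)%E.
  case: (r i.+1) xr => [y||] //.
    by rewrite lte_fin => /rat_in_itvoo[p']; rewrite in_itv/= => /andP[yp px']; exists p'.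
  by have [p'] := @rat_in_itvoo _ x (x + 1) ltac:(lra); rewrite in_itv/= => /andP[? _] _;
    exists p' => //; rewrite ltry.
have pqE : pq (pickle (p, q)) = (ratr p, ratr q) by rewrite /pq pickleK.
have := Hpq (pickle (p, q)); rewrite pqE/=; apply; last by rewrite px xq.
  by apply: ltW; exact: lt_trans xq.
apply: (acP i i_n); first by apply: ltW; exact: lt_trans xq.
move=> u /=; rewrite in_itv/= => /andP[pu uq]; apply/andP; split.
  by apply: (lt_le_trans rp); rewrite lee_fin.
by apply: le_lt_trans qr; rewrite lee_fin.
Qed.

Lemma mule_infty_ge (x y : \bar R) : (0 <= x)%E -> (0 <= y)%E ->
  (x * y <= mule_infty x y)%E.
Proof. by move=> x0 y0; rewrite /mule_infty; case: ifP => // _; exact: leey. Qed.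

Lemma mule_infty_ge0 (x y : \bar R) : (0 <= x)%E -> (0 <= y)%E ->
  (0 <= mule_infty x y)%E.
Proof. by move=> x0 y0; apply: le_trans (mule_infty_ge x0 y0); exact: mule_ge0. Qed.

Lemma measurable_lsc_comp (K : X -> \bar R) : lower_semicontinuous K ->
  measurable_fun setT (K \o g).
Proof.
move=> Kl; apply: lower_semicontinuous_measurable => t c /Kl[V gV VK].
by exists (g @^-1` V) => [|s /VK//]; exact: cg.
Qed.

(** The right speed is the metric derivative a.e., which compares the measurable
    integrand on the left with the one defining the weighted length. *)
Lemma int_speed_le_Klength (K : X -> \bar R) : lower_semicontinuous K ->
  (forall x, (0 <= K x)%E) ->
  (\int[mu]_(t in `[0%R, 1%R]) (K (g t) * rho t) <= Klength d K `[0%R, 1%R] g)%E.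
Proof.
move=> Kl K0; rewrite /Klength; apply: ge0_ae_le_lower_integral => //.
- apply: measurable_funTS; apply: emeasurable_funM => //.
  exact: measurable_lsc_comp.
- by move=> x _; rewrite mule_ge0.
- move=> x /= x01; apply: mule_infty_ge0 => //.
  have [x0|x0] := eqVneq x 0.
    by apply: (@metric_derivative_ge0 _ _ d dm _ _ _ 1) => //; rewrite ?in_itv/= ?lexx ?ler01// x0 oner_neq0.
  by apply: (@metric_derivative_ge0 _ _ d dm _ _ _ 0) => //; rewrite ?in_itv/= ?lexx ?ler01// eq_sym.
have H := @filterS2 _ _ (ae_filter_ringOfSetsType mu) _ _ _ (fun x a b => conj a b) (ae_neq 0) (ae_neq 1).
apply: (@filterS2 _ _ (ae_filter_ringOfSetsType mu) _ _ _ _ piecewise_ae_speed H).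
move=> x sp [x0 x1] /=; rewrite in_itv/= => /andP[x0' x1'].
have x01 : 0 < x < 1 by rewrite !lt_neqAle eq_sym x0 x0' x1 x1'.
have [rfin /(has_speed_metric_derivative dm x01) ->] := sp x01; last first.
  by move=> y /=; rewrite !in_itv/= => /andP[? ?]; rewrite !ltW.
have rE : ((fine (rho x))%:E = rho x)%E by rewrite fineK// ge0_fin_numE.
by rewrite rE mule_infty_ge.
Qed.

End Curve.

End PiecewiseAC.

(** * The clocks of a curve of finite weighted length *)

Section IndefiniteIntegral.
Context {R : realType}.
Local Open Scope ring_scope.
Local Notation mu := (@lebesgue_measure R).
Variable h : R -> \bar R.
Hypothesis mh : measurable_fun setT h.
Hypothesis h0 : forall x, (0 <= h x)%E.
Hypothesis hfin : (\int[mu]_(x in `[0%R, 1%R]) h x < +oo)%E.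

Definition primitive (t : R) : R := fine (\int[mu]_(x in `[0%R, t]) h x)%E.

Lemma primitiveB s t : 0 <= s -> s <= t -> t <= 1 ->
  ((primitive t - primitive s)%:E = \int[mu]_(x in `[s, t]) h x)%E.
Proof.
move=> s0 st t1.
have fin v : 0 <= v <= 1 -> (\int[mu]_(x in `[0%R, v]) h x)%E \is a fin_num.
  move=> v01; rewrite ge0_fin_numE ?integral_ge0//; apply: le_lt_trans hfin.
  by rewrite (@integral_itv_split _ h 0 v 1)// leeDl ?integral_ge0.
have finst : (\int[mu]_(x in `[s, t]) h x)%E \is a fin_num.
  have := fin t ltac:(by apply/andP; split; lra).
  rewrite (@integral_itv_split _ h 0 s t)//; last by rewrite s0.
  by rewrite fin_numD => /andP[].
rewrite /primitive (@integral_itv_split _ h 0 s t)//; last by rewrite s0.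
have fins := fin s ltac:(by apply/andP; split; lra).
rewrite (fineD fins finst).
by rewrite addrAC subrr add0r fineK.
Qed.

Lemma primitive_le s t : 0 <= s -> s <= t -> t <= 1 -> primitive s <= primitive t.
Proof.
by move=> s0 st t1; rewrite -subr_ge0 -lee_fin primitiveB// integral_ge0.
Qed.

Lemma primitive0 : primitive 0 = 0.
Proof. by rewrite /primitive set_itv1 integral_set1. Qed.

Lemma primitive1 : ((primitive 1)%:E = \int[mu]_(x in `[0%R, 1%R]) h x)%E.
Proof. by rewrite /primitive fineK// ge0_fin_numE// integral_ge0. Qed.

Lemma primitive_continuous : {within `[0, 1], continuous primitive}.
Proof.
have ih : mu.-integrable `[0%R, 1%R] h.
  apply/integrableP; split; first exact: measurable_funTS.
  by under eq_integral do rewrite gee0_abs//.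
have mf : measurable_fun setT (fine \o h).
  by apply: (measurableT_comp (f := fine)) => //; exact: measurable_fine.
have ifh : mu.-integrable `[0%R, 1%R] (EFin \o (fine \o h)).
  apply: le_integrable ih => //.
    by apply: measurable_funTS; apply/measurable_EFinP.
  move=> x _; rewrite /= ger0_norm ?fine_ge0// gee0_abs//.
  by case: (h x) (h0 x) => [r||]//= _; rewrite leey.
have fE t : 0 <= t <= 1 -> primitive t = parameterized_integral mu 0 t (fine \o h).
  move=> t01; rewrite /primitive /parameterized_integral /Rintegral; congr fine.
  apply: ge0_ae_eq_integral => //.
  - exact: measurable_funTS.
  - by apply: measurable_funTS; apply/measurable_EFinP.
  - by move=> x _; rewrite lee_fin fine_ge0.
  have := integrable_ae _ ih; move=> /(_ (measurable_itv _)) Hae.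
  suff : {ae mu, forall x, [set` `[0, t]] x -> h x = (fine (h x))%:E} by [].
  apply: (@filterS _ _ (ae_filter_ringOfSetsType mu) _ _ _ Hae) => x xfin /=.
  rewrite in_itv/= => /andP[x0 xt]; rewrite fineK// xfin//= in_itv/= x0/=.
  by apply: (le_trans xt); case/andP: t01.
apply: (@subspace_eq_continuous _ _ _ (fun t => parameterized_integral mu 0 t (fine \o h))).
  by move=> t /set_mem /=; rewrite in_itv/= => /fE.
exact: parameterized_integral_continuous.
Qed.

End IndefiniteIntegral.

Section WeightedLength.
Context {R : realType} {X : pseudoMetricType R} (d : X -> X -> \bar R).
Hypothesis dm : emetric d.
Local Open Scope ring_scope.
Local Notation mu := (@lebesgue_measure R).
Variable K : X -> \bar R.
Hypothesis Kl : lower_semicontinuous K.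
Hypothesis K0 : forall x, (0 <= K x)%E.
Variable g : R -> X.
Hypothesis cg : continuous g.
Hypothesis pw : piecewise (fun J => ac_loc d J g) `[0, 1]%R.
Hypothesis Kfin : (Klength d K `[0%R, 1%R] g < +oo)%E.

Let d_ge0 x y : (0 <= d x y)%E := emetric_ge0 dm x y.
Local Notation rho := (right_speed d g).
Let rho_ge0 t : (0 <= rho t)%E := right_speed_ge0 dm g t.
Let mrho : measurable_fun setT rho := measurable_right_speed dm cg.
Let mK : measurable_fun setT (K \o g) := measurable_lsc_comp cg Kl.

Let f t : \bar R := (K (g t) * rho t)%E.
Let k t : \bar R := (mine (K (g t)) 1 * rho t)%E.

Let mf : measurable_fun setT f. Proof. exact: emeasurable_funM. Qed.
Let mk : measurable_fun setT k.
Proof.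
apply: emeasurable_funM => //; apply: measurable_mine => //; exact: measurable_cst.
Qed.
Let f0 t : (0 <= f t)%E. Proof. exact: mule_ge0. Qed.
Let min0 t : (0 <= mine (K (g t)) 1)%E. Proof. by rewrite le_min K0 lee01. Qed.
Let k0 t : (0 <= k t)%E. Proof. exact: mule_ge0. Qed.
Let kf t : (k t <= f t)%E. Proof. by rewrite lee_wpmul2r// ge_min lexx. Qed.

Let ffin : (\int[mu]_(x in `[0%R, 1%R]) f x < +oo)%E.
Proof. exact: le_lt_trans (int_speed_le_Klength dm cg pw Kl K0) Kfin. Qed.

Let kfin : (\int[mu]_(x in `[0%R, 1%R]) k x < +oo)%E.
Proof.
apply: le_lt_trans ffin; apply: ge0_le_integral => //.
- exact: measurable_funTS.
- exact: measurable_funTS.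
Qed.

(** The length for the weight min (K, 1), to be used as a new time.  The cap at 1
    makes time spent where K > c cost at least c per unit: so a limit of curves
    of bounded cost spends no time in {K = +oo}, where even a stationary curve
    has infinite weighted length. *)
Definition clock1 : R -> R := primitive k.
Definition clockK : R -> R := primitive f.

Lemma integral_le_scale (h1 h2 : R -> \bar R) (c s t : R) :
  measurable_fun setT h1 -> measurable_fun setT h2 ->
  (forall x, (0 <= h1 x)%E) -> (forall x, (0 <= h2 x)%E) -> 0 <= c ->
  (forall x, s < x <= t -> (c%:E * h1 x <= h2 x)%E) ->
  (c%:E * \int[mu]_(x in `[s, t]) h1 x <= \int[mu]_(x in `[s, t]) h2 x)%E.
Proof.
move=> m1 m2 p1 p2 c0 h12.
rewrite -ge0_integralZl//; last exact: measurable_funTS.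
rewrite -!integral_itv_obnd_cbnd; last 2 first.
- by apply: measurable_funTS; apply: emeasurable_funM => //; exact: measurable_cst.
- exact: measurable_funTS.
apply: ge0_le_integral => //.
- by move=> x _; rewrite mule_ge0.
- by apply: measurable_funTS; apply: emeasurable_funM => //; exact: measurable_cst.
- exact: measurable_funTS.
Qed.

Lemma clock1_dist s t c : 0 <= s -> s <= t -> t <= 1 -> 0 < c ->
  (forall r, s <= r <= t -> (c%:E < K (g r))%E) ->
  ((Num.min c 1)%:E * d (g s) (g t) <= (clock1 t - clock1 s)%:E)%E.
Proof.
move=> s0 st t1 c0 cK.
have m0 : 0 <= Num.min c 1 by rewrite le_min ler01 ltW.
apply: (@le_trans _ _ ((Num.min c 1)%:E * \int[mu]_(x in `[s, t]) rho x)%E).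
  by apply: lee_wpmul2l; rewrite ?lee_fin//; exact: piecewise_dist_le_int.
rewrite primitiveB//; apply: integral_le_scale => // x /andP[sx xt].
rewrite lee_wpmul2r// le_min lee_fin ge_min lexx orbT andbT.
apply: (@le_trans _ _ c%:E); first by rewrite lee_fin ge_min lexx.
by apply/ltW/cK; rewrite (ltW sx).
Qed.

Lemma clockK_dist s t c : 0 <= s -> s <= t -> t <= 1 -> 0 <= c ->
  (forall r, s < r <= t -> (c%:E < K (g r))%E) ->
  (c%:E * d (g s) (g t) <= (clockK t - clockK s)%:E)%E.
Proof.
move=> s0 st t1 c0 cK.
apply: (@le_trans _ _ (c%:E * \int[mu]_(x in `[s, t]) rho x)%E).
  by apply: lee_wpmul2l; rewrite ?lee_fin//; exact: piecewise_dist_le_int.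
rewrite primitiveB//; apply: integral_le_scale => // x sxt.
by rewrite lee_wpmul2r// ltW// cK.
Qed.

(** Where K > c the cost density K rho is at least max (c, 1) times the clock
    density min (K, 1) rho. *)
Lemma clock1_clockK s t c : 0 <= s -> s <= t -> t <= 1 -> 0 < c ->
  (forall r, s <= r <= t -> (c%:E < K (g r))%E) ->
  Num.max c 1 * (clock1 t - clock1 s) <= clockK t - clockK s.
Proof.
move=> s0 st t1 c0 cK; rewrite -lee_fin EFinM !primitiveB//.
apply: integral_le_scale => // [|x /andP[sx xt]]; first by rewrite le_max ler01 orbT.
rewrite muleA lee_wpmul2r//.
have cKx : (c%:E < K (g x))%E by apply: cK; rewrite (ltW sx).
have [c1|c1] := leP c 1.
  by rewrite mul1e ge_min lexx.
have := cKx; case: (K (g x)) (K0 (g x)) => [r||] // _; last by rewrite leey.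
rewrite lte_fin => cr; rewrite min_r; first by rewrite mule1 lee_fin ltW.
by rewrite lee_fin; lra.
Qed.

Lemma clock1_le s t : 0 <= s -> s <= t -> t <= 1 -> clock1 s <= clock1 t.
Proof. exact: primitive_le. Qed.

Lemma clockK_le s t : 0 <= s -> s <= t -> t <= 1 -> clockK s <= clockK t.
Proof. exact: primitive_le. Qed.

Lemma clock1_le_clockK : clock1 1 <= clockK 1.
Proof.
rewrite -lee_fin !primitive1//; apply: ge0_le_integral => //.
- exact: measurable_funTS.
- exact: measurable_funTS.
Qed.

Lemma clock1_0 : clock1 0 = 0. Proof. exact: primitive0. Qed.
Lemma clockK_0 : clockK 0 = 0. Proof. exact: primitive0. Qed.

Lemma clock1_continuous : {within `[0, 1], continuous clock1}.
Proof. exact: primitive_continuous. Qed.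

Lemma clockK_Klength : ((clockK 1)%:E <= Klength d K `[0%R, 1%R] g)%E.
Proof. by rewrite primitive1//; exact: int_speed_le_Klength. Qed.

(** Go back from t to the last time s at which K <= l (or to 0): between s and t
    the curve stays in {K > l}, so each unit of length there costs at least l.
    Hence points of the curve are close to a sublevel set of K when l is large,
    which will give relative compactness. *)
Lemma excursion t l : 0 <= t <= 1 -> 0 <= l -> exists s,
  [/\ 0 <= s <= t, s = 0 \/ (K (g s) <= l%:E)%E &
      (l%:E * d (g s) (g t) <= (clockK 1)%:E)%E].
Proof.
move=> /andP[t0 t1] l0.
pose S := [set s | 0 <= s <= t /\ (s = 0 \/ (K (g s) <= l%:E)%E)].
have S0 : S 0 by split; [rewrite lexx|left].
have supS : has_sup S by split; [exists 0 | exists t => s [/andP[]]].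
have s0 : 0 <= sup S by apply: ub_le_sup S0; case: supS.
have st : sup S <= t by apply: ge_sup => [|s [/andP[]]]; first by exists 0.
exists (sup S); split; first by rewrite s0.
  have [->|sN0] := eqVneq (sup S) 0; first by left.
  right; rewrite leNgt; apply/negP => /Kl[V gV VK].
  have /nbhs_ballP[e /= e0 eV] := @cg (sup S) _ gV.
  have e'0 : 0 < Num.min e (sup S) by rewrite lt_min e0 lt_neqAle eq_sym sN0.
  have [s Ss es] := sup_adherent e'0 supS.
  have ss : s <= sup S by apply: ub_le_sup Ss; case: supS.
  have m1 : Num.min e (sup S) <= e by rewrite ge_min lexx.
  have m2 : Num.min e (sup S) <= sup S by rewrite ge_min lexx orbT.
  case: Ss => _ [s0'|]; first by lra.
  rewrite leNgt => /negP; apply; apply: VK; apply: eV.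
  by rewrite /ball/= ger0_norm; lra.
apply: le_trans (_ : (clockK t - clockK (sup S))%:E <= _)%E.
  apply: clockK_dist => // r /andP[sr rt]; rewrite ltNge; apply/negP => Kr.
  have : r <= sup S; last by rewrite leNgt sr.
  by apply: ub_le_sup; [case: supS|split; [lra|right]].
rewrite lee_fin; have := clockK_le t0 t1 (lexx 1).
by have := clockK_le (lexx 0) s0 (le_trans st t1); rewrite clockK_0; lra.
Qed.

End WeightedLength.

(** * A modulus of continuity shared by all curves in F *)

Section Crossing.
Context {R : realType}.
Local Open Scope ring_scope.

(** Pigeonhole: n points cannot meet all windows of an interval of length e; the
    free width h depends on n and e only. *)
Lemma avoid_values (n : nat) (e : R) : 0 < e -> exists2 h, 0 < h &
  forall (zs : seq R) (p : R), size zs = n -> exists a,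
    [/\ p <= a, a + h <= p + e & forall z, z \in zs -> z + h <= a \/ a + h + h <= z].
Proof.
elim: n e => [|n IHn] e e0.
  exists e => // zs p /size0nil ->; exists p; split => //; lra.
have e3 : 0 < e / 3 by lra.
have [h h0 Hh] := IHn _ e3; exists (Num.min h (e / 6)).
  by rewrite lt_min h0; lra.
have m1 : Num.min h (e / 6) <= h by rewrite ge_min lexx.
have m2 : Num.min h (e / 6) <= e / 6 by rewrite ge_min lexx orbT.
move: (Num.min _ _) m1 m2 => m m1 m2 [//|z zs] p /= [szs].
have [zl|zg] := leP z (p + e / 2).
  have [a [pa ae azs]] := Hh zs (p + 2 * e / 3) szs.
  exists a; split; [lra|lra|move=> z']; rewrite inE => /predU1P[->|/azs[|]];
    [left|left|right]; lra.
have [a [pa ae azs]] := Hh zs p szs.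
exists a; split; [lra|lra|move=> z']; rewrite inE => /predU1P[->|/azs[|]];
  [right|left|right]; lra.
Qed.

Lemma first_time (f : R -> R) (s t q : R) :
  (forall r e, 0 < e -> exists2 h, 0 < h & forall r', `|r' - r| < h -> `|f r' - f r| < e) ->
  s <= t -> q <= f t ->
  exists t1, [/\ s <= t1 <= t, q <= f t1 & forall r, s <= r < t1 -> f r < q].
Proof.
move=> cf st qt.
pose A := [set r | s <= r <= t /\ q <= f r].
have At : A t by split; rewrite ?st ?lexx.
have infA : has_inf A by split; [exists t | exists s => r [/andP[]]].
have mt : inf A <= t by apply: ge_inf At; case: infA.
have sm : s <= inf A by apply: lb_le_inf => [|r [/andP[]]]; first by exists t.
exists (inf A); split; first by rewrite sm.
  rewrite leNgt; apply/negP => fm.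
  have e0 : 0 < q - f (inf A) by lra.
  have [h h0 Hh] := cf (inf A) _ e0.
  have [r Ar rh] := inf_adherent h0 infA.
  have ir : inf A <= r by apply: ge_inf Ar; case: infA.
  have := Hh r; rewrite ger0_norm ?subr_ge0// => /(_ ltac:(lra)).
  by case: Ar => _ qr; rewrite ltr_norml => /andP[_]; lra.
move=> r /andP[sr rm]; rewrite ltNge; apply/negP => qr.
have : inf A <= r; last by rewrite leNgt rm.
by apply: ge_inf; [case: infA|split=> //; lra].
Qed.

(** Take the first time f reaches q, then the last time before it f is at most
    p; in between f stays in [p, q]. *)
Lemma crossing (f : R -> R) (s t p q : R) :
  (forall r e, 0 < e -> exists2 h, 0 < h & forall r', `|r' - r| < h -> `|f r' - f r| < e) ->
  s <= t -> f s <= p -> p < q -> q <= f t ->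
  exists s1 t1, [/\ s <= s1, s1 <= t1, t1 <= t, q - p <= f t1 - f s1 &
    forall r, s1 <= r <= t1 -> p <= f r <= q].
Proof.
move=> cf st sp pq qt.
have [t1 [/andP[st1 t1t] qt1 lt1]] := first_time cf st qt.
have cf' r e : 0 < e -> exists2 h, 0 < h & forall r', `|r' - r| < h ->
    `|(- f (- r')) - (- f (- r))| < e.
  move=> e0; have [h h0 Hh] := cf (- r) _ e0; exists h => // r' r'r.
  rewrite -opprD normrN; apply: Hh.
  by rewrite -opprD normrN.
have st1' : - t1 <= - s by rewrite lerN2.
have [|s1 [/andP[ts1 s1s] ps1 gs1]] := @first_time (fun r => - f (- r)) (- t1) (- s) (- p) cf' st1'.
  by rewrite opprK lerN2.
rewrite /= in ps1 gs1.
have gs r : - s1 < r <= t1 -> p < f r.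
  by move=> rs1; have := gs1 (- r); rewrite opprK ltrN2; apply; lra.
have s1t1 : - s1 <= t1 by lra.
exists (- s1), t1; split; [lra|lra|lra|lra|].
move=> r /andP[s1r rt1]; apply/andP; split; last first.
  have [rt|tr] := ltP r t1; first by apply/ltW/lt1; lra.
  have -> : r = t1 by lra.
  apply/ler_addgt0Pr => e e0; have [h h0 Hh] := cf t1 _ e0.
  have [s_t1|t1s] := ltP s t1; last first.
    have t1E : t1 = s by lra.
    by move: qt1; rewrite t1E; lra.
  pose v := t1 - Num.min (h / 2) (t1 - s).
  have m0 : 0 < Num.min (h / 2) (t1 - s) by rewrite lt_min; apply/andP; split; lra.
  have m1 : Num.min (h / 2) (t1 - s) <= h / 2 by rewrite ge_min lexx.
  have m2 : Num.min (h / 2) (t1 - s) <= t1 - s by rewrite ge_min lexx orbT.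
  have vt1 : `|v - t1| < h by rewrite /v addrAC subrr add0r normrN gtr0_norm//; lra.
  have := Hh _ vt1; rewrite ltr_norml => /andP[].
  have := lt1 v ltac:(rewrite /v; lra).
  lra.
have [s1r'|rs1] := ltP (- s1) r; first by apply/ltW/gs; rewrite s1r'.
have -> : r = - s1 by lra.
rewrite leNgt; apply/negP => fp.
have s1t : - s1 < t1.
  rewrite lt_neqAle s1t1 andbT; apply/eqP => s1E; move: fp; rewrite s1E; lra.
have e0 : 0 < p - f (- s1) by lra.
have [h h0 Hh] := cf (- s1) _ e0.
pose v := - s1 + Num.min (h / 2) (t1 + s1).
have m0 : 0 < Num.min (h / 2) (t1 + s1) by rewrite lt_min; apply/andP; split; lra.
have m1 : Num.min (h / 2) (t1 + s1) <= h / 2 by rewrite ge_min lexx.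
have m2 : Num.min (h / 2) (t1 + s1) <= t1 + s1 by rewrite ge_min lexx orbT.
have vs1 : `|v - - s1| < h by rewrite /v addrAC subrr add0r gtr0_norm//; lra.
have := Hh _ vs1; rewrite ltr_norml => /andP[_].
have := gs v ltac:(rewrite /v; lra).
lra.
Qed.

End Crossing.

Section Modulus.
Context {R : realType} {X : pseudoMetricType R} (d : X -> X -> \bar R).
Hypothesis dm : emetric d.
Local Open Scope ring_scope.
Variable K : X -> \bar R.
Hypothesis Kl : lower_semicontinuous K.
Hypothesis K0 : forall x, (0 <= K x)%E.
Hypothesis Kz : finite_set [set x | K x = 0%E].
Variable F : set X.
Hypothesis cF : forall l : R, compact (F `&` [set x | (K x <= l%:E)%E]).

Let d_ge0 x y : (0 <= d x y)%E := emetric_ge0 dm x y.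

(** Lower semicontinuity bounds K from below near each point of the compact set
    F `&` {K <= 1} that is not a zero, and near a zero the hypothesis fails. *)
Lemma lower_bound_away_zeros (h : R) : 0 < h -> exists2 k, 0 < k < 1 &
  forall z, F z -> (forall y, K y = 0%E -> (h%:E <= d z y)%E) -> (k%:E < K z)%E.
Proof.
move=> h0; pose P k z := (forall y, K y = 0%E -> (h%:E <= d z y)%E) -> (k%:E < K z)%E.
have : \forall k \near (0:R)^'+, F `&` [set x | (K x <= 1%:E)%E] `<=` P k.
  have nc := (compact_near_coveringP _).1 (@cF 1).
  apply: (nc R (0:R)^'+ P _) => z _.
  have [Kz0|Kz0] := eqVneq (K z) 0%E.
    exists (ball z h, setT) => /=; first by split; [exact: nbhsx_ballx|exact: filterT].
    move=> [z' k] [/= zz' _] /(_ z Kz0).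
    by rewrite (emetric_sym dm) leNgt; move/(emetric_ballP dm): zz' => ->.
  have [c c0 cK] : exists2 c, 0 < c & (c%:E < K z)%E.
    have : (0 < K z)%E by rewrite lt_neqAle eq_sym Kz0 K0.
    case: (K z) => [r||]//; last by exists 1; rewrite ?ltry.
    by rewrite lte_fin => r0; exists (r / 2); rewrite ?lte_fin; lra.
  have [V zV VK] := Kl cK.
  exists (V, [set k | k < c]) => /=.
    split=> //; exact: nbhs_right_lt.
  move=> [z' k] [/= /VK cKz' kc] _; apply: lt_trans cKz'.
  by rewrite lte_fin.
move=> near0.
near (0:R)^'+ => k.
have k0 : 0 < k by [].
have k1 : k < 1 by near: k; exact: nbhs_right_lt.
have Pk : F `&` [set x | (K x <= 1%:E)%E] `<=` P k by near: k.
exists k; first by rewrite k0.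
move=> z Fz zfar; have [K1|K1] := leP (K z) 1%:E; first exact: Pk.
by apply: lt_trans K1; rewrite lte_fin.
Unshelve. all: by end_near. Qed.

(** The cap makes the distance real-valued, as needed to follow it along a curve. *)
Definition capped_dist (e : R) (z x : X) : R := fine (mine (d z x) e%:E).

Lemma capped_distE e z x : 0 < e -> ((capped_dist e z x)%:E = mine (d z x) e%:E)%E.
Proof.
move=> e0; rewrite /capped_dist fineK// ge0_fin_numE.
  by rewrite gt_min ltry orbT.
by rewrite le_min d_ge0 lee_fin ltW.
Qed.

Lemma capped_dist_lip e z x y : 0 < e ->
  (`|capped_dist e z x - capped_dist e z y|%:E <= d x y)%E.
Proof.
move=> e0.
have half a b : ((capped_dist e z a)%:E <= (capped_dist e z b)%:E + d a b)%E.
  rewrite !capped_distE//; have [dzb|ezb] := leP (d z b) e%:E.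
    apply: (@le_trans _ _ (d z a)); first by rewrite ge_min lexx.
    by rewrite (emetric_sym dm a); exact: emetric_triangle.
  by apply: (@le_trans _ _ e%:E); rewrite ?leeDl// ge_min lexx orbT.
have [dfin|dinf] := boolP (d x y \is a fin_num); last first.
  suff -> : d x y = +oo%E by rewrite leey.
  by apply/eqP; rewrite -leye_eq leNgt -ge0_fin_numE.
have := half x y; have := half y x; rewrite (emetric_sym dm y).
rewrite -(fineK dfin) -!EFinD !lee_fin ler_norml => h1 h2.
by apply/andP; split; lra.
Qed.

(** What the modulus needs to know of a curve in F and of its clock. *)
Definition clocked (g : R -> X) (u : R -> R) : Prop :=
  [/\ continuous g,
      forall t, 0 <= t <= 1 -> F (g t),
      forall s t, 0 <= s -> s <= t -> t <= 1 -> u s <= u t &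
      forall s t c, 0 <= s -> s <= t -> t <= 1 -> 0 < c ->
        (forall r, s <= r <= t -> (c%:E < K (g r))%E) ->
        ((Num.min c 1)%:E * d (g s) (g t) <= (u t - u s)%:E)%E].

Definition clock_modulus (g : R -> X) (u : R -> R) (delta e : R) : Prop :=
  forall s t, 0 <= s -> s <= t -> t <= 1 -> u t - u s < delta ->
    (d (g s) (g t) < e%:E)%E.

(** To get e away from g s, the curve has to cross each shell
    {a <= d (g s) x <= a + h} with a + h <= e.  The zeros of K being finitely
    many, some shell stays h away from all of them, with h depending only on e;
    there K > k, and crossing it takes at least k h of the clock.  Neither h nor
    k depends on the curve. *)
Lemma modulus (e : R) : 0 < e -> exists2 delta, 0 < delta &
  forall g u, clocked g u -> clock_modulus g u delta e.
Proof.
move=> e0; have /finite_seqP[zs zsE] := Kz.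
have [h h0 Hh] := avoid_values (size zs) e0.
have [k /andP[k0 k1] kK] := lower_bound_away_zeros h0.
exists (k * h); first exact: mulr_gt0.
move=> g u [cg gF undec gu_speed] s t s0 st t1 ust; rewrite ltNge; apply/negP => ed.
pose psi r := capped_dist e (g s) (g r).
have cpsi r c : 0 < c -> exists2 y, 0 < y & forall r', `|r' - r| < y -> `|psi r' - psi r| < c.
  move=> c0; have [y y0 Hy] := curve_close dm (cg r) c0; exists y => // r' /Hy.
  rewrite distrC -lte_fin; apply: le_lt_trans; exact: capped_dist_lip.
have psis : psi s = 0.
  by apply/EFin_inj; rewrite capped_distE// emetric_xx// min_l// lee_fin ltW.
have psit : psi t = e by apply/EFin_inj; rewrite capped_distE// min_r.
have [a [a0 ah azs]] := Hh (map (capped_dist e (g s)) zs) 0 (size_map _ _).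
have [|||s1 [t1' [ss1 s1t1 t1t hpsi between]]] := @crossing _ psi s t a (a + h) cpsi st.
- by rewrite psis.
- by rewrite ltrDl.
- by rewrite psit; lra.
have far r : s1 <= r <= t1' -> (k%:E < K (g r))%E.
  move=> sr; apply: kK => [|y Ky]; first by apply: gF; lra.
  apply: le_trans (capped_dist_lip (g s) (g r) y e0).
  rewrite lee_fin -/(psi r).
  have yzs : y \in zs by have : [set x | K x = 0%E] y by []; rewrite zsE.
  have /andP[b1 b2] := between _ sr.
  case: (azs (capped_dist e (g s) y)); first exact: map_f.
    by move=> ?; rewrite ler_normr; apply/orP; left; lra.
  by move=> ?; rewrite ler_normr; apply/orP; right; lra.
have := gu_speed s1 t1' k ltac:(lra) s1t1 ltac:(lra) k0 far.
rewrite (min_l (ltW k1)) => H.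
have : ((k * h)%:E <= (u t1' - u s1)%:E)%E.
  apply: le_trans H; rewrite EFinM; apply: lee_wpmul2l; first by rewrite lee_fin ltW.
  apply: le_trans (capped_dist_lip (g s) _ _ e0); rewrite lee_fin -/(psi s1) -/(psi t1').
  by rewrite distrC ler_normr; apply/orP; left; lra.
rewrite lee_fin leNgt => /negP; apply.
have := undec s s1 s0 ss1 ltac:(lra); have := undec t1' t ltac:(lra) t1t t1.
lra.
Qed.

End Modulus.

(** * Reparametrization by the clock and passage to the limit *)

Section Reparametrization.
Context {R : realType} {X : pseudoMetricType R} (d : X -> X -> \bar R).
Hypothesis dm : emetric d.
Variable K : X -> \bar R.
Local Open Scope ring_scope.

(** The traces left by the weighted length on a curve run at constant clock
    speed U: bounds on intervals where K > c, for every c.  By lower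
    semicontinuity of K they are stable under uniform limits, and they are
    strong enough to recover the weighted length of a curve with few zeros. *)
Definition speed_bound (T U : R) (sg : R -> X) : Prop :=
  forall s t c, 0 <= s -> s <= t -> t <= T -> 0 < c ->
    (forall r, s <= r <= t -> (c%:E < K (sg r))%E) ->
    ((Num.min c 1)%:E * d (sg s) (sg t) <= (U * (t - s))%:E)%E.

Definition cost_bound (T U : R) (sg : R -> X) (w : R -> R) : Prop :=
  forall s t c, 0 <= s -> s <= t -> t <= T -> 0 < c ->
    (forall r, s <= r <= t -> (c%:E < K (sg r))%E) ->
    Num.max c 1 * (U * (t - s)) <= w t - w s.

Definition nondecreasing_upto (T : R) (w : R -> R) : Prop :=
  forall s t, 0 <= s -> s <= t -> t <= T -> w s <= w t.

Definition clamp (t : R) : R := Num.max 0 (Num.min t 1).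

Lemma clamp01 t : 0 <= clamp t <= 1.
Proof. by rewrite /clamp le_max lexx/= ge_max ler01 ge_min lexx orbT. Qed.

Lemma clampE t : 0 <= t <= 1 -> clamp t = t.
Proof. by move=> /andP[t0 t1]; rewrite /clamp (min_l t1) (max_r t0). Qed.

Lemma clampP t : [\/ t <= 0 /\ clamp t = 0, 0 <= t <= 1 /\ clamp t = t
  | 1 <= t /\ clamp t = 1].
Proof.
have [t0|t0] := leP t 0.
  by apply: Or31; split=> //; rewrite /clamp min_l ?max_l//; lra.
have [t1|t1] := leP t 1.
  by apply: Or32; rewrite clampE (ltW t0).
by apply: Or33; split; [exact: ltW|rewrite /clamp min_r ?max_r// ltW].
Qed.

Lemma clamp_lip s t : `|clamp s - clamp t| <= `|s - t|.
Proof.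
have half a b : clamp a - clamp b <= `|a - b|.
  have := ler_norm (a - b); have := normr_ge0 (a - b).
  by case: (clampP a) => -[? ->]; case: (clampP b) => -[? ->]; lra.
rewrite ler_norml half andbT; have := half t s; rewrite distrC; lra.
Qed.

Variables (g : R -> X) (u w : R -> R).
Hypothesis u0 : u 0 = 0.
Hypothesis u1 : 0 < u 1.
Hypothesis und : nondecreasing_upto 1 u.
Hypothesis wnd : nondecreasing_upto 1 w.
Hypothesis w0 : w 0 = 0.
Hypothesis uc : {within `[0, 1], continuous u}.
Hypothesis gu_speed : forall s t c, 0 <= s -> s <= t -> t <= 1 -> 0 < c ->
    (forall r, s <= r <= t -> (c%:E < K (g r))%E) ->
    ((Num.min c 1)%:E * d (g s) (g t) <= (u t - u s)%:E)%E.
Hypothesis uw_cost : forall s t c, 0 <= s -> s <= t -> t <= 1 -> 0 < c ->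
    (forall r, s <= r <= t -> (c%:E < K (g r))%E) ->
    Num.max c 1 * (u t - u s) <= w t - w s.

Hypothesis mod_ex : forall e : R, 0 < e -> exists2 delta : R, 0 < delta & clock_modulus d g u delta e.

(** The clock may be constant on an interval, but then the curve is too. *)
Lemma clock_determines s t : 0 <= s <= 1 -> 0 <= t <= 1 -> u s = u t -> g s = g t.
Proof.
wlog st : s t / s <= t.
  move=> H s01 t01 ust; have [st|ts] := leP s t; first exact: H.
  by apply/esym/H => //; exact: ltW.
move=> /andP[s0 s1] /andP[t0 t1] ust; apply: (emetric_small0 dm) => e e0.
by have [delta delta0] := mod_ex e0; apply => //; rewrite ust subrr.
Qed.

(** sg r is g at any time t at which the clock shows U r, U = u 1 being its final
    value.  The times between those chosen for s and t are, up to intervals on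
    which g does not move, those chosen between s and t (the claim cover), so
    the bounds for g carry over. *)
Lemma reparametrize : exists (sg : R -> X) (om : R -> R),
  [/\ sg 0 = g 0, sg 1 = g 1 & forall r, exists2 t, 0 <= t <= 1 & sg r = g t] /\
  [/\ speed_bound 1 (u 1) sg, cost_bound 1 (u 1) sg om,
      nondecreasing_upto 1 om & forall r, 0 <= om r <= w 1] /\
  forall e delta, clock_modulus d g u delta e ->
    forall r r', u 1 * `|r - r'| < delta -> (d (sg r) (sg r') < e%:E)%E.
Proof.
have ex r : exists t, 0 <= t <= 1 /\ u t = u 1 * clamp r.
  have /andP[c0 c1] := clamp01 r.
  have [|t] := @IVT _ u 0 1 (u 1 * clamp r) ler01 uc.
    rewrite u0 (min_l (ltW u1)) (max_r (ltW u1)) mulr_ge0 ?(ltW u1)//=.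
    by rewrite ler_piMr// ltW.
  by rewrite in_itv/= => t01 ut; exists t.
have [tt ttP] := choice ex.
have tt01 r : 0 <= tt r <= 1 by case: (ttP r).
have utt r : u (tt r) = u 1 * clamp r by case: (ttP r).
have utt' r : 0 <= r <= 1 -> u (tt r) = u 1 * r by move=> r01; rewrite utt clampE.
have tt_mono s t : 0 <= s -> s <= t -> t <= 1 -> tt s <= tt t.
  move=> s0 st t1; have [<-//|sNt] := eqVneq s t.
  have {}st : s < t by rewrite lt_neqAle sNt.
  rewrite leNgt; apply/negP => ttt.
  have /andP[a0 a1] := tt01 t; have /andP[b0 b1] := tt01 s.
  have := und a0 (ltW ttt) b1; rewrite !utt'; [|lra|lra].
  by rewrite ler_pM2l// leNgt st.
have cover s t r : 0 <= s -> s <= t -> t <= 1 -> tt s <= r <= tt t ->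
    exists2 v, s <= v <= t & g (tt v) = g r.
  move=> s0 st t1 /andP[sr rt].
  have /andP[a0 a1] := tt01 t; have /andP[b0 b1] := tt01 s.
  have us : u 1 * s <= u r by rewrite -utt'; [apply: und|]; lra.
  have ut : u r <= u 1 * t by rewrite -utt'; [apply: und|]; lra.
  have sv : s <= u r / u 1 by rewrite ler_pdivlMr// mulrC.
  have vt : u r / u 1 <= t by rewrite ler_pdivrMr// mulrC.
  exists (u r / u 1); first by rewrite sv.
  apply: clock_determines => //; first lra.
  by rewrite utt'; [rewrite mulrC divfK// gt_eqF|lra].
have ge1 : 0 <= (1 : R) <= 1 by rewrite ler01 lexx.
have ge0 : 0 <= (0 : R) <= 1 by rewrite ler01 lexx.
exists (g \o tt), (w \o tt); split; [|split]; [split|split|].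
- by apply: clock_determines => //; rewrite utt' // mulr0 u0.
- by apply: clock_determines => //; rewrite utt' // mulr1.
- by move=> r; exists (tt r).
- move=> s t c s0 st t1 c0 Kc /=.
  have /andP[a0 a1] := tt01 t; have /andP[b0 b1] := tt01 s.
  have -> : u 1 * (t - s) = u (tt t) - u (tt s) by rewrite !utt' ?mulrBr//; lra.
  apply: gu_speed => //; first exact: tt_mono.
  by move=> r /(cover _ _ _ s0 st t1)[v svt <-]; exact: Kc.
- move=> s t c s0 st t1 c0 Kc /=.
  have /andP[a0 a1] := tt01 t; have /andP[b0 b1] := tt01 s.
  have -> : u 1 * (t - s) = u (tt t) - u (tt s) by rewrite !utt' ?mulrBr//; lra.
  apply: uw_cost => //; first exact: tt_mono.
  by move=> r /(cover _ _ _ s0 st t1)[v svt <-]; exact: Kc.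
- move=> s t s0 st t1 /=.
  have /andP[a0 a1] := tt01 t; have /andP[b0 b1] := tt01 s.
  by apply: wnd => //; exact: tt_mono.
- move=> r /=; have /andP[a0 a1] := tt01 r.
  by rewrite -w0 !wnd.
- move=> e delta dmod r r' rr' /=.
  have /andP[a0 a1] := tt01 r; have /andP[b0 b1] := tt01 r'.
  have urr' : `|u (tt r) - u (tt r')| < delta.
    rewrite !utt -mulrBr normrM gtr0_norm//; apply: le_lt_trans rr'.
    by rewrite ler_pM2l// clamp_lip.
  have [rr|rr] := leP (tt r) (tt r').
    apply: dmod => //; apply: le_lt_trans urr'.
    by rewrite distrC ler_norm.
  rewrite (emetric_sym dm); apply: dmod => //; first exact: ltW.
  by apply: le_lt_trans urr'; rewrite ler_norm.
Qed.

End Reparametrization.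

Section Limit.
Context {R : realType} {X : completePseudoMetricType R} (d : X -> X -> \bar R).
Hypothesis dm : emetric d.
Variable K : X -> \bar R.
Hypothesis Kl : lower_semicontinuous K.
Local Open Scope ring_scope.
Variable F : set X.
Hypothesis cF : forall l : R, compact (F `&` [set x | (K x <= l%:E)%E]).
Variables (x y : X) (U : nat -> R) (sg : nat -> R -> X) (w : nat -> R -> R) (B C D : R).
Hypothesis B0 : 0 <= B.
Hypothesis UC : forall n, B <= U n <= C.
Hypothesis sg0 : forall n, sg n 0 = x.
Hypothesis sg1 : forall n, sg n 1 = y.
Hypothesis sgS : forall n, speed_bound d K 1 (U n) (sg n).
Hypothesis sgW : forall n, cost_bound K 1 (U n) (sg n) (w n).
Hypothesis wnd : forall n, nondecreasing_upto 1 (w n).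
Hypothesis wC : forall n r, 0 <= w n r <= C.
Hypothesis wD : forall e : R, 0 < e -> \forall n \near \oo, forall r, w n r <= D + e.
Hypothesis equi : forall e : R, 0 < e -> exists2 delta : R, 0 < delta &
  forall n r r', `|r - r'| < delta -> (d (sg n r) (sg n r') < e%:E)%E.
Hypothesis near_F : forall (n : nat) (r l : R), 0 <= l -> exists p,
  (p = x \/ F p /\ (K p <= l%:E)%E) /\ (l%:E * d (sg n r) p <= C%:E)%E.

Let d_ge0 a b : (0 <= d a b)%E := emetric_ge0 dm a b.

(** Along an ultrafilter a sequence in a compact set converges; this replaces
    the extraction of diagonal subsequences. *)
Lemma compact_ultra_near (T : topologicalType) (A : set T) (G : set_system nat)
    (p : nat -> T) : UltraFilter G -> compact A -> (forall n, A (p n)) ->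
  exists2 q, A q & forall V, nbhs q V -> \forall n \near G, V (p n).
Proof.
move=> UG cA Ap.
have PG : ProperFilter G := @ultra_proper _ _ UG.
have [|q [Aq cq]] := cA (p @ G) _ _; first by apply: (@filterE _ G) => n; exact: Ap.
exists q => // V qV.
have [//|GV] := in_ultra_setVsetC (p @^-1` V) UG.
have GVp : G (p @^-1` (p @` (~` (p @^-1` V)))) by apply: filterS GV => n nV /=; exists n.
by have [_ [/= [n nV <-]]] := cq _ _ GVp qV; move/nV.
Qed.

(** Pointwise limits along one ultrafilter.  They exist because sg n r is within
    C / l of the compact set {x} `|` F `&` {K <= l}, for every l, and X is
    complete.  Equicontinuity makes the limit continuous, and makes the strict
    bound K > c on an interval pass from the limit back to sg n for most n, by
    compactness of the interval; then the bounds of sg n apply. *)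
Lemma limit_curve : exists (U' : R) (s : R -> X) (w' : R -> R),
  [/\ B <= U', continuous s, s 0 = x & s 1 = y] /\
  [/\ speed_bound d K 1 U' s, cost_bound K 1 U' s w', nondecreasing_upto 1 w' &
      forall r, 0 <= w' r <= D].
Proof.
have [G [UG ooG]] := @ultraFilterLemma nat \oo _.
have PG : ProperFilter G := @ultra_proper _ _ UG.
have both (P Q : nat -> Prop) : G P -> G Q -> G (fun n => P n /\ Q n).
  by move=> GP GQ; exact: (@filterI _ G _ _ _ GP GQ).
have pick (P : nat -> Prop) : G P -> exists n, P n by exact: filter_ex.
have C0 : 0 <= C by case/andP: (UC 0%N) => h1 h2; rewrite (le_trans B0)// (le_trans h1).
have real_lim (lo : R) (a : nat -> R) : (forall n, lo <= a n <= C) -> exists2 l : R, lo <= l <= C &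
    forall e : R, 0 < e -> \forall n \near G, `|l - a n| < e.
  move=> aC; have aC' n : `[lo, C]%classic (a n) by rewrite /= in_itv/=.
  have [l lC al] := compact_ultra_near UG (@segment_compact R lo C) aC'.
  exists l; first by move: lC; rewrite /= in_itv.
  by move=> e e0; have := al _ (nbhsx_ballx l e e0).
have [U' /andP[U'B U'C] Ul] := real_lim B U UC.
have U'0 : 0 <= U' by exact: le_trans U'B.
have w_ex (r : R) : exists l : R, 0 <= l <= C /\
    forall e : R, 0 < e -> \forall n \near G, `|l - w n r| < e.
  by have [l lC al] := real_lim 0 (w^~ r) (wC^~ r); exists l.
have [w' w'P] := choice w_ex.
have wl (r e : R) : 0 < e -> \forall n \near G, `|w' r - w n r| < e.
  by case: (w'P r) => _; exact.
have s_ex (r : R) : exists l : X, forall e : R, 0 < e ->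
    \forall n \near G, (d l (sg n r) < e%:E)%E.
  have cau : cauchy ((fun n => sg n r) @ G).
    apply: cauchy_exP => e e0.
    pose l := (C + 1) / (e / 2).
    have l0 : 0 < l by rewrite divr_gt0//; lra.
    have [p pP] := choice (fun n => near_F n r (ltW l0)).
    pose A : set X := [set x] `|` (F `&` [set z | (K z <= l%:E)%E]).
    have cA : compact A by apply: compactU => //; exact: compact_set1.
    have Ap n : A (p n) by case: (pP n) => -[->|Fp] _; [left|right].
    have [q Aq pq] := compact_ultra_near UG cA Ap.
    exists q; have e20 : 0 < e / 2 by lra.
    apply: filterS (pq _ (nbhsx_ballx q (e / 2) e20)) => n /(emetric_ballP dm) qpn.
    apply/(emetric_ballP dm); apply: (le_lt_trans (emetric_triangle dm (p n) _ _)).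
    rewrite (splitr e) EFinD; apply: lteD => //.
    rewrite (emetric_sym dm); have [_] := pP n.
    rewrite ltNge; apply: contraTN => ed; rewrite -ltNge.
    apply: (@lt_le_trans _ _ (l%:E * (e / 2)%:E)%E); last first.
      by apply: lee_wpmul2l => //; rewrite lee_fin ltW.
    by rewrite -EFinM /l divfK ?gt_eqF// lte_fin; lra.
  have [l sgl] := (cvg_ex _).1 (@cauchy_cvg _ ((fun n => sg n r) @ G) _ cau).
  exists l => e e0.
  have lG : G (fun n => ball l e (sg n r)) := sgl _ (nbhsx_ballx l e e0).
  by apply: filterS lG => n /(emetric_ballP dm).
have [s sl] := choice s_ex.
have eq_lim r z : (forall n, sg n r = z) -> s r = z.
  move=> sgz; apply: (emetric_small0 dm) => e e0.
  by have /pick[n] := sl r e e0; rewrite sgz.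
have s_equi (e : R) : 0 < e -> exists2 delta : R, 0 < delta &
    forall r r', `|r - r'| < delta -> (d (s r) (s r') < e%:E)%E.
  move=> e0; have e40 : 0 < e / 4 by lra.
  have [delta delta0 H] := equi e40; exists delta => // r r' /(fun h n => H n _ _ h) sgrr'.
  have /pick[n [d1 d2]] := both _ _ (sl r _ e40) (sl r' _ e40).
  apply: (le_lt_trans (emetric_triangle dm (sg n r) _ _)).
  apply: (@le_lt_trans _ _ ((e / 4)%:E + ((e / 4)%:E + (e / 4)%:E))%E); last first.
    by rewrite -!EFinD lte_fin; lra.
  apply: leeD; first exact: ltW.
  apply: (le_trans (emetric_triangle dm (sg n r') _ _)); apply: leeD; first exact/ltW/sgrr'.
  by rewrite (emetric_sym dm) ltW.
have cs : continuous s.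
  move=> r; apply/cvg_ballP => e e0; have [delta delta0 H] := s_equi _ e0.
  by apply/nbhs_ballP; exists delta => // r' /H /(emetric_ballP dm).
have Kn (a b c : R) : 0 <= a -> a <= b -> b <= 1 ->
    (forall r, a <= r <= b -> (c%:E < K (s r))%E) ->
    \forall n \near G, forall r, a <= r <= b -> (c%:E < K (sg n r))%E.
  move=> a0 ab b1 Kc.
  have nc := (compact_near_coveringP _).1 (@segment_compact R a b).
  have : \forall n \near G, `[a, b]%classic `<=` (fun r => (c%:E < K (sg n r))%E).
    apply: (nc nat G (fun n r => (c%:E < K (sg n r))%E) _) => r.
    rewrite /= in_itv/= => /Kc /Kl[V /nbhs_ballP[e /= e0 eV] VK].
    have e20 : 0 < e / 2 by lra.
    have [delta delta0 H] := equi e20.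
    exists (ball r delta, [set n | (d (s r) (sg n r) < (e / 2)%:E)%E]) => /=.
      by split; [exact: nbhsx_ballx|exact: sl].
    move=> [r' n] [/= rr' dn]; apply/VK/eV/(emetric_ballP dm).
    apply: (le_lt_trans (emetric_triangle dm (sg n r) _ _)).
    by rewrite (splitr e) EFinD; apply: lteD => //; exact: H.
  by apply: filterS => n H r rab; apply: H; rewrite /= in_itv.
exists U', s, w'; split; [split|split] => //.
- exact: eq_lim.
- exact: eq_lim.
- move=> a b c a0 ab b1 c0 Kc; apply/lee_addgt0Pr => e e0.
  have e30 : 0 < e / 3 by lra.
  have /pick[n [[KnH Un] [da db]]] := both _ _
    (both _ _ (Kn a b c a0 ab b1 Kc) (Ul _ e30))
    (both _ _ (sl a _ e30) (sl b _ e30)).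
  have m0 : 0 <= Num.min c 1 by rewrite le_min ler01 ltW.
  have m1 : Num.min c 1 <= 1 by rewrite ge_min lexx orbT.
  have H := sgS a0 ab b1 c0 KnH.
  have dle : (d (s a) (s b) <= (e / 3 + e / 3)%:E + d (sg n a) (sg n b))%E.
    apply: (le_trans (emetric_triangle dm (sg n a) _ _)).
    rewrite EFinD -addeA; apply: leeD; first exact: ltW.
    rewrite addeC; apply: (le_trans (emetric_triangle dm (sg n b) _ _)).
    by apply: leeD => //; rewrite (emetric_sym dm) ltW.
  apply: (@le_trans _ _ ((Num.min c 1)%:E * ((e / 3 + e / 3)%:E + d (sg n a) (sg n b)))%E).
    by apply: lee_wpmul2l; rewrite ?lee_fin.
  rewrite ge0_muleDr//; last by rewrite lee_fin; lra.
  apply: (@le_trans _ _ ((e / 3 + e / 3)%:E + (U n * (b - a))%:E)%E).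
    apply: leeD => //; rewrite -EFinM lee_fin -[leRHS]mul1r ler_wpM2r//; lra.
  rewrite -!EFinD lee_fin.
  have : U n * (b - a) <= (U' + e / 3) * (b - a).
    by rewrite ler_wpM2r//; [lra|move: Un; rewrite ltr_norml; lra].
  have : e / 3 * (b - a) <= e / 3 by rewrite -[leRHS]mulr1 ler_pM2l//; lra.
  rewrite mulrDl; lra.
- move=> a b c a0 ab b1 c0 Kc; set m := Num.max c 1.
  have m1 : 1 <= m by rewrite le_max lexx orbT.
  apply/ler_addgt0Pr => e e0.
  have e30 : 0 < e / (m + 2) by rewrite divr_gt0//; lra.
  have /pick[n [[KnH Un] [da db]]] := both _ _
    (both _ _ (Kn a b c a0 ab b1 Kc) (Ul _ e30))
    (both _ _ (wl a _ e30) (wl b _ e30)).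
  have H := sgW a0 ab b1 c0 KnH.
  have eE : e = m * (e / (m + 2)) + 2 * (e / (m + 2)).
    by rewrite -mulrDl mulrC divfK// gt_eqF//; lra.
  move: e30 Un da db eE; set q := e / (m + 2) => q0 Un da db eE.
  have : m * (U' * (b - a)) <= m * (U n * (b - a)) + m * q.
    rewrite -mulrDr ler_wpM2l//; first lra.
    have : (U' - U n) * (b - a) <= q * 1.
      apply: (@le_trans _ _ (q * (b - a))); first by rewrite ler_wpM2r//; [lra|move: Un; rewrite ltr_norml; lra].
      by rewrite ler_pM2l//; lra.
    rewrite mulrBl; lra.
  move: H da db; rewrite -/m !ltr_norml; lra.
- move=> a b a0 ab b1; apply/ler_addgt0Pr => e e0.
  have e30 : 0 < e / 2 by lra.
  have /pick[n [da db]] := both _ _ (wl a _ e30) (wl b _ e30).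
  by have := wnd n a0 ab b1; move: da db; rewrite !ltr_norml; lra.
- move=> r; case: (w'P r) => /andP[-> _] _ /=.
  apply/ler_addgt0Pr => e e0.
  have e30 : 0 < e / 2 by lra.
  have /pick[n [da db]] := both _ _ (wl r _ e30) (ooG _ (wD e30)).
  by have := db r; move: da; rewrite !ltr_norml; lra.
Qed.

End Limit.

(** * Reversal of curves *)

Section Reversal.
Context {R : realType} {X : pseudoMetricType R} (d : X -> X -> \bar R).
Hypothesis dm : emetric d.
Variable K : X -> \bar R.
Local Open Scope ring_scope.
Local Notation mu := (@lebesgue_measure R).

Definition opp_bound (b : itv_bound R) : itv_bound R :=
  match b with BSide s a => BSide (~~ s) (- a) | BInfty s => BInfty R (~~ s) end.

Definition opp_itv (I : interval R) : interval R :=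
  let: Interval l r := I in Interval (opp_bound r) (opp_bound l).

Lemma mem_opp_itv I t : (t \in opp_itv I) = (- t \in I).
Proof.
case: I => [[[] l|[]] [[] r|[]]]; rewrite !in_itv/= ?andbF ?andbT//;
  rewrite ?(lerNl r) ?(ltrNl r) ?(lerNr _ l) ?(ltrNr _ l) ?(lerNr l) ?(ltrNr l) ?(lerNl _ r) ?(ltrNl _ r) 1?andbC//.
Qed.

Lemma set_opp_itv I : [set` opp_itv I] = -%R @^-1` [set` I] :> set R.
Proof. by apply/seteqP; split => t /=; rewrite mem_opp_itv. Qed.

Lemma opp_fmap_within_dnbhs I (t : R) :
  within [set` opp_itv I] (t^') = -%R @ within [set` I] ((- t)^').
Proof.
apply/seteqP; split => A.
  rewrite /within/= /dnbhs /= => /nbhs_ballP[e /= e0 He].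
  apply/nbhs_ballP; exists e => // s; rewrite /ball/= => st sNt Is.
  apply: He; last by rewrite mem_opp_itv opprK.
    by rewrite /ball/= opprK -normrN opprD.
  by apply: contra sNt => /eqP <-; rewrite opprK.
rewrite /within/= /dnbhs /= => /nbhs_ballP[e /= e0 He].
apply/nbhs_ballP; exists e => // s; rewrite /ball/= => st sNt Is.
have := He (- s); rewrite /= opprK; apply; last by rewrite -mem_opp_itv.
  by rewrite /ball/= opprK -normrN opprD opprK.
by apply: contra sNt => /eqP /oppr_inj ->.
Qed.

Lemma metric_derivative_opp I (g : R -> X) t :
  metric_derivative d (opp_itv I) (g \o -%R) t = metric_derivative d I g (- t).
Proof.
rewrite /metric_derivative opp_fmap_within_dnbhs; congr (lim _).
apply/funext => A; congr (within _ _ _); apply/funext => s /=.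
by rewrite !opprK (_ : - t - s = - (t + s)) ?normrN// opprD.
Qed.

Lemma Klength_opp I (g : R -> X) : Klength d K (opp_itv I) (g \o -%R) = Klength d K I g.
Proof.
rewrite /Klength set_opp_itv; etransitivity; last first.
  exact: (@integral_opp R [set` I]
    (fun t => mule_infty (K (g t)) (metric_derivative d I g t)) (measurable_itv I)).
by apply: eq_integral => t _; rewrite metric_derivative_opp.
Qed.

Lemma curve_opp I (g : R -> X) : curve I g -> curve (opp_itv I) (g \o -%R).
Proof.
move=> [[t It] cg]; split; first by exists (- t); rewrite /= mem_opp_itv opprK.
move/subspace_continuousP : cg => cg; apply/subspace_continuousP => s /=.
rewrite mem_opp_itv => Is A /(cg _ Is).
rewrite /nbhs/= /within/= => /nbhs_ballP[e /= e0 He].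
apply/nbhs_ballP; exists e => // v; rewrite /ball/= => vs Iv.
apply: He; last by rewrite -mem_opp_itv.
by rewrite /ball/= -normrN opprD !opprK.
Qed.

Lemma pinftyN : -%R @ (+oo%R : set_system R) = -oo%R.
Proof.
rewrite -ninftyN -fmap_comp; apply/seteqP; split => A;
  by rewrite /fmap/=; under [_ \o _]eq_fun do rewrite /= opprK.
Qed.

Lemma joins_opp I (g : R -> X) x y : joins I g x y -> joins (opp_itv I) (g \o -%R) y x.
Proof.
case: I => l r [/= gx gy]; split => /=.
  case: r gy {gx} => [[] b|[]] /= gy; rewrite ?opprK//.
  - exact: ((cvg_at_leftNP _ _ _).1 gy).
  - by move: gy; rewrite -ninftyN -fmap_comp.
  - by move: gy; rewrite -ninftyN -fmap_comp.
case: l gx {gy} => [[] b|[]] /= gx; rewrite ?opprK//.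
- exact: ((cvg_at_rightNP _ _ _).1 gx).
- by move: gx; rewrite -pinftyN -fmap_comp.
- by move: gx; rewrite -pinftyN -fmap_comp.
Qed.

Lemma piecewise_opp (P Q : set R -> Prop) I :
  (forall J, P J -> Q (-%R @^-1` J)) -> piecewise P I -> piecewise Q (opp_itv I).
Proof.
move=> PQ [n [t [t0 tn tS tP]]].
exists n, (fun i => - t (n - i)%N)%E; split.
- rewrite subn0 tn ereal_supEN oppeK; congr ereal_inf.
  apply/seteqP; split => [_ [_ [s Is <-] <-]|_ [s Is <-]].
    exists (- s) => [|//]; rewrite /= mem_opp_itv opprK; exact: Is.
  exists (- s%:E)%E; last by rewrite oppeK.
  by exists (- s) => //=; rewrite -mem_opp_itv.
- rewrite subnn t0 ereal_infEN oppeK; congr ereal_sup.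
  apply/seteqP; split => [_ [_ [s Is <-] <-]|_ [s Is <-]].
    exists (- s) => [|//]; rewrite /= mem_opp_itv opprK; exact: Is.
  exists (- s%:E)%E; last by rewrite oppeK.
  by exists (- s) => //=; rewrite -mem_opp_itv.
- by move=> i i_n; rewrite lteN2 (_ : (n - i = (n - i.+1).+1)%N); [apply: tS|]; lia.
move=> i i_n; have := PQ _ (tP (n - i.+1)%N ltac:(lia)).
rewrite (_ : ((n - i.+1).+1 = n - i)%N); last by lia.
congr (Q _); apply/seteqP; split => s /=; rewrite EFinN.
  by rewrite lteNl lteNr andbC.
by rewrite lteNl lteNr andbC.
Qed.

Lemma ac_loc_opp (g : R -> X) J : ac_loc d J g -> ac_loc d (-%R @^-1` J) (g \o -%R).
Proof.
move=> ac a b ab abJ.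
have := @ac_opp _ _ d dm g (- b) (- a); rewrite !opprK; apply; apply: ac.
  by rewrite lerN2.
move=> s /=; rewrite in_itv/= => bsa; have := abJ (- s); rewrite /= in_itv/= opprK; apply.
by lra.
Qed.

Lemma lip_loc_opp (g : R -> X) J : lip_loc d J g -> lip_loc d (-%R @^-1` J) (g \o -%R).
Proof.
move=> lp a b ab abJ.
have [|s /=|L HL] := lp (- b) (- a); first by rewrite lerN2.
  rewrite in_itv/= => bsa; have := abJ (- s); rewrite /= in_itv/= opprK; apply; lra.
exists L => s t; rewrite !in_itv/= => sab tab.
have := HL (- s) (- t); rewrite !in_itv/= (_ : - s - - t = - (s - t)); last by ring.
by rewrite normrN; apply; lra.
Qed.

Lemma ac_ploc_opp I (g : R -> X) : ac_ploc d I g -> ac_ploc d (opp_itv I) (g \o -%R).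
Proof.
move=> [cg pw]; split; first exact: curve_opp.
by apply: piecewise_opp pw => J; exact: ac_loc_opp.
Qed.

Lemma lip_ploc_opp I (g : R -> X) : lip_ploc d I g -> lip_ploc d (opp_itv I) (g \o -%R).
Proof.
move=> [cg pw]; split; first exact: curve_opp.
by apply: piecewise_opp pw => J; exact: lip_loc_opp.
Qed.

Lemma Kdist_sym x y : Kdist d K x y = Kdist d K y x.
Proof.
have half a b : (Kdist d K a b <= Kdist d K b a)%E.
  apply: le_ereal_inf_tmp => _ [I [g [acg jg ->]]]; apply: ereal_inf_lbound.
  exists (opp_itv I), (g \o -%R); split; [exact: ac_ploc_opp|exact: joins_opp|].
  by rewrite Klength_opp.
by apply/eqP; rewrite eq_le !half.
Qed.

Lemma lip_ac_loc (g : R -> X) J : lip_loc d J g -> ac_loc d J g.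
Proof.
move=> lp a b ab abJ e e0; have [L HL] := lp a b ab abJ.
have M0 : 0 < `|L| + 1 by have := normr_ge0 L; lra.
exists (e / (`|L| + 1)); first by rewrite divr_gt0.
move=> n s t st _ sm.
apply: (@le_lt_trans _ _ (\sum_(i < n) ((`|L| + 1) * (t i - s i))%:E)%E).
  apply: lee_sum => i _; have [as_ st' tb] := st i (ltn_ord i).
  have dst := HL (s i) (t i) ltac:(rewrite in_itv/=; lra) ltac:(rewrite in_itv/=; lra).
  apply: (le_trans dst).
  rewrite lee_fin distrC ger0_norm ?subr_ge0//; apply: ler_wpM2r; first lra.
  by have := ler_norm L; lra.
rewrite sumEFin -mulr_sumr lte_fin mulrC.
by rewrite -ltr_pdivlMr.
Qed.

Lemma lip_ac_ploc I (g : R -> X) : lip_ploc d I g -> ac_ploc d I g.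
Proof.
move=> [cg [n [t [t0 tn tS tP]]]]; split => //; exists n, t; split => // i i_n.
exact: lip_ac_loc (tP i i_n).
Qed.

End Reversal.

(** * Length and regularity of a curve with bounded speed and cost *)

Section UpperIntegral.
Context {R : realType}.
Local Open Scope ring_scope.
Local Notation mu := (@lebesgue_measure R).

(** The inequality is made to hold everywhere by giving f the value +oo on the
    null set, which does not change the integral of f. *)
Lemma ge0_ae_le_upper_integral (D : set R) (g f : R -> \bar R) :
  measurable D -> measurable_fun setT f ->
  (forall x, (0 <= f x)%E) -> (forall x, D x -> (0 <= g x)%E) ->
  {ae mu, forall x, D x -> (g x <= f x)%E} ->
  (\int[mu]_(x in D) g x <= \int[mu]_(x in D) f x)%E.
Proof.
move=> mD mf f0 g0 [N [mN N0 gfN]].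
pose f' x := if x \in N then +oo%E else f x.
have mf' : measurable_fun setT f'.
  apply: measurable_fun_ifT => //.
  apply: (measurable_fun_bool true) => /=.
  rewrite setTI (_ : _ @^-1` _ = N)//; apply/seteqP; split => x /=; first exact: set_mem.
  exact: mem_set.
have f'0 x : (0 <= f' x)%E by rewrite /f'; case: ifP => // _; exact: leey.
apply: (@le_trans _ _ (\int[mu]_(x in D) f' x)%E).
  apply: integral_mono_sub => // x Dx; rewrite g0//= /f'.
  case: ifPn => [_|xN]; first exact: leey.
  apply: contrapT => ngf; move/negP: xN; apply; rewrite inE; apply: gfN => /=.
  by move/(_ Dx).
rewrite (ge0_negligible_integral mN)//; last exact: measurable_funTS.
rewrite [leRHS](ge0_negligible_integral mN)//; last exact: measurable_funTS.
apply: integral_mono_sub => // x [_ xN]; rewrite f'0/= /f'.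
by case: ifPn => // /set_mem.
Qed.

End UpperIntegral.

Section CurveOfBoundedSpeed.
Context {R : realType} {X : pseudoMetricType R} (d : X -> X -> \bar R).
Hypothesis dm : emetric d.
Variable K : X -> \bar R.
Hypothesis Kl : lower_semicontinuous K.
Hypothesis K0 : forall x, (0 <= K x)%E.
Local Open Scope ring_scope.
Local Notation mu := (@lebesgue_measure R).

Let d_ge0 a b : (0 <= d a b)%E := emetric_ge0 dm a b.

Lemma metric_derivative_le (I : interval R) (g : R -> X) t u (L h : R) :
  t \in I -> u \in I -> u != t -> 0 <= L -> 0 < h ->
  (forall s, s \in I -> `|s - t| < h -> (d (g t) (g s) <= (L * `|s - t|)%:E)%E) ->
  (metric_derivative d I g t <= L%:E)%E.
Proof.
move=> tI uI ut L0 h0 Hh; rewrite /metric_derivative.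
have PF := within_dnbhs_proper tI uI ut.
set f := fun s => _; set F := within _ _.
have [cvf|dvf] := pselect (cvg (f @ F)); last by rewrite dvgP// lee_fin.
apply: lime_le => //; rewrite /F /within/=; apply/nbhs_ballP; exists h => //= s ts sNt Is.
have st0 : 0 < `|s - t| by rewrite normr_gt0 subr_eq0.
rewrite /f distrC lee_pdivrMr// -EFinM; apply: Hh => //.
by move: ts; rewrite /ball/= distrC.
Qed.

Lemma lsc_pos_bound (g : R -> X) (a b : R) : continuous g ->
  (forall r, a <= r <= b -> K (g r) != 0%E) ->
  exists2 c, 0 < c & forall r, a <= r <= b -> (c%:E < K (g r))%E.
Proof.
move=> cg Kn0.
have nc := (compact_near_coveringP _).1 (@segment_compact R a b).
have H : \forall c \near (0:R)^'+, `[a, b]%classic `<=` (fun r => (c%:E < K (g r))%E).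
  apply: (nc R (0:R)^'+ (fun c r => (c%:E < K (g r))%E) _) => r.
  rewrite /= in_itv/= => /Kn0 Kr.
  have [c c0 cK] : exists2 c, 0 < c & (c%:E < K (g r))%E.
    have : (0 < K (g r))%E by rewrite lt_neqAle eq_sym Kr K0.
    case: (K (g r)) => [k||]//; last by exists 1; rewrite ?ltry.
    by rewrite lte_fin => k0; exists (k / 2); rewrite ?lte_fin; lra.
  have [V gV VK] := Kl cK.
  exists (g @^-1` V, [set k | k < c]) => /=.
    by split; [exact: cg|exact: nbhs_right_lt].
  by move=> [r' k] [/= /VK cKr' kc]; apply: lt_trans cKr'; rewrite lte_fin.
near (0:R)^'+ => c.
exists c; first by [].
move=> r rab; have : `[a, b]%classic `<=` (fun r => (c%:E < K (g r))%E) by near: c.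
by apply; rewrite /= in_itv.
Unshelve. all: by end_near. Qed.

Section Final.
Variables (T U : R) (g : R -> X) (w : R -> R) (x y : X).
Hypothesis T0 : 0 < T.
Hypothesis U0 : 0 < U.
Hypothesis cg : continuous g.
Hypothesis sb : speed_bound d K T U g.
Hypothesis cb : cost_bound K T U g w.
Hypothesis wnd : nondecreasing_upto T w.

(** The density of the cost when the clock runs at speed U: max (K, 1) U.  The
    zeros of K, where nothing is known, are given density 0. *)
Let f (t : R) : \bar R := if (0 < K (g t))%E then (U%:E * maxe (K (g t)) 1)%E else 0%E.

Let mf : measurable_fun setT f.
Proof.
have mK : measurable_fun setT (K \o g) := measurable_lsc_comp cg Kl.
apply: measurable_fun_ifT => //.
- by apply: measurable_fun_lte => //; exact: measurable_cst.
- apply: emeasurable_funM; first exact: measurable_cst.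
  by apply: measurable_maxe => //; exact: measurable_cst.
Qed.

Let f0 t : (0 <= f t)%E.
Proof.
rewrite /f; case: ifP => // Kt; apply: mule_ge0; first by rewrite lee_fin ltW.
by rewrite le_max K0.
Qed.

(** By lower semicontinuity, c < f t persists to the right of t in the form
    K > k with c <= max (k, 1) U, and the cost bound then says that w grows at
    rate at least c. *)
Lemma int_le_cost : (\int[mu]_(t in `[0%R, T]) f t <= (w T - w 0)%:E)%E.
Proof.
have T0' : 0 <= T by exact: ltW.
apply: growth => //.
  by move=> s t; rewrite !in_itv/= => /andP[? ?] /andP[? ?] st; apply: wnd.
move=> t /andP[t0 tT] c cf.
have trivial_case : c <= 0 -> exists2 h0 : R, 0 < h0 & forall s, t < s < t + h0 -> s <= T ->
    c * (s - t) <= w s - w t.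
  move=> c0; exists 1 => // s /andP[ts _] sT.
  apply: (@le_trans _ _ 0); first by apply: mulr_le0_ge0 => //; lra.
  by rewrite subr_ge0; apply: wnd => //; exact: ltW.
have [c0|c0] := leP c 0; first exact: trivial_case.
move: cf; rewrite /f; case: ifPn => [Kt|_]; last by rewrite lte_fin ltNge ltW.
move=> cf.
have [k [k0 kK ckU]] : exists k : R, [/\ 0 < k, (k%:E < K (g t))%E & c <= Num.max k 1 * U].
  have [cU|Uc] := leP c U.
    have [|k k0 kK] := @lsc_pos_bound g t t cg.
      move=> r /andP[tr rt]; have -> : r = t by apply/eqP; rewrite eq_le rt.
      by rewrite gt_eqF.
    exists k; split => //; first by apply: kK; rewrite lexx.
    by apply: (le_trans cU); rewrite ler_peMl ?(ltW U0)// le_max lexx orbT.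
  exists (c / U); split; first by rewrite divr_gt0.
    have U1 : 1 < c / U by rewrite ltr_pdivlMr ?mul1r.
    move: cf; case: (K (g t)) Kt => [k||] // Kt; last by rewrite ltry.
    rewrite -EFin_max -EFinM !lte_fin mulrC -ltr_pdivrMr// lt_max => /orP[//|].
    by move=> U1'; have := lt_trans U1 U1'; rewrite ltxx.
  apply: (@le_trans _ _ (c / U * U)); first by rewrite divfK// gt_eqF.
  by rewrite ler_pM2r// le_max lexx.
have [V gV VK] := Kl kK.
have /nbhs_ballP[e /= e0 eV] := @cg t _ gV.
exists e => // s /andP[ts se] sT.
have step : Num.max k 1 * (U * (s - t)) <= w s - w t.
  apply: (cb (c := k)) => //; first exact: ltW.
  move=> r /andP[tr rs]; apply/VK/eV.
  by rewrite /ball/= distrC ger0_norm; lra.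
by apply: le_trans step; rewrite mulrA ler_wpM2r//; lra.
Qed.

Variable zs : seq R.
Hypothesis zsP : forall r, 0 <= r <= T -> K (g r) = 0%E -> r \in zs.

(** Near t the speed is at most U / min (k, 1) for each k < K (g t), so that
    min (K, 1) times the speed is at most U, and K = min (K, 1) max (K, 1). *)
Lemma Kspeed_le t : 0 < t < T -> K (g t) != 0%E ->
  (mule_infty (K (g t)) (metric_derivative d `[0%R, T] g t) <= f t)%E.
Proof.
move=> /andP[t0 tT] Kt0.
have Kt : (0 < K (g t))%E by rewrite lt_neqAle eq_sym Kt0 K0.
have tI : t \in `[0, T] by rewrite in_itv/= !ltW.
have TI : T \in `[0, T] by rewrite in_itv/= lexx ltW.
have tNT : T != t by rewrite gt_eqF.
have md0 := metric_derivative_ge0 dm g tI TI tNT.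
have mdk k : 0 < k -> (k%:E < K (g t))%E ->
    (metric_derivative d `[0%R, T] g t <= (U / Num.min k 1)%:E)%E.
  move=> k0 kK; have m0 : 0 < Num.min k 1 by rewrite lt_min k0 ltr01.
  have [V gV VK] := Kl kK.
  have /nbhs_ballP[e /= e0 eV] := @cg t _ gV.
  apply: (metric_derivative_le tI TI tNT _ e0); first by rewrite divr_ge0 ?ltW.
  have bnd p q : 0 <= p -> p <= q -> q <= T -> t - e < p -> q < t + e ->
      (d (g p) (g q) <= (U / Num.min k 1 * (q - p))%:E)%E.
    move=> p0 pq qT tp qt; have := @sb p q k p0 pq qT k0 _.
    move=> /(_ _)H; rewrite (_ : U / _ * _ = U * (q - p) / Num.min k 1); last by rewrite mulrAC.
    rewrite EFinM lee_pdivlMr// muleC; apply: H => r /andP[pr rq].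
    by apply/VK/eV; rewrite /ball/= ltr_norml; lra.
  move=> s; rewrite in_itv/= => /andP[s0 sT]; have [ts|st] := leP t s.
    rewrite ger0_norm ?subr_ge0// => se; apply: bnd => //; lra.
  rewrite distrC gtr0_norm ?subr_gt0// => se; rewrite (emetric_sym dm).
  by apply: bnd => //; lra.
rewrite /f Kt; move: Kt mdk; case: (K (g t)) => [r||] // Kt mdk; last first.
  by rewrite maxye gt0_muley ?leey// lte_fin.
have r0 : 0 < r by [].
have mdlt : (metric_derivative d `[0%R, T] g t < +oo)%E.
  have := mdk (r / 2) ltac:(lra) ltac:(rewrite lte_fin; lra).
  by move=> /le_lt_trans; apply; rewrite ltry.
have mdfin : metric_derivative d `[0%R, T] g t \is a fin_num by rewrite ge0_fin_numE.
move: md0 mdk mdlt; rewrite -(fineK mdfin); set m := fine _ => m0 mdk _.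
rewrite /mule_infty /= -EFin_max -!EFinM lee_fin.
have mk k : 0 < k -> k < r -> Num.min k 1 * m <= U.
  move=> k0 kr; have := mdk k k0; rewrite lte_fin => /(_ kr).
  by rewrite lee_fin ler_pdivlMr 1?mulrC// lt_min k0 ltr01.
have [r1|r1] := leP r 1; last first.
  have := mk 1 ltr01 r1; rewrite minxx mul1r => mU.
  by rewrite mulrC ler_pM2r.
rewrite mulr1 leNgt; apply/negP => Urm.
have mpos : 0 < m.
  by rewrite -(pmulr_rgt0 _ r0); apply: lt_trans Urm.
have Ur : U / m < r by rewrite ltr_pdivrMr.
have Um0 : 0 < U / m by rewrite divr_gt0.
have := mk ((U / m + r) / 2) ltac:(lra) ltac:(lra).
rewrite min_l; last lra.
rewrite leNgt => /negP; apply.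
by rewrite -ltr_pdivrMr//; lra.
Qed.

Lemma ae_notin_seq (s : seq R) : {ae mu, forall r, r \notin s}.
Proof.
have H : {ae mu, forall r, forall k, r != nth 0 s k}.
  by apply/ae_foralln => k; exact: ae_neq.
apply: (@filterS _ _ (ae_filter_ringOfSetsType mu) _ _ _ H) => r rs.
by apply/negP => /(nthP 0)[k _ rk]; have := rs k; rewrite rk eqxx.
Qed.

Lemma Klength_le_cost : (Klength d K `[0%R, T] g <= (w T - w 0)%:E)%E.
Proof.
apply: le_trans int_le_cost; apply: ge0_ae_le_upper_integral => //.
  move=> t tT; apply: mule_infty_ge0 => //.
  have [t0|t0] := eqVneq t 0.
    apply: (@metric_derivative_ge0 _ _ d dm _ _ _ T) => //; first by rewrite in_itv/= lexx ltW.
    by rewrite t0 gt_eqF.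
  apply: (@metric_derivative_ge0 _ _ d dm _ _ _ 0) => //; first by rewrite in_itv/= lexx ltW.
  by rewrite eq_sym.
apply: (@filterS _ _ (ae_filter_ringOfSetsType mu) _ _ _ (ae_notin_seq [:: 0, T & zs])) => t.
rewrite !inE !negb_or => /and3P[t0 tT tzs] /=; rewrite in_itv/= => /andP[t0' tT'].
apply: Kspeed_le; first by rewrite !lt_neqAle eq_sym t0 t0' tT tT'.
by apply/eqP => Kt; move/negP: tzs; apply; apply: zsP => //; rewrite t0'.
Qed.

End Final.

Lemma subdivision (a b : R) (zs : seq R) : a < b -> exists (n : nat) (t : nat -> R),
  [/\ t 0%N = a, t n = b, forall i, (i < n)%N -> t i < t i.+1 &
      forall i z, (i < n)%N -> z \in zs -> ~ (t i < z < t i.+1)].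
Proof.
move=> ab; elim: zs => [|z zs [n [t [t0 tn tS tzs]]]].
  by exists 1%N, (fun i => if i is 0%N then a else b); split => // -[|].
have tmono := steps_mono tS.
have [[i [i_n /andP[tiz zti]]]|noi] := pselect (exists i, (i < n)%N /\ t i < z < t i.+1); last first.
  exists n, t; split => // i z' i_n; rewrite inE => /predU1P[->|]; last exact: tzs.
  by move=> zi; apply: noi; exists i.
exists n.+1, (fun j => if (j <= i)%N then t j else if j == i.+1 then z else t j.-1).
split.
- by [].
- by rewrite leqNgt ltnS (ltnW i_n)/= eqSS gtn_eqF.
- move=> j jn; case: (ltngtP j i) => [ji|ij|->].
  + by apply: tS; exact: ltn_trans i_n.
  + rewrite eqSS (gtn_eqF ij).
    case: ifPn => [/eqP -> //|ji]; case: j jn ij ji => // j jn ij ji /=; apply: tS.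
    by rewrite -ltnS.
  + by rewrite eqxx.
move=> j z' jn z'zs; case: (ltngtP j i) => [ji|ij|->].
- have jn' : (j < n)%N by exact: ltn_trans i_n.
  move: z'zs; rewrite inE => /predU1P[->|]; last exact: tzs.
  by have := tmono j.+1 i ji (ltnW i_n); lra.
- rewrite eqSS (gtn_eqF ij).
  case: ifPn => [/eqP jE|ji].
    rewrite jE /=; move: z'zs; rewrite inE => /predU1P[->|z'zs]; first by lra.
    by have := tzs i z' i_n z'zs; lra.
  case: j jn ij ji => // j jn ij ji /=; have jn' : (j < n)%N by rewrite -ltnS.
  move: z'zs; rewrite inE => /predU1P[->|]; last exact: tzs.
  have ij' : (i.+1 <= j)%N by rewrite ltn_neqAle -ltnS ij andbT eq_sym -eqSS.
  by have := tmono i.+1 j ij' (ltnW jn'); lra.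
- rewrite eqxx; move: z'zs; rewrite inE => /predU1P[->|z'zs]; first by lra.
  by have := tzs i z' i_n z'zs; lra.
Qed.

(** Cut [0, T] at the finitely many times in zs.  On a compact interval inside a
    piece, K is bounded below along g, and the speed bound is a Lipschitz bound. *)
Lemma lip_ploc_of_speed_bound (T U : R) (g : R -> X) (zs : seq R) :
  0 < T -> 0 < U -> continuous g -> speed_bound d K T U g ->
  (forall r, 0 <= r <= T -> K (g r) = 0%E -> r \in zs) ->
  lip_ploc d `[0%R, T] g.
Proof.
move=> T0 U0 cg sb zsP; split.
  split; first by exists 0; rewrite /= in_itv/= lexx ltW.
  exact: continuous_subspaceT.
have [n [t [t0 tn tS tzs]]] := subdivision zs T0.
have tmono := steps_mono tS.
exists n, (fun i => (t i)%:E); split.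
- by rewrite ereal_inf_itvcc ?t0// ltW.
- by rewrite ereal_sup_itvcc ?tn// ltW.
- by move=> i i_n; rewrite lte_fin; exact: tS.
move=> i i_n a b ab abJ.
have aJ : t i < a < t i.+1 by have := abJ a; rewrite /= in_itv/= lexx !lte_fin; apply.
have bJ : t i < b < t i.+1 by have := abJ b; rewrite /= in_itv/= lexx !lte_fin andbT; apply.
have ti0 : 0 <= t i by rewrite -t0; apply: tmono => //; exact: ltnW.
have tiT : t i.+1 <= T by rewrite -tn; exact: tmono.
have [|c c0 cK] := @lsc_pos_bound g a b cg.
  move=> r rab; apply/eqP => Kr; apply: (tzs i r i_n); last by lra.
  by apply: zsP => //; lra.
have m0 : 0 < Num.min c 1 by rewrite lt_min c0 ltr01.
exists (U / Num.min c 1).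
have bnd p q : a <= p -> p <= q -> q <= b ->
    (d (g p) (g q) <= (U / Num.min c 1 * (q - p))%:E)%E.
  move=> ap pq qb; rewrite (_ : U / _ * _ = U * (q - p) / Num.min c 1); last by rewrite mulrAC.
  rewrite EFinM lee_pdivlMr// muleC; apply: sb => //; [lra|lra|].
  by move=> r rpq; apply: cK; lra.
move=> s s'; rewrite !in_itv/= => /andP[as_ sb'] /andP[as' sb''].
have [ss|ss] := leP s s'.
  by rewrite distrC ger0_norm ?subr_ge0//; exact: bnd.
by rewrite gtr0_norm ?subr_gt0// (emetric_sym dm); apply: bnd => //; exact: ltW.
Qed.

End CurveOfBoundedSpeed.

(** * Excising loops *)

Section CutLoops.
Context {R : realType} {X : pseudoMetricType R} (d : X -> X -> \bar R).
Hypothesis dm : emetric d.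
Variable K : X -> \bar R.
Local Open Scope ring_scope.

Lemma first_visit (g : R -> X) (s t : R) (z : X) : continuous g -> s <= t -> g t = z ->
  exists a, [/\ s <= a <= t, g a = z & forall r, s <= r < a -> g r <> z].
Proof.
move=> cg st gt; pose f r := - capped_dist d 1 z (g r).
have cf r e : 0 < e -> exists2 h, 0 < h & forall r', `|r' - r| < h -> `|f r' - f r| < e.
  move=> e0; have [h h0 Hh] := curve_close dm (cg r) e0; exists h => // r' /Hh.
  rewrite -lte_fin; apply: le_lt_trans.
  rewrite (_ : f r' - f r = capped_dist d 1 z (g r) - capped_dist d 1 z (g r')); last first.
    by rewrite /f; ring.
  by apply: (capped_dist_lip dm).
have fz r : 0 <= f r -> g r = z.
  rewrite /f oppr_ge0 -lee_fin capped_distE// ge_min lee_fin.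
  rewrite [(1 <= 0)%R]leNgt ltr01 orbF => dz.
  by apply/esym/(emetric_eq0 dm)/eqP; rewrite eq_le dz emetric_ge0.
have f0 r : g r = z -> f r = 0.
  move=> grz; apply/eqP; rewrite /f grz oppr_eq0; apply/eqP/EFin_inj.
  by rewrite capped_distE// emetric_xx// min_l.
have ft0 : 0 <= f t by rewrite f0.
have [a [sat fa0 fa]] := first_time cf st ft0.
exists a; split; [by []|exact: fz|move=> r /fa fr /f0 fr0].
by move: fr; rewrite fr0 ltxx.
Qed.

Lemma last_visit (g : R -> X) (s t : R) (z : X) : continuous g -> s <= t -> g s = z ->
  exists b, [/\ s <= b <= t, g b = z & forall r, b < r <= t -> g r <> z].
Proof.
move=> cg st gs.
have cg' : continuous (g \o -%R).
  by move=> r; apply: continuous_comp; [exact: oppr_continuous|exact: cg].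
have ts : - t <= - s by rewrite lerN2.
have gs' : (g \o -%R) (- s) = z by rewrite /= opprK.
have [b [/andP[tb bs] gb lb]] := first_visit cg' ts gs'.
exists (- b); split; [by apply/andP; split; lra|by []|move=> r /andP[br rt]].
by have := lb (- r); rewrite /= opprK; apply; lra.
Qed.

Variables (U D : R) (x y : X).

Definition bounded_cost (T : R) (g : R -> X) : Prop := exists w,
  [/\ cost_bound K T U g w, nondecreasing_upto T w & w T - w 0 <= D].

Definition admissible (T : R) (g : R -> X) : Prop :=
  [/\ 0 <= T, continuous g & g 0 = x /\ g T = y] /\ speed_bound d K T U g /\ bounded_cost T g.

(** The loop of g on [a, b] is removed and the rest is shifted; meant for
    g a = g b, which makes the two branches agree at a. *)
Definition excise (a b : R) (g : R -> X) (r : R) : X :=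
  if r <= a then g r else g (r + (b - a)).

Section Excise.
Variables (a b : R) (g : R -> X).
Hypothesis gab : g a = g b.

Lemma excise_le r : r <= a -> excise a b g r = g r.
Proof. by rewrite /excise => ->. Qed.

Lemma excise_ge r : a <= r -> excise a b g r = g (r + (b - a)).
Proof.
rewrite /excise le_eqVlt => /predU1P[<-|]; first by rewrite lexx gab addrC subrK.
by rewrite ltNge => /negbTE ->.
Qed.

Lemma excise_continuous : continuous g -> continuous (excise a b g).
Proof.
move=> cg.
suff H (r e : R) : 0 < e -> exists2 h, 0 < h & forall r', `|r' - r| < h ->
    (d (excise a b g r) (excise a b g r') < e%:E)%E.
  move=> r; apply/cvg_ballP => e /(H r)[h h0 Hh]; apply/nbhs_ballP.
  by exists h => // r'; rewrite /ball/= distrC => /Hh /(emetric_ballP dm).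
move=> e0.
have [h1 h10 H1] : exists2 h, 0 < h & forall r', `|r' - r| < h -> r' <= a ->
    (d (excise a b g r) (excise a b g r') < e%:E)%E.
  have [ra|ar] := leP r a; last first.
    exists (r - a) => [|r']; first by rewrite subr_gt0.
    by rewrite ltr_norml => ? ?; exfalso; lra.
  have [h h0 H] := curve_close dm (cg r) e0; exists h => // r' r'r r'a.
  by rewrite !excise_le//; exact: H.
have [h2 h20 H2] : exists2 h, 0 < h & forall r', `|r' - r| < h -> a <= r' ->
    (d (excise a b g r) (excise a b g r') < e%:E)%E.
  have [ar|ra] := leP a r; last first.
    exists (a - r) => [|r']; first by rewrite subr_gt0.
    by rewrite ltr_norml => ? ?; exfalso; lra.
  have [h h0 H] := curve_close dm (cg (r + (b - a))) e0; exists h => // r' r'r ar'.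
  by rewrite !excise_ge//; apply: H; rewrite opprD addrACA subrr addr0.
exists (Num.min h1 h2) => [|r']; first by rewrite lt_min h10.
rewrite lt_min => /andP[r'1 r'2]; have [r'a|ar'] := leP r' a; first exact: H1.
by apply: H2 => //; exact: ltW.
Qed.

Hypothesis ab : a <= b.
Variable T : R.
Hypothesis a0 : 0 <= a.
Hypothesis bT : b <= T.
Let T' := T - (b - a).

(** Only an interval containing a needs an argument: its image under g is made of
    two pieces, meeting at g a = g b. *)
Lemma excise_speed : speed_bound d K T U g -> speed_bound d K T' U (excise a b g).
Proof.
have [a0' ab' bT'] := And3 a0 ab bT.
move=> sb s t c s0 st tT c0 Kc; have tT' : t + (b - a) <= T by rewrite -lerBrDr.
have left_part v : s <= a -> v <= a -> s <= v -> v <= t ->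
    ((Num.min c 1)%:E * d (g s) (g v) <= (U * (v - s))%:E)%E.
  move=> sa va sv vt; apply: sb => //; first by lra.
  move=> r srv; rewrite -excise_le; last lra.
  by apply: Kc; lra.
have right_part v : a <= v -> v <= t -> s <= v ->
    ((Num.min c 1)%:E * d (g (v + (b - a))) (g (t + (b - a))) <= (U * (t - v))%:E)%E.
  move=> av vt sv; rewrite (_ : t - v = t + (b - a) - (v + (b - a))); last by ring.
  apply: sb => //; [lra|lra|].
  move=> r vrt; rewrite (_ : r = (r - (b - a)) + (b - a)); last by rewrite subrK.
  by rewrite -excise_ge; [apply: Kc|]; lra.
have [ta|at_] := leP t a.
  by have sa := le_trans st ta; rewrite !excise_le//; exact: left_part.
have [as_|sa] := leP a s.
  by rewrite !excise_ge ?(ltW at_)//; exact: right_part.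
rewrite excise_le ?(ltW sa)// excise_ge ?(ltW at_)//.
have m0 : (0 <= (Num.min c 1)%:E)%E by rewrite lee_fin le_min ler01 ltW.
apply: (@le_trans _ _ ((Num.min c 1)%:E * (d (g s) (g a) + d (g b) (g (t + (b - a)))))%E).
  by apply: lee_wpmul2l => //; rewrite -gab; exact: emetric_triangle.
rewrite ge0_muleDr; [|exact: (emetric_ge0 dm)..].
rewrite (_ : U * (t - s) = U * (a - s) + U * (t - a)); last by ring.
rewrite EFinD; apply: leeD; first by apply: left_part => //; exact: ltW.
have := @right_part a (lexx a) (ltW at_) (ltW sa).
by rewrite (_ : a + (b - a) = b)// addrC subrK.
Qed.

(** The cost w b - w a of the loop is subtracted from later costs. *)
Lemma excise_cost : bounded_cost T g -> bounded_cost T' (excise a b g).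
Proof.
have [a0' ab' bT'] := And3 a0 ab bT.
move=> [w [cb wnd wD]].
pose w' r := if r <= a then w r else w (r + (b - a)) - (w b - w a).
have w'_le r : r <= a -> w' r = w r by rewrite /w' => ->.
have w'_ge r : a <= r -> w' r = w (r + (b - a)) - (w b - w a).
  rewrite /w' le_eqVlt => /predU1P[<-|]; last by rewrite ltNge => /negbTE ->.
  by rewrite lexx (_ : a + (b - a) = b); [ring|rewrite addrC subrK].
have wab : w a <= w b by exact: wnd.
exists w'; split.
- move=> s t c s0 st tT c0 Kc; have tT' : t + (b - a) <= T by rewrite -lerBrDr.
  have left_part v : s <= a -> v <= a -> s <= v -> v <= t ->
      Num.max c 1 * (U * (v - s)) <= w v - w s.
    move=> sa va sv vt; apply: cb => //; first by lra.
    move=> r srv; rewrite -excise_le; last lra.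
    by apply: Kc; lra.
  have right_part v : a <= v -> v <= t -> s <= v ->
      Num.max c 1 * (U * (t - v)) <= w (t + (b - a)) - w (v + (b - a)).
    move=> av vt sv; rewrite (_ : t - v = t + (b - a) - (v + (b - a))); last by ring.
    apply: cb => //; [lra|lra|].
    move=> r vrt; rewrite (_ : r = (r - (b - a)) + (b - a)); last by rewrite subrK.
    by rewrite -excise_ge; [apply: Kc|]; lra.
  have [ta|at_] := leP t a.
    by have sa := le_trans st ta; rewrite !w'_le//; exact: left_part.
  have [as_|sa] := leP a s.
    rewrite !w'_ge ?(ltW at_)//; apply: (le_trans (right_part s as_ st (lexx s))).
    by lra.
  rewrite (w'_le s (ltW sa)) (w'_ge t (ltW at_)).
  have := @left_part a (ltW sa) (lexx a) (ltW sa) (ltW at_).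
  have := @right_part a (lexx a) (ltW at_) (ltW sa).
  rewrite (_ : a + (b - a) = b); last by rewrite addrC subrK.
  rewrite (_ : U * (t - s) = U * (a - s) + U * (t - a)); last by ring.
  by rewrite mulrDr; lra.
- move=> s t s0 st tT; have tT' : t + (b - a) <= T by rewrite -lerBrDr.
  have [ta|at_] := leP t a.
    by rewrite !w'_le//; [apply: wnd => //; lra|exact: le_trans st ta].
  have [as_|sa] := leP a s.
    by rewrite !w'_ge ?(ltW at_)// lerD2r; apply: wnd => //; lra.
  rewrite (w'_le s (ltW sa)) (w'_ge t (ltW at_)).
  have := wnd s a s0 (ltW sa) ltac:(lra).
  by have := wnd b (t + (b - a)) ltac:(lra) ltac:(lra) tT'; lra.
rewrite (w'_le 0 a0) (w'_ge T'); last by rewrite /T'; lra.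
by rewrite /T' subrK; lra.
Qed.

End Excise.

Lemma admissible_excise (a b T : R) (g : R -> X) : 0 <= a -> a <= b -> b <= T ->
  g a = g b -> admissible T g -> admissible (T - (b - a)) (excise a b g).
Proof.
move=> a0 ab bT gab [[T0 cg [g0 gT]] [sb cb]].
split; [split|split].
- by lra.
- exact: excise_continuous.
- by rewrite excise_le// excise_ge//; [rewrite subrK|lra].
- exact: excise_speed.
- exact: excise_cost.
Qed.

Definition visits_once (T : R) (g : R -> X) (z : X) : Prop :=
  forall r r', 0 <= r <= T -> 0 <= r' <= T -> g r = z -> g r' = z -> r = r'.

(** Remove the part of the curve between its first and its last visit to z.  No
    new visit to another point is created. *)
Lemma cut_loop (T : R) (g : R -> X) (z : X) : admissible T g -> exists T' g',
  [/\ admissible T' g', visits_once T' g' z &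
      forall z', visits_once T g z' -> visits_once T' g' z'].
Proof.
move=> adm; have [[t [/andP[t0 tT] gtz]]|nov] :=
  pselect (exists t, 0 <= t <= T /\ g t = z); last first.
  exists T, g; split => // r r' rT _ grz _; exfalso; apply: nov; exists r.
  by split.
have cg : continuous g by case: adm => [[]].
have [a [/andP[a0 at_] ga fa]] := first_visit cg t0 gtz.
have [b [/andP[tb bT] gb lb]] := last_visit cg tT gtz.
have ab : a <= b by exact: le_trans tb.
have gab : g a = g b by rewrite ga gb.
exists (T - (b - a)), (excise a b g); split; first exact: admissible_excise.
  have one r : 0 <= r <= T - (b - a) -> excise a b g r = z -> r = a.
    move=> /andP[r0 rT]; have [ra|ar] := leP r a.
      rewrite excise_le// => grz; apply/eqP; rewrite eq_le ra/= leNgt; apply/negP => ra'.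
      by apply: (fa r) => //; rewrite r0.
    rewrite excise_ge ?(ltW ar)// => grz; exfalso; apply: (lb (r + (b - a))) => //.
    lra.
  by move=> r r' rT rT' /(one _ rT) -> /(one _ rT') ->.
move=> z' once r r' /andP[r0 rT] /andP[r'0 r'T].
have [ra|ar] := leP r a; have [r'a|ar'] := leP r' a.
- by rewrite !excise_le// => grz gr'z; apply: once => //; lra.
- rewrite excise_le// excise_ge ?(ltW ar')// => grz gr'z.
  by have := once r (r' + (b - a)) ltac:(lra) ltac:(lra) grz gr'z; lra.
- rewrite excise_ge ?(ltW ar)// excise_le// => grz gr'z.
  by have := once (r + (b - a)) r' ltac:(lra) ltac:(lra) grz gr'z; lra.
- rewrite !excise_ge ?(ltW ar) ?(ltW ar')// => grz gr'z.
  by have := once (r + (b - a)) (r' + (b - a)) ltac:(lra) ltac:(lra) grz gr'z; lra.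
Qed.

Lemma cut_loops (zs : seq X) (T : R) (g : R -> X) : admissible T g -> exists T' g',
  admissible T' g' /\ forall z, z \in zs -> visits_once T' g' z.
Proof.
move=> adm; elim: zs => [|z zs [T' [g' [adm' once]]]]; first by exists T, g.
have [T2 [g2 [adm2 once2 keep]]] := cut_loop z adm'.
exists T2, g2; split => // z'; rewrite inE => /predU1P[->//|/once]; exact: keep.
Qed.

Lemma visit_times (zs : seq X) (T : R) (g : R -> X) :
  (forall z, z \in zs -> visits_once T g z) ->
  exists rs : seq R, forall r, 0 <= r <= T -> g r \in zs -> r \in rs.
Proof.
move=> once; exists [seq xget 0 [set r | 0 <= r <= T /\ g r = z] | z <- zs].
move=> r rT grz; apply/mapP; exists (g r) => //.
have [r'T gr'] : [set v | 0 <= v <= T /\ g v = g r] (xget 0 [set v | 0 <= v <= T /\ g v = g r]).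
  by apply: (@xgetPex _ 0 [set v | 0 <= v <= T /\ g v = g r]); exists r.
exact: (once _ grz).
Qed.

End CutLoops.

(** * Existence of an optimal curve *)

Section Normalization.
Context {R : realType} {X : pseudoMetricType R} (d : X -> X -> \bar R).
Variable K : X -> \bar R.
Local Open Scope ring_scope.
Local Notation mu := (@lebesgue_measure R).

(** Curves on [0, 1] will be extended to the whole line by composition with
    clamp, to be continuous everywhere without changing on [0, 1]. *)
Lemma metric_derivative_eq_on (I : interval R) (g h : R -> X) t :
  (forall s, s \in I -> g s = h s) -> t \in I ->
  metric_derivative d I g t = metric_derivative d I h t.
Proof.
move=> gh tI; rewrite /metric_derivative; congr (lim _); apply/seteqP; split => A.
  by apply: filterS2 (withinT [set` I] _) => s sI /=; rewrite !gh.
by apply: filterS2 (withinT [set` I] _) => s sI /=; rewrite -!gh.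
Qed.

Lemma Klength_eq_on (I : interval R) (g h : R -> X) :
  (forall s, s \in I -> g s = h s) -> Klength d K I g = Klength d K I h.
Proof.
move=> gh; apply: eq_integral => t; rewrite inE => tI.
by rewrite gh// (metric_derivative_eq_on gh).
Qed.

Lemma curve_clamp_continuous (g : R -> X) : curve `[0%R, 1%R] g -> continuous (g \o @clamp R).
Proof.
move=> [_ /subspace_continuousP cg] t.
have ct : [set` `[0%R, 1%R]] (clamp t) by rewrite /= in_itv/= clamp01.
apply: cvg_trans (cg _ ct) => A; rewrite /fmap/= /within/= => /nbhs_ballP[e /= e0 He].
apply/nbhs_ballP; exists e => // s; rewrite /ball/= => st; apply: He.
  by apply: le_lt_trans st; exact: clamp_lip.
by rewrite in_itv/= clamp01.
Qed.

Lemma clamp_in t : t \in `[0, 1] -> clamp t = t :> R.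
Proof. by rewrite in_itv/=; exact: clampE. Qed.

Lemma piecewise_ac_clamp (g : R -> X) :
  piecewise (fun J => ac_loc d J g) `[0%R, 1%R] ->
  piecewise (fun J => ac_loc d J (g \o @clamp R)) `[0%R, 1%R].
Proof.
move=> [n [t [t0 tn tS tP]]]; exists n, t; split => // i i_n a b ab abJ e e0.
have tmono := steps_mono tS.
have [delta delta0 H] := tP i i_n a b ab abJ e e0; exists delta => // m s s' ss sS sm.
have ti : (0%:E <= t i)%E.
  rewrite -(@ereal_inf_itvcc R 0 1)//; rewrite -t0; apply: tmono => //; exact: ltnW.
have ti1 : (t i.+1 <= 1%:E)%E.
  by rewrite -(@ereal_sup_itvcc R 0 1)//; rewrite -tn; exact: tmono.
have ab01 v : a <= v <= b -> clamp v = v.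
  move=> vab; have := abJ v; rewrite /= in_itv/= => /(_ vab)/andP[iv vi].
  apply: clampE; rewrite -!lee_fin; apply/andP; split; apply: ltW.
    exact: le_lt_trans iv.
  exact: lt_le_trans ti1.
apply: le_lt_trans (H m s s' ss sS sm); apply: lee_sum => j _ /=.
by have [? ? ?] := ss j (ltn_ord j); rewrite !ab01//; lra.
Qed.

Hypothesis dm : emetric d.
Hypothesis K0 : forall x, (0 <= K x)%E.

Lemma Klength01_ge0 (g : R -> X) : (0 <= Klength d K `[0%R, 1%R] g)%E.
Proof.
apply: integral_ge0 => t tI; apply: mule_infty_ge0 => //.
have [->|t0] := eqVneq t 0.
  apply: (@metric_derivative_ge0 _ _ d dm _ _ _ 1) => //; rewrite ?in_itv/= ?lexx ?ler01//.
apply: (@metric_derivative_ge0 _ _ d dm _ _ _ 0) => //; last by rewrite eq_sym.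
by rewrite in_itv/= lexx ler01.
Qed.

Lemma constant_lip_ploc (x : X) : lip_ploc d `[0%R, 0%R] (fun=> x).
Proof.
split; first by split; [exists 0; rewrite /= in_itv/= lexx|apply: continuous_subspaceT => t; exact: cvg_cst].
by exists 0%N, (fun=> 0%E); split => //; rewrite ?ereal_inf_itvcc ?ereal_sup_itvcc.
Qed.

Lemma Klength_point (a : R) (g : R -> X) : Klength d K `[a, a] g = 0%E.
Proof. by rewrite /Klength set_itv1 integral_set1. Qed.

End Normalization.

Section Existence.
Context {R : realType} {X : completePseudoMetricType R} (d : X -> X -> \bar R).
Hypothesis dm : emetric d.
Variable K : X -> \bar R.
Hypothesis Kl : lower_semicontinuous K.
Hypothesis K0 : forall x, (0 <= K x)%E.
Hypothesis Kz : finite_set [set x | K x = 0%E].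
Variable F : set X.
Hypothesis cF : forall l : R, compact (F `&` [set x | (K x <= l%:E)%E]).
Local Open Scope ring_scope.
Variables (x y : X) (D : R).
Hypothesis xy : x <> y.
Hypothesis D0 : 0 <= D.
Hypothesis seq_ex : forall n : nat, exists g : R -> X,
  [/\ continuous g, piecewise (fun J => ac_loc d J g) `[0, 1] &
      g 0 = x /\ g 1 = y] /\
  (forall t, 0 <= t <= 1 -> F (g t)) /\ (Klength d K `[0%R, 1%R] g <= (D + n.+1%:R^-1)%:E)%E.

(** Competitors of cost at most D + 1 / (n + 1), run at constant clock speed
    U_n on [0, 1].  U_n is at most the cost, and is bounded below because the
    common modulus forbids going from x to y within a small clock time.  So the
    limit exists, runs at a speed U > 0 and costs at most D. *)
Lemma admissible_exists : exists2 U : R, 0 < U & exists T g, admissible d K U D x y T g.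
Proof.
have [e0 e00 e0xy] : exists2 e, 0 < e & (e%:E <= d x y)%E.
  have : (0 < d x y)%E.
    rewrite lt_neqAle emetric_ge0// andbT eq_sym; apply/eqP => /(emetric_eq0 dm).
    exact: xy.
  case: (d x y) => [r||] // r0; [by exists r|by exists 1; rewrite ?leey].
have [B B0 HB] := modulus dm Kl K0 Kz cF e00.
pose C := D + 1.
have C0 : 0 < C by rewrite /C; have D0' := D0; lra.
have DnC n : D + n.+1%:R^-1 <= C by rewrite lerD2l invf_le1 ?ler1n.
have ex n : exists p : R * ((R -> X) * (R -> R)),
    [/\ B <= p.1 <= C, p.2.1 0 = x & p.2.1 1 = y] /\
    [/\ speed_bound d K 1 p.1 p.2.1, cost_bound K 1 p.1 p.2.1 p.2.2,
      nondecreasing_upto 1 p.2.2 & forall r, 0 <= p.2.2 r <= D + n.+1%:R^-1] /\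
    (forall e delta, (forall g u, clocked d K F g u -> clock_modulus d g u delta e) ->
      forall r r', C * `|r - r'| < delta -> (d (p.2.1 r) (p.2.1 r') < e%:E)%E) /\
    (forall r l, 0 <= l -> exists q,
      (q = x \/ F q /\ (K q <= l%:E)%E) /\ (l%:E * d (p.2.1 r) q <= C%:E)%E).
  have [g [[cg pw [g0 g1]] [gF gD]]] := seq_ex n.
  have Kfin : (Klength d K `[0%R, 1%R] g < +oo)%E by apply: (le_lt_trans gD); rewrite ltry.
  pose u := clock1 d K g; pose w := clockK d K g.
  have und s t : 0 <= s -> s <= t -> t <= 1 -> u s <= u t.
    exact: (clock1_le dm Kl K0 cg pw Kfin).
  have gu_speed := clock1_dist dm Kl K0 cg pw Kfin.
  have gu : clocked d K F g u by split.
  have w1D : w 1 <= D + n.+1%:R^-1.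
    by rewrite -lee_fin; apply: le_trans gD; exact: (clockK_Klength dm Kl K0 cg pw Kfin).
  have uw : u 1 <= w 1 := clock1_le_clockK dm Kl K0 cg pw Kfin.
  have u0 : u 0 = 0 := clock1_0 _ _ _.
  have u1B : B <= u 1.
    rewrite leNgt; apply/negP => u1B.
    have := HB g u gu 0 1 (lexx 0) ler01 (lexx 1).
    by rewrite u0 subr0 g0 g1 => /(_ u1B); rewrite ltNge e0xy.
  have mod_ex (e : R) : 0 < e -> exists2 delta : R, 0 < delta & clock_modulus d g u delta e.
    move=> e_gt0; have [delta delta0 H] := modulus dm Kl K0 Kz cF e_gt0.
    by exists delta => //; exact: H.
  have [sg [om [[sg0 sg1 sgg] [[sS sW omn omw] sH]]]] :=
    reparametrize dm u0 (lt_le_trans B0 u1B) und (clockK_le dm Kl K0 cg pw Kfin)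
      (clockK_0 _ _ _) (clock1_continuous dm Kl K0 cg pw Kfin) gu_speed
      (clock1_clockK dm Kl K0 cg pw Kfin) mod_ex.
  exists (u 1, (sg, om)) => /=; split; [split|split; [split|split]].
  - by rewrite u1B (le_trans uw)// (le_trans w1D).
  - by rewrite sg0.
  - by rewrite sg1.
  - exact: sS.
  - exact: sW.
  - exact: omn.
  - by move=> r; have /andP[-> /= omr] := omw r; exact: le_trans w1D.
  - move=> e delta H r r' rr'; apply: (sH e delta); first exact: H.
    apply: le_lt_trans rr'; apply: ler_wpM2r => //.
    by rewrite (le_trans uw)// (le_trans w1D).
  - move=> r l l0; have [t t01 ->] := sgg r.
    have [s [/andP[s0 st] sK sd]] := excursion dm Kl K0 cg pw Kfin t01 l0.
    exists (g s); split.
      case: sK => [->|Ks]; first by left.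
      right; split => //; apply: gF; rewrite s0/=; apply: (le_trans st).
      by case/andP: t01.
    rewrite (emetric_sym dm); apply: (le_trans sd); rewrite lee_fin.
    exact: le_trans w1D (DnC n).
have [p pP] := choice ex.
have [U [s [w [[UB cs s0 s1] [sS sW wnd wD]]]]] :
    exists (U' : R) (s : R -> X) (w' : R -> R),
    [/\ B <= U', continuous s, s 0 = x & s 1 = y] /\
    [/\ speed_bound d K 1 U' s, cost_bound K 1 U' s w', nondecreasing_upto 1 w' &
      forall r, 0 <= w' r <= D].
  apply: (@limit_curve R X d dm K Kl F cF x y (fun n => (p n).1) (fun n => (p n).2.1)
    (fun n => (p n).2.2) B C D (ltW B0)).
  - by move=> n; have [[]] := pP n.
  - by move=> n; have [[]] := pP n.
  - by move=> n; have [[]] := pP n.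
  - by move=> n; have [_ [[]]] := pP n.
  - by move=> n; have [_ [[]]] := pP n.
  - by move=> n; have [_ [[]]] := pP n.
  - move=> n r; have [_ [[_ _ _ /(_ r)/andP[-> /= wr]] _]] := pP n.
    exact: le_trans wr (DnC n).
  - move=> e e_gt0; near=> n => r.
    have [_ [[_ _ _ /(_ r)/andP[_ wr]] _]] := pP n.
    apply: (le_trans wr); rewrite lerD2l; apply: ltW.
    near: n; exact: (near_infty_natSinv_lt (PosNum e_gt0)).
  - move=> e e_gt0; have [delta delta0 H] := modulus dm Kl K0 Kz cF e_gt0.
    exists (delta / C); first by rewrite divr_gt0.
    move=> n r r' rr'; have [_ [_ [+ _]]] := pP n; apply; first exact: H.
    by rewrite mulrC -ltr_pdivlMr.
  - by move=> n r l l0; have [_ [_ [_ +]]] := pP n; apply.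
exists U; first exact: lt_le_trans UB.
exists 1, s; split; [by split|split => //].
exists w; split => //; have /andP[w00 _] := wD 0; have /andP[_ w1D] := wD 1; lra.
Unshelve. all: by end_near. Qed.

(** Once the loops at the zeros of K are removed, the zeros are met at finitely
    many times only, away from which the speed and cost bounds determine the
    regularity and the weighted length of the curve. *)
Lemma optimal_curve : exists T (g : R -> X), [/\ 0 < T, lip_ploc d `[0%R, T] g,
  g 0 = x, g T = y & (Klength d K `[0%R, T] g <= D%:E)%E].
Proof.
have [U U0 [T0 [g0 adm0]]] := admissible_exists.
have /finite_seqP[zs zsE] := Kz.
have [T [g [[[T_ge0 cg [gx gy]] [sb [w [cb wnd wD]]]] once]]] := cut_loops dm zs adm0.
have T_gt0 : 0 < T.
  rewrite lt_neqAle T_ge0 andbT; apply/eqP => T00.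
  by apply: xy; rewrite -gx -gy T00.
have [rs rsP] := visit_times once.
have rsP' r : 0 <= r <= T -> K (g r) = 0%E -> r \in rs.
  move=> rT Kr; apply: rsP => //.
  by have : [set x | K x = 0%E] (g r) by []; rewrite zsE.
exists T, g; split => //; first exact: (lip_ploc_of_speed_bound dm Kl K0 T_gt0 U0 cg sb rsP').
apply: le_trans (Klength_le_cost dm Kl K0 T_gt0 U0 cg sb cb wnd rsP') _.
by rewrite lee_fin.
Qed.

End Existence.

Theorem theorem3 (R : realType) (X : completePseudoMetricType R)
    (d : X -> X -> \bar R) (K : X -> \bar R) (xm xp : X)
    (d_metric : emetric d)
    (d_length : length_space d)
    (K_ge0 : forall x, 0 <= K x)
    (K_lsc : lower_semicontinuous K)
    (K_zeros : finite_set [set x | K x = 0])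
    (K_inf : exists F : set X,
      (forall l : R, compact (F `&` [set x | K x <= l%:E])) /\
      Kdist d K xm xp =
        ereal_inf [set L | exists gamma : R -> X,
          [/\ ac_ploc d `[0%R, 1%R] gamma, joins `[0%R, 1%R] gamma xm xp,
              gamma @` [set` `[0%R, 1%R]] `<=` F &
              L = Klength d K `[0%R, 1%R] gamma]])
    (dK_fin : Kdist d K xp xm < +oo) :
  exists (I : interval R) (gamma : R -> X),
    [/\ lip_ploc d I gamma, joins I gamma xp xm &
        Klength d K I gamma = Kdist d K xp xm].
Proof.
have dist_le I g : lip_ploc d I g -> joins I g xp xm -> Kdist d K xp xm <= Klength d K I g.
  by move=> lg jg; apply: ereal_inf_lbound; exists I, g; split => //; exact: lip_ac_ploc.
have [F [cF infF]] := K_inf.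
have dist0 : 0 <= Kdist d K xm xp.
  rewrite infF; apply: le_ereal_inf_tmp => _ [g [_ _ _ ->]]; exact: Klength01_ge0.
have symD : Kdist d K xp xm = Kdist d K xm xp := Kdist_sym d_metric K xp xm.
have finD : Kdist d K xm xp \is a fin_num by rewrite ge0_fin_numE// -symD.
have [xE|xNy] := pselect (xm = xp).
  exists `[0%R, 0%R], (fun=> xp); have lc := constant_lip_ploc d xp.
  have jc : joins `[0%R, 0%R] (fun=> xp) xp xm by rewrite xE.
  split => //; apply/eqP; rewrite eq_le dist_le// andbT.
  by rewrite Klength_point symD.
pose D := fine (Kdist d K xm xp).
have DE : D%:E = Kdist d K xm xp by rewrite fineK.
have D0 : (0 <= D)%R by rewrite -lee_fin DE.
have [|T [g [T0 lg g0 gT gD]]] := @optimal_curve R X d d_metric K K_lsc K_ge0 K_zeros F cF xm xp D xNy D0.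
  move=> n; have n0 : (0 < n.+1%:R^-1 :> R)%R by rewrite invr_gt0 ltr0n.
  have := finD; rewrite infF => finF.
  have [_ [g [[cg pw] [jx jy] gF ->]] gD] := lb_ereal_inf_adherent n0 finF.
  have gE s : s \in `[0%R, 1%R] -> g s = (g \o @clamp R) s by move=> sI /=; rewrite clamp_in.
  exists (g \o @clamp R); split; [split|split].
  - exact: curve_clamp_continuous.
  - exact: piecewise_ac_clamp.
  - by rewrite -!gE// in_itv/= ?lexx ?ler01.
  - move=> t t01; rewrite -gE ?in_itv//; by apply: gF; exists t.
  - by rewrite -(Klength_eq_on d K gE) EFinD DE infF ltW.
exists (opp_itv `[0%R, T]), (g \o -%R).
have lg' := lip_ploc_opp lg.
have jg : joins (opp_itv `[0%R, T]) (g \o -%R) xp xm by apply: joins_opp.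
split => //; apply/eqP; rewrite eq_le dist_le// andbT.
by rewrite Klength_opp symD -DE.
Qed.
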